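(* Let $\mathbf{x}:T^2\to\mathbb{E}^3$ be a smooth immersion of the (oriented) torus whose mean curvature $H$ and Gaussian curvature $K$ satisfy $H=f(H^2-K)$, where $f$ is a smooth function on some interval $(-\epsilon,\infty)$ with $\epsilon>0$. Then $\mathbf{x}$ has no umbilic points and there exists a global positive principal frame field on $T^2$.
   Context: A point is umbilic if the principal curvatures coincide. A positive principal frame field is a smooth oriented orthonormal tangent frame field $(e_1,e_2)$ (together with the oriented unit normal $e_3$) that diagonalizes the second fundamental form, with the principal curvature in direction $e_1$ strictly greater than that in direction $e_2$. *)

(* Defs.v *)
From Stdlib Require Import Reals.
From Coquelicot Require Import Coquelicot.
Open Scope R_scope.

Record V3 := mkV { c1 : R; c2 : R; c3 : R }.

Definition dot (a b : V3) : R := c1 a * c1 b + c2 a * c2 b + c3 a * c3 b.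
Definition cross (a b : V3) : V3 :=
  mkV (c2 a * c3 b - c3 a * c2 b)
      (c3 a * c1 b - c1 a * c3 b)
      (c1 a * c2 b - c2 a * c1 b).
Definition scal (k : R) (a : V3) : V3 := mkV (k * c1 a) (k * c2 a) (k * c3 a).
Definition vnorm (a : V3) : R := sqrt (dot a a).

Definition pu (g : R -> R -> R) (u v : R) : R := Derive (fun t => g t v) u.
Definition pv (g : R -> R -> R) (u v : R) : R := Derive (fun t => g u t) v.

Fixpoint Ck (k : nat) (g : R -> R -> R) : Prop :=
  match k with
  | O => forall u v : R, continuous (fun p : R * R => g (fst p) (snd p)) (u, v)
  | S k' =>
      (forall u v : R, continuous (fun p : R * R => g (fst p) (snd p)) (u, v)) /\
      (forall u v : R, ex_derive (fun t => g t v) u /\ ex_derive (fun t => g u t) v) /\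
      Ck k' (pu g) /\ Ck k' (pv g)
  end.

Definition smooth2 (g : R -> R -> R) : Prop := forall k, Ck k g.

Definition smooth_V3 (x : R -> R -> V3) : Prop :=
  smooth2 (fun u v => c1 (x u v)) /\ smooth2 (fun u v => c2 (x u v)) /\
  smooth2 (fun u v => c3 (x u v)).

(** The torus T^2 = R^2 / Z^2 (with its standard orientation): maps on the
    torus are the Z^2-periodic maps on R^2. *)
Definition periodic2 {A : Type} (x : R -> R -> A) : Prop :=
  forall u v : R, x (u + 1) v = x u v /\ x u (v + 1) = x u v.

Definition dU (x : R -> R -> V3) (u v : R) : V3 :=
  mkV (pu (fun a b => c1 (x a b)) u v) (pu (fun a b => c2 (x a b)) u v)
      (pu (fun a b => c3 (x a b)) u v).
Definition dV (x : R -> R -> V3) (u v : R) : V3 :=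
  mkV (pv (fun a b => c1 (x a b)) u v) (pv (fun a b => c2 (x a b)) u v)
      (pv (fun a b => c3 (x a b)) u v).

Definition torus_immersion (x : R -> R -> V3) : Prop :=
  smooth_V3 x /\ periodic2 x /\
  (forall u v, cross (dU x u v) (dV x u v) <> mkV 0 0 0).

Definition unitN (x : R -> R -> V3) (u v : R) : V3 :=
  scal (/ vnorm (cross (dU x u v) (dV x u v))) (cross (dU x u v) (dV x u v)).

Definition fE x u v := dot (dU x u v) (dU x u v).
Definition fF x u v := dot (dU x u v) (dV x u v).
Definition fG x u v := dot (dV x u v) (dV x u v).
Definition sL x u v := dot (dU (dU x) u v) (unitN x u v).
Definition sM x u v := dot (dV (dU x) u v) (unitN x u v).
Definition sN x u v := dot (dV (dV x) u v) (unitN x u v).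

Definition meanH x u v :=
  (fE x u v * sN x u v - 2 * fF x u v * sM x u v + fG x u v * sL x u v)
  / (2 * (fE x u v * fG x u v - fF x u v ^ 2)).
Definition gaussK x u v :=
  (sL x u v * sN x u v - sM x u v ^ 2) / (fE x u v * fG x u v - fF x u v ^ 2).

Definition kappa1 x u v := meanH x u v + sqrt (meanH x u v ^ 2 - gaussK x u v).
Definition kappa2 x u v := meanH x u v - sqrt (meanH x u v ^ 2 - gaussK x u v).
Definition umbilic x u v : Prop := kappa1 x u v = kappa2 x u v.

(** Second fundamental form evaluated on tangent vectors w, w' at (u,v):
    w = a x_u + b x_v, w' = a' x_u + b' x_v, II(w,w') = L a a' + M (a b' + b a') + N b b'. *)
Definition coefA x u v (w : V3) :=
  (dot w (dU x u v) * fG x u v - dot w (dV x u v) * fF x u v)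
  / (fE x u v * fG x u v - fF x u v ^ 2).
Definition coefB x u v (w : V3) :=
  (dot w (dV x u v) * fE x u v - dot w (dU x u v) * fF x u v)
  / (fE x u v * fG x u v - fF x u v ^ 2).
Definition II x u v (w w' : V3) : R :=
  sL x u v * coefA x u v w * coefA x u v w'
  + sM x u v * (coefA x u v w * coefB x u v w' + coefB x u v w * coefA x u v w')
  + sN x u v * coefB x u v w * coefB x u v w'.

(** A global positive principal frame field on T^2: smooth periodic (e1,e2),
    orthonormal, tangent with (e1,e2,e3) oriented (e1 x e2 = e3 the unit normal),
    diagonalizing II, with principal curvature along e1 strictly greater. *)
Definition positive_principal_frame (x e1 e2 : R -> R -> V3) : Prop :=
  smooth_V3 e1 /\ smooth_V3 e2 /\ periodic2 e1 /\ periodic2 e2 /\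
  forall u v,
    dot (e1 u v) (e1 u v) = 1 /\ dot (e2 u v) (e2 u v) = 1 /\
    dot (e1 u v) (e2 u v) = 0 /\
    cross (e1 u v) (e2 u v) = unitN x u v /\
    II x u v (e1 u v) (e2 u v) = 0 /\
    II x u v (e1 u v) (e1 u v) > II x u v (e2 u v) (e2 u v).

Definition smooth_on_ray (eps : R) (f : R -> R) : Prop :=
  forall (n : nat) (t : R), - eps < t -> ex_derive (Derive_n f n) t.

(* Main.v *)
(** A zero of the trace-free second fundamental form is an umbilic. Since [H = f(H^2 - K)], the differential
    [dH] is of first order in the trace-free form [q], so the Codazzi equations read [dbar q = O(|q|)], and
    [q] satisfies [|grad q|^2 <= c1 Jac q + c2 |q|^2] on the torus. Integrating the exact form
    [Jac q / (|q|^2 + eps)] bounds the Dirichlet energy of [log (|q|^2 + eps)] uniformly in [eps]; in dimension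
    two this is incompatible with a zero of [q] unless [q] vanishes identically. The same dichotomy, applied to
    the tangential part of a constant vector, which is a conformal field on a totally umbilic surface, excludes
    the case [q = 0].

    Without umbilics the principal direction [e1] lifts to the universal cover up to signs under the periods.
    The Codazzi equations provide a function [A > 0] of [H^2 - K] such that [A <e1, dx>] is closed. If a sign
    were -1, the form would have a primitive which is periodic up to sign, hence has a critical point, whereas
    the form has no zero. *)

Require Import Defs.
From Stdlib Require Import Reals Lra Lia ZArith Classical FunctionalExtensionality.
From Coquelicot Require Import Coquelicot.
Open Scope R_scope.

(** * Calculus of two-variable functions *)

(** The coordinates u, v are arbitrary, not isothermal. In them dbar becomes the pair a_v = b_u, b_v
    = 2 al b_u - ga a_u up to O(|q|), with q = (a, b), al = F/E and ga = G/E. It is elliptic since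
    ga - al^2 = det g / E^2 > 0, and minus the Jacobian is then a positive definite form in (a_u,
    b_u); this gives the differential inequality without uniformisation. A zero of q is tested at a
    single scale rho, with eps = rho^2. Near the zero, log |q| is at most log rho + const, whereas
    bounded energy lets averages drop by at most (1/2) |log rho| + const between scales 1 and rho.
    The argument lives on 1/2 < 1. Bounded energy does not control point values in dimension two, so
    averages over segments are compared, and |q| is bounded below on a whole segment. For the frame:
    e1 lies at half the angle of the trace-free form, an angle known only modulo 2 pi; hence the
    signs. A exists because k1 and k1 - k2 are functions of H^2 - K, and d log A = dk1 / (k1 -
    k2). *)

Definition cont2 (g : R -> R -> R) : Prop :=
  forall u v : R, continuous (fun p : R * R => g (fst p) (snd p)) (u, v).

Lemma cont2_pt g u v : cont2 g -> continuity_2d_pt g u v.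
Proof. intros H. apply continuity_2d_pt_filterlim. apply (H u v). Qed.

Lemma cont2_fst : cont2 (fun u _ => u).
Proof. intros u v. apply continuous_fst. Qed.

Lemma cont2_snd : cont2 (fun _ v => v).
Proof. intros u v. apply continuous_snd. Qed.

Lemma cont2_const c : cont2 (fun _ _ => c).
Proof. intros u v. apply continuous_const. Qed.

Lemma cont2_plus g h : cont2 g -> cont2 h -> cont2 (fun u v => g u v + h u v).
Proof. intros Hg Hh u v. apply (continuous_plus (V := R_NormedModule) _ _ _ (Hg u v) (Hh u v)). Qed.

Lemma cont2_minus g h : cont2 g -> cont2 h -> cont2 (fun u v => g u v - h u v).
Proof. intros Hg Hh u v. apply (continuous_minus (V := R_NormedModule) _ _ _ (Hg u v) (Hh u v)). Qed.

Lemma cont2_opp g : cont2 g -> cont2 (fun u v => - g u v).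
Proof. intros Hg u v. apply (continuous_opp (V := R_NormedModule) _ _ (Hg u v)). Qed.

Lemma cont2_mult g h : cont2 g -> cont2 h -> cont2 (fun u v => g u v * h u v).
Proof. intros Hg Hh u v. apply (continuous_mult (K := R_AbsRing) _ _ _ (Hg u v) (Hh u v)). Qed.

Lemma cont2_comp (k : R -> R) g :
  (forall u v, continuous k (g u v)) -> cont2 g -> cont2 (fun u v => k (g u v)).
Proof.
  intros Hk Hg u v.
  apply (continuous_comp (fun p : R * R => g (fst p) (snd p)) k); [apply Hg | apply Hk].
Qed.

Lemma cont2_comp2 g a b :
  cont2 g -> cont2 a -> cont2 b -> cont2 (fun u v => g (a u v) (b u v)).
Proof.
  intros Hg Ha Hb u v.
  apply (continuous_comp_2 (fun p : R * R => a (fst p) (snd p))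
           (fun p : R * R => b (fst p) (snd p)) g);
  [apply Ha | apply Hb | apply Hg].
Qed.

Lemma cont2_inv g : (forall u v, g u v <> 0) -> cont2 g -> cont2 (fun u v => / g u v).
Proof.
  intros H0 Hg. apply (cont2_comp Rinv); [|exact Hg].
  intros u v. apply (ex_derive_continuous Rinv). auto_derive. apply H0.
Qed.

Lemma cont2_div g h : cont2 g -> cont2 h -> (forall u v, h u v <> 0) ->
  cont2 (fun u v => g u v / h u v).
Proof. intros Hg Hh H0. apply cont2_mult; [exact Hg | apply cont2_inv; assumption]. Qed.

Lemma cont2_sqrt g : cont2 g -> cont2 (fun u v => sqrt (g u v)).
Proof. apply cont2_comp. intros u v. apply continuous_sqrt. Qed.

Lemma cont2_section_u g v : cont2 g -> forall u, continuous (fun t => g t v) u.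
Proof.
  intros Hg u.
  apply (continuous_comp_2 (fun t : R => t) (fun _ : R => v) g).
  apply continuous_id. apply continuous_const. apply Hg.
Qed.

Lemma cont2_section_v g u : cont2 g -> forall v, continuous (fun t => g u t) v.
Proof.
  intros Hg v.
  apply (continuous_comp_2 (fun _ : R => u) (fun t : R => t) g).
  apply continuous_const. apply continuous_id. apply Hg.
Qed.

Lemma cont2_RInt_v g u a b : cont2 g -> ex_RInt (fun t => g u t) a b.
Proof. intros Hg. apply (ex_RInt_continuous (V := R_CompleteNormedModule)). intros z _. apply cont2_section_v, Hg. Qed.

Lemma cont2_RInt_u g v a b : cont2 g -> ex_RInt (fun t => g t v) a b.
Proof. intros Hg. apply (ex_RInt_continuous (V := R_CompleteNormedModule)). intros z _. apply cont2_section_u, Hg. Qed.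

Definition partial_u (g gu : R -> R -> R) : Prop :=
  forall u v, is_derive (fun t => g t v) u (gu u v).
Definition partial_v (g gv : R -> R -> R) : Prop :=
  forall u v, is_derive (fun t => g u t) v (gv u v).

Lemma partial_u_unique g h gu hu u v :
  partial_u g gu -> partial_u h hu -> (forall a b, g a b = h a b) -> gu u v = hu u v.
Proof.
  intros Hg Hh Heq. rewrite <- (is_derive_unique _ _ _ (Hg u v)), <- (is_derive_unique _ _ _ (Hh u v)).
  apply Derive_ext. intros t. apply Heq.
Qed.

Lemma partial_v_unique g h gv hv u v :
  partial_v g gv -> partial_v h hv -> (forall a b, g a b = h a b) -> gv u v = hv u v.
Proof.
  intros Hg Hh Heq. rewrite <- (is_derive_unique _ _ _ (Hg u v)), <- (is_derive_unique _ _ _ (Hh u v)).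
  apply Derive_ext. intros t. apply Heq.
Qed.

Lemma is_derive_Rplus (f g : R -> R) x df dg : is_derive f x df -> is_derive g x dg ->
  is_derive (fun t => f t + g t) x (df + dg).
Proof. exact (is_derive_plus (V := R_NormedModule) f g x df dg). Qed.

Lemma is_derive_Rminus (f g : R -> R) x df dg : is_derive f x df -> is_derive g x dg ->
  is_derive (fun t => f t - g t) x (df - dg).
Proof. exact (is_derive_minus (V := R_NormedModule) f g x df dg). Qed.

Lemma is_derive_Rmult (f g : R -> R) x df dg : is_derive f x df -> is_derive g x dg ->
  is_derive (fun t => f t * g t) x (df * g x + f x * dg).
Proof. intros Hf Hg. exact (is_derive_mult (K := R_AbsRing) f g x df dg Hf Hg Rmult_comm). Qed.

Lemma is_derive_Rcomp (k g : R -> R) x dk dg : is_derive k (g x) dk -> is_derive g x dg ->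
  is_derive (fun t => k (g t)) x (dg * dk).
Proof. exact (is_derive_comp k g x dk dg). Qed.

Section Partials.
Variables g h gu hu gv hv : R -> R -> R.

Lemma partial_u_plus : partial_u g gu -> partial_u h hu ->
  partial_u (fun u v => g u v + h u v) (fun u v => gu u v + hu u v).
Proof. intros Hg Hh u v. exact (is_derive_Rplus _ _ u _ _ (Hg u v) (Hh u v)). Qed.
Lemma partial_v_plus : partial_v g gv -> partial_v h hv ->
  partial_v (fun u v => g u v + h u v) (fun u v => gv u v + hv u v).
Proof. intros Hg Hh u v. exact (is_derive_Rplus _ _ v _ _ (Hg u v) (Hh u v)). Qed.
Lemma partial_u_minus : partial_u g gu -> partial_u h hu ->
  partial_u (fun u v => g u v - h u v) (fun u v => gu u v - hu u v).
Proof. intros Hg Hh u v. exact (is_derive_Rminus _ _ u _ _ (Hg u v) (Hh u v)). Qed.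
Lemma partial_v_minus : partial_v g gv -> partial_v h hv ->
  partial_v (fun u v => g u v - h u v) (fun u v => gv u v - hv u v).
Proof. intros Hg Hh u v. exact (is_derive_Rminus _ _ v _ _ (Hg u v) (Hh u v)). Qed.
Lemma partial_u_mult : partial_u g gu -> partial_u h hu ->
  partial_u (fun u v => g u v * h u v) (fun u v => gu u v * h u v + g u v * hu u v).
Proof. intros Hg Hh u v. exact (is_derive_Rmult _ _ u _ _ (Hg u v) (Hh u v)). Qed.
Lemma partial_v_mult : partial_v g gv -> partial_v h hv ->
  partial_v (fun u v => g u v * h u v) (fun u v => gv u v * h u v + g u v * hv u v).
Proof. intros Hg Hh u v. exact (is_derive_Rmult _ _ v _ _ (Hg u v) (Hh u v)). Qed.

Lemma partial_u_comp (k k' : R -> R) : (forall u v, is_derive k (g u v) (k' (g u v))) ->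
  partial_u g gu -> partial_u (fun u v => k (g u v)) (fun u v => gu u v * k' (g u v)).
Proof. intros Hk Hg u v. exact (is_derive_Rcomp k (fun t => g t v) u _ _ (Hk u v) (Hg u v)). Qed.
Lemma partial_v_comp (k k' : R -> R) : (forall u v, is_derive k (g u v) (k' (g u v))) ->
  partial_v g gv -> partial_v (fun u v => k (g u v)) (fun u v => gv u v * k' (g u v)).
Proof. intros Hk Hg u v. exact (is_derive_Rcomp k (fun t => g u t) v _ _ (Hk u v) (Hg u v)). Qed.
End Partials.

Lemma partial_u_const c : partial_u (fun _ _ => c) (fun _ _ => 0).
Proof. intros u v. exact (is_derive_const (V := R_NormedModule) c u). Qed.
Lemma partial_v_const c : partial_v (fun _ _ => c) (fun _ _ => 0).
Proof. intros u v. exact (is_derive_const (V := R_NormedModule) c v). Qed.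

(** Two partial derivatives of which one is continuous already give total differentiability, hence
    the asymmetry between [gu] and [gv]. *)
Lemma is_derive_chain2 g gu gv (a b : R -> R) t a' b' :
  partial_u g gu -> partial_v g gv -> cont2 gu ->
  is_derive a t a' -> is_derive b t b' ->
  is_derive (fun s => g (a s) (b s)) t (gu (a t) (b t) * a' + gv (a t) (b t) * b').
Proof.
  intros Hu Hv Cu Ha Hb.
  assert (HD := is_derive_filterdiff g (a t) (b t) gu (gv (a t) (b t))).
  assert (HD' := HD (filter_forall _ (fun p => Hu (fst p) (snd p))) (Hv _ _) (Cu _ _)).
  unfold is_derive in *.
  eapply filterdiff_ext_lin.
  - apply (filterdiff_comp'_2 a b g t _ _
      (fun x y => plus (scal x (gu (a t) (b t))) (scal y (gv (a t) (b t)))) Ha Hb HD').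
  - intros y. simpl. unfold plus, scal; simpl. unfold mult; simpl. ring.
Qed.

Lemma is_derive_RInt_parameter g gu a b :
  cont2 g -> partial_u g gu -> cont2 gu ->
  forall u, is_derive (fun u => RInt (fun t => g u t) a b) u (RInt (fun t => gu u t) a b).
Proof.
  intros Cg Hu Cu u.
  assert (Heq : forall x y, Derive (fun z => g z y) x = gu x y).
  { intros x y. apply is_derive_unique, Hu. }
  rewrite <- (RInt_ext (fun t => Derive (fun z => g z t) u)).
  2: { intros; apply Heq. }
  apply (is_derive_RInt_param g).
  - apply filter_forall. intros x t _. eexists; apply Hu.
  - intros t _. apply (continuity_2d_pt_ext gu). intros; symmetry; apply Heq.
    apply cont2_pt, Cu.
  - apply filter_forall. intros y. apply cont2_RInt_v, Cg.
Qed.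

(** * Smooth functions *)

Lemma Ck_S k g : Ck (S k) g <->
  cont2 g /\ (forall u v, ex_derive (fun t => g t v) u /\ ex_derive (fun t => g u t) v)
  /\ Ck k (pu g) /\ Ck k (pv g).
Proof. reflexivity. Qed.

Lemma Ck_cont2 k g : Ck k g -> cont2 g.
Proof. destruct k; [auto | intros H; exact (proj1 H)]. Qed.

Lemma Ck_pred k g : Ck (S k) g -> Ck k g.
Proof.
  revert g. induction k as [|k IH]; intros g H.
  - exact (proj1 H).
  - destruct H as (H1 & H2 & H3 & H4). apply Ck_S. auto.
Qed.

Lemma Ck_partial_u k g : Ck (S k) g -> partial_u g (pu g).
Proof. intros (_ & H & _) u v. exact (Derive_correct _ _ (proj1 (H u v))). Qed.

Lemma Ck_partial_v k g : Ck (S k) g -> partial_v g (pv g).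
Proof. intros (_ & H & _) u v. exact (Derive_correct _ _ (proj2 (H u v))). Qed.

(** [Ck] refers to [pu g] and [pv g] themselves; extensionality identifies them with explicit
    formulas, so that the closure properties below go by induction on k. *)
Lemma Ck_intro k g gu gv : cont2 g -> partial_u g gu -> partial_v g gv ->
  Ck k gu -> Ck k gv -> Ck (S k) g.
Proof.
  intros Hc Hu Hv Cu Cv. apply Ck_S. repeat split; auto.
  - eexists; apply Hu.
  - eexists; apply Hv.
  - replace (pu g) with gu; auto.
    extensionality u; extensionality v. symmetry; apply is_derive_unique, Hu.
  - replace (pv g) with gv; auto.
    extensionality u; extensionality v. symmetry; apply is_derive_unique, Hv.
Qed.

Lemma Ck_const k c : Ck k (fun _ _ => c).
Proof.
  revert c; induction k as [|k IH]; intros c.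
  - apply cont2_const.
  - apply (Ck_intro k _ (fun _ _ => 0) (fun _ _ => 0)); auto using cont2_const.
    all: intros u v; auto_derive; auto.
Qed.

Lemma Ck_plus k g h : Ck k g -> Ck k h -> Ck k (fun u v => g u v + h u v).
Proof.
  revert g h; induction k as [|k IH]; intros g h Hg Hh.
  - apply cont2_plus; assumption.
  - apply (Ck_intro k _ (fun u v => pu g u v + pu h u v) (fun u v => pv g u v + pv h u v)).
    + apply cont2_plus; eapply Ck_cont2; eassumption.
    + apply partial_u_plus; eapply Ck_partial_u; eassumption.
    + apply partial_v_plus; eapply Ck_partial_v; eassumption.
    + apply IH; [apply Hg | apply Hh].
    + apply IH; [apply Hg | apply Hh].
Qed.

Lemma Ck_mult k g h : Ck k g -> Ck k h -> Ck k (fun u v => g u v * h u v).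
Proof.
  revert g h; induction k as [|k IH]; intros g h Hg Hh.
  - apply cont2_mult; assumption.
  - apply (Ck_intro k _ (fun u v => pu g u v * h u v + g u v * pu h u v)
                        (fun u v => pv g u v * h u v + g u v * pv h u v)).
    + apply cont2_mult; eapply Ck_cont2; eassumption.
    + apply partial_u_mult; eapply Ck_partial_u; eassumption.
    + apply partial_v_mult; eapply Ck_partial_v; eassumption.
    + pose proof (Ck_pred _ _ Hg). pose proof (Ck_pred _ _ Hh).
      apply Ck_plus; apply IH; auto; [apply Hg | apply Hh].
    + pose proof (Ck_pred _ _ Hg). pose proof (Ck_pred _ _ Hh).
      apply Ck_plus; apply IH; auto; [apply Hg | apply Hh].
Qed.

Lemma Ck_opp k g : Ck k g -> Ck k (fun u v => - g u v).
Proof.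
  intros Hg. replace (fun u v => - g u v) with (fun u v => (-1) * g u v).
  apply Ck_mult; auto using Ck_const.
  extensionality u; extensionality v; ring.
Qed.

Lemma Ck_minus k g h : Ck k g -> Ck k h -> Ck k (fun u v => g u v - h u v).
Proof. intros. apply Ck_plus; auto using Ck_opp. Qed.

(** The derivative of 1/g contains 1/g again, so the induction hypothesis is applied to the same g,
    one order lower. The square root is treated alike. *)
Lemma Ck_inv k g : (forall u v, g u v <> 0) -> Ck k g -> Ck k (fun u v => / g u v).
Proof.
  intros H0. revert g H0; induction k as [|k IH]; intros g H0 Hg.
  - apply cont2_inv; assumption.
  - assert (Hi : Ck k (fun u v => / g u v)) by (apply IH, Ck_pred; assumption).
    apply (Ck_intro k _ (fun u v => - pu g u v * (/ g u v * / g u v))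
                        (fun u v => - pv g u v * (/ g u v * / g u v))).
    + apply cont2_inv; auto. eapply Ck_cont2; eassumption.
    + intros u v. pose proof (Ck_partial_u _ _ Hg u v) as Hd.
      assert (Hx := is_derive_inv _ _ _ Hd (H0 u v)). simpl in Hx.
      replace (- pu g u v * (/ g u v * / g u v)) with (- pu g u v / g u v ^ 2) by (field; auto).
      exact Hx.
    + intros u v. pose proof (Ck_partial_v _ _ Hg u v) as Hd.
      assert (Hx := is_derive_inv _ _ _ Hd (H0 u v)). simpl in Hx.
      replace (- pv g u v * (/ g u v * / g u v)) with (- pv g u v / g u v ^ 2) by (field; auto).
      exact Hx.
    + apply Ck_mult; [apply Ck_opp, Hg | apply Ck_mult; exact Hi].
    + apply Ck_mult; [apply Ck_opp, Hg | apply Ck_mult; exact Hi].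
Qed.

Lemma Ck_sqrt k g : (forall u v, 0 < g u v) -> Ck k g -> Ck k (fun u v => sqrt (g u v)).
Proof.
  intros H0. revert g H0; induction k as [|k IH]; intros g H0 Hg.
  - apply cont2_sqrt; assumption.
  - assert (Hs : Ck k (fun u v => sqrt (g u v))) by (apply IH, Ck_pred; assumption).
    assert (Hi : Ck k (fun u v => / (2 * sqrt (g u v)))).
    { apply Ck_inv; [|apply Ck_mult; auto using Ck_const].
      intros u v. pose proof (sqrt_lt_R0 _ (H0 u v)). lra. }
    apply (Ck_intro k _ (fun u v => pu g u v * / (2 * sqrt (g u v)))
                        (fun u v => pv g u v * / (2 * sqrt (g u v)))).
    + apply cont2_sqrt. eapply Ck_cont2; eassumption.
    + intros u v. pose proof (Ck_partial_u _ _ Hg u v) as Hd.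
      exact (is_derive_sqrt _ _ _ Hd (H0 u v)).
    + intros u v. pose proof (Ck_partial_v _ _ Hg u v) as Hd.
      exact (is_derive_sqrt _ _ _ Hd (H0 u v)).
    + apply Ck_mult; [apply Hg | exact Hi].
    + apply Ck_mult; [apply Hg | exact Hi].
Qed.

(** Joint induction, since each function reappears in the derivative of the other. *)
Lemma Ck_cos_sin k g : Ck k g ->
  Ck k (fun u v => cos (g u v)) /\ Ck k (fun u v => sin (g u v)).
Proof.
  revert g; induction k as [|k IH]; intros g Hg.
  - split; apply cont2_comp; try exact Hg; intros u v;
    [apply continuous_cos | apply continuous_sin].
  - destruct (IH g (Ck_pred _ _ Hg)) as [Hc Hs].
    assert (Hg0 := Ck_cont2 _ _ Hg).
    split.
    + apply (Ck_intro k _ (fun u v => pu g u v * (- sin (g u v)))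
                          (fun u v => pv g u v * (- sin (g u v)))).
      * apply cont2_comp; auto. intros u v; apply continuous_cos.
      * apply (partial_u_comp g (pu g) cos (fun y => - sin y));
        [intros; apply is_derive_cos | eapply Ck_partial_u; eassumption].
      * apply (partial_v_comp g (pv g) cos (fun y => - sin y));
        [intros; apply is_derive_cos | eapply Ck_partial_v; eassumption].
      * apply Ck_mult; [apply Hg | apply Ck_opp, Hs].
      * apply Ck_mult; [apply Hg | apply Ck_opp, Hs].
    + apply (Ck_intro k _ (fun u v => pu g u v * cos (g u v))
                          (fun u v => pv g u v * cos (g u v))).
      * apply cont2_comp; auto. intros u v; apply continuous_sin.
      * apply (partial_u_comp g (pu g) sin cos);
        [intros; apply is_derive_sin | eapply Ck_partial_u; eassumption].
      * apply (partial_v_comp g (pv g) sin cos);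
        [intros; apply is_derive_sin | eapply Ck_partial_v; eassumption].
      * apply Ck_mult; [apply Hg | exact Hc].
      * apply Ck_mult; [apply Hg | exact Hc].
Qed.

Lemma smooth2_cont2 g : smooth2 g -> cont2 g.
Proof. intros H; exact (H O). Qed.
Lemma smooth2_pu g : smooth2 g -> smooth2 (pu g).
Proof. intros H k; apply (H (S k)). Qed.
Lemma smooth2_pv g : smooth2 g -> smooth2 (pv g).
Proof. intros H k; apply (H (S k)). Qed.
Lemma smooth2_partial_u g : smooth2 g -> partial_u g (pu g).
Proof. intros H; apply (Ck_partial_u 0), H. Qed.
Lemma smooth2_partial_v g : smooth2 g -> partial_v g (pv g).
Proof. intros H; apply (Ck_partial_v 0), H. Qed.
Lemma smooth2_const c : smooth2 (fun _ _ => c).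
Proof. intros k; apply Ck_const. Qed.
Lemma smooth2_plus g h : smooth2 g -> smooth2 h -> smooth2 (fun u v => g u v + h u v).
Proof. intros Hg Hh k; apply Ck_plus; auto. Qed.
Lemma smooth2_minus g h : smooth2 g -> smooth2 h -> smooth2 (fun u v => g u v - h u v).
Proof. intros Hg Hh k; apply Ck_minus; auto. Qed.
Lemma smooth2_opp g : smooth2 g -> smooth2 (fun u v => - g u v).
Proof. intros Hg k; apply Ck_opp; auto. Qed.
Lemma smooth2_mult g h : smooth2 g -> smooth2 h -> smooth2 (fun u v => g u v * h u v).
Proof. intros Hg Hh k; apply Ck_mult; auto. Qed.
Lemma smooth2_inv g : smooth2 g -> (forall u v, g u v <> 0) -> smooth2 (fun u v => / g u v).
Proof. intros Hg H0 k; apply Ck_inv; auto. Qed.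
Lemma smooth2_div g h : smooth2 g -> smooth2 h -> (forall u v, h u v <> 0) ->
  smooth2 (fun u v => g u v / h u v).
Proof. intros Hg Hh H0 k; apply Ck_mult, Ck_inv; auto. Qed.
Lemma smooth2_sqrt g : smooth2 g -> (forall u v, 0 < g u v) -> smooth2 (fun u v => sqrt (g u v)).
Proof. intros Hg H0 k; apply Ck_sqrt; auto. Qed.
Lemma smooth2_cos g : smooth2 g -> smooth2 (fun u v => cos (g u v)).
Proof. intros Hg k; apply Ck_cos_sin; auto. Qed.
Lemma smooth2_sin g : smooth2 g -> smooth2 (fun u v => sin (g u v)).
Proof. intros Hg k; apply Ck_cos_sin; auto. Qed.
Lemma smooth2_sqr g : smooth2 g -> smooth2 (fun u v => g u v ^ 2).
Proof.
  intros Hg. replace (fun u v => g u v ^ 2) with (fun u v => g u v * g u v).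
  apply smooth2_mult; assumption.
  extensionality u; extensionality v; ring.
Qed.

Lemma smooth2_intro g gu gv : partial_u g gu -> partial_v g gv -> cont2 g ->
  smooth2 gu -> smooth2 gv -> smooth2 g.
Proof.
  intros Hu Hv Hc Su Sv [|k]; [exact Hc|].
  apply (Ck_intro k g gu gv); auto.
Qed.

Lemma pv_pu_comm g u v : smooth2 g -> pv (pu g) u v = pu (pv g) u v.
Proof.
  intros Hg. symmetry. unfold pu, pv. apply (Schwarz g u v).
  - exists (mkposreal 1 Rlt_0_1). intros u' v' _ _.
    pose proof (Hg 1%nat) as (_ & H1 & _).
    pose proof (smooth2_pv _ Hg 1%nat) as (_ & H2 & _).
    pose proof (smooth2_pu _ Hg 1%nat) as (_ & H3 & _).
    repeat split; [exact (proj1 (H1 u' v')) | exact (proj2 (H1 u' v')) | exact (proj1 (H2 u' v')) | exact (proj2 (H3 u' v'))].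
  - apply (cont2_pt (pu (pv g))), smooth2_cont2, smooth2_pu, smooth2_pv, Hg.
  - apply (cont2_pt (pv (pu g))), smooth2_cont2, smooth2_pv, smooth2_pu, Hg.
Qed.

(** * Doubly periodic functions *)

Lemma periodic2_pu g : periodic2 g -> periodic2 (pu g).
Proof.
  intros Hg u v. unfold pu. split.
  - rewrite <- (Derive_ext (fun t => g (t + 1) v) (fun t => g t v) u) by (intros t; apply Hg).
    unfold Derive. f_equal. apply Lim_ext. intros y. now replace (u + 1 + y) with (u + y + 1) by ring.
  - apply Derive_ext. intros t. apply Hg.
Qed.

Lemma periodic2_pv g : periodic2 g -> periodic2 (pv g).
Proof.
  intros Hg u v. unfold pv. split.
  - apply Derive_ext. intros t. apply Hg.
  - rewrite <- (Derive_ext (fun t => g u (t + 1)) (fun t => g u t) v) by (intros t; apply Hg).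
    unfold Derive. f_equal. apply Lim_ext. intros y. now replace (v + 1 + y) with (v + y + 1) by ring.
Qed.

Lemma periodic2_comp {A B : Type} (k : A -> B) g : periodic2 g -> periodic2 (fun u v => k (g u v)).
Proof. intros Hg u v. destruct (Hg u v) as [H1 H2]. now rewrite H1, H2. Qed.

Lemma periodic2_comp2 {A B C : Type} (k : A -> B -> C) g h :
  periodic2 g -> periodic2 h -> periodic2 (fun u v => k (g u v) (h u v)).
Proof. intros Hg Hh u v. destruct (Hg u v) as [H1 H2], (Hh u v) as [H3 H4]. now rewrite H1, H2, H3, H4. Qed.

Lemma periodic2_const {A : Type} (c : A) : periodic2 (fun _ _ => c).
Proof. intros u v; auto. Qed.

Lemma periodic_nat {A : Type} (k : R -> A) n : (forall t, k (t + 1) = k t) -> forall t, k (t + INR n) = k t.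
Proof.
  intros H t. induction n as [|n IH]; [now rewrite Rplus_0_r|].
  rewrite S_INR, <- Rplus_assoc, H. exact IH.
Qed.

Lemma periodic_Z {A : Type} (k : R -> A) z : (forall t, k (t + 1) = k t) -> forall t, k (t + IZR z) = k t.
Proof.
  intros H t. destruct (Z_le_gt_dec 0 z) as [Hz|Hz].
  - rewrite <- (Z2Nat.id z Hz), <- INR_IZR_INZ. now apply periodic_nat.
  - rewrite <- (periodic_nat k (Z.to_nat (- z)) H (t + IZR z)).
    f_equal. rewrite INR_IZR_INZ, Z2Nat.id by lia. rewrite opp_IZR. ring.
Qed.

(** The cell is anchored at a free corner, later a zero of q, and is half-open: the strict bound
    leaves room for a segment to the right of the reduced point. *)
Lemma periodic2_reduce {A : Type} (g : R -> R -> A) u0 v0 u v : periodic2 g ->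
  exists u' v', u0 <= u' < u0 + 1 /\ v0 <= v' < v0 + 1 /\ g u v = g u' v'.
Proof.
  intros Hg.
  (* [up r] is the integer part of r plus one, so [1 - up r] is minus the integer part. *)
  exists (u + IZR (1 - up (u - u0))), (v + IZR (1 - up (v - v0))).
  rewrite (periodic_Z (fun t => g t _)) by (intros; apply Hg).
  rewrite (periodic_Z (fun t => g u t)) by (intros; apply Hg).
  rewrite !minus_IZR. destruct (archimed (u - u0)), (archimed (v - v0)). repeat split; lra.
Qed.

(** The ray from the origin to a point of the unit square is cut into n steps, with 1/n below the
    modulus of uniform continuity for oscillation 1; |g| grows by at most 1 per step. *)
Lemma periodic2_bounded g : cont2 g -> periodic2 g ->
  exists B, 0 < B /\ forall u v, Rabs (g u v) <= B.
Proof.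
  intros Hc Hp.
  destruct (uniform_continuity_2d g 0 1 0 1 (fun x y _ _ => cont2_pt g x y Hc) (mkposreal 1 Rlt_0_1))
    as [d Hd]. simpl in Hd.
  destruct (archimed_cor1 d (cond_pos d)) as [n [Hn Hn0]].
  assert (HnR : 0 < INR n) by (apply lt_0_INR; lia).
  assert (Hstep : forall k u v, (k <= n)%nat -> 0 <= u <= 1 -> 0 <= v <= 1 ->
     Rabs (g (INR k / INR n * u) (INR k / INR n * v)) <= Rabs (g 0 0) + INR k).
  { intros k u v Hk Hu Hv. induction k as [|k IH].
    - simpl. unfold Rdiv. rewrite !Rmult_0_l. lra.
    - assert (Hin : forall j w, (j <= n)%nat -> 0 <= w <= 1 -> 0 <= INR j / INR n * w <= 1).
      { intros j w Hj Hw. assert (INR j <= INR n) by (apply le_INR; lia). pose proof (pos_INR j).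
        assert (0 <= INR j / INR n <= 1).
        { split. apply Rdiv_le_0_compat; lra. apply (Rmult_le_reg_r (INR n)); auto.
          unfold Rdiv; rewrite Rmult_assoc, Rinv_l; lra. }
        nra. }
      assert (Hdiff : forall w, 0 <= w <= 1 -> Rabs (INR (S k) / INR n * w - INR k / INR n * w) < d).
      { intros w Hw. rewrite S_INR.
        replace ((INR k + 1) / INR n * w - INR k / INR n * w) with (/ INR n * w) by (field; lra).
        pose proof (Rinv_0_lt_compat _ HnR). rewrite Rabs_pos_eq; nra. }
      specialize (IH ltac:(lia)).
      assert (H := Hd (INR k / INR n * u) (INR k / INR n * v) (INR (S k) / INR n * u) (INR (S k) / INR n * v)
        (Hin k u ltac:(lia) Hu) (Hin k v ltac:(lia) Hv) (Hin (S k) u Hk Hu) (Hin (S k) v Hk Hv)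
        (Hdiff u Hu) (Hdiff v Hv)).
      rewrite S_INR at 3.
      pose proof (Rabs_triang (g (INR (S k) / INR n * u) (INR (S k) / INR n * v) - g (INR k / INR n * u) (INR k / INR n * v))
        (g (INR k / INR n * u) (INR k / INR n * v))) as Ht.
      replace (g (INR (S k) / INR n * u) (INR (S k) / INR n * v) - g (INR k / INR n * u) (INR k / INR n * v)
        + g (INR k / INR n * u) (INR k / INR n * v)) with (g (INR (S k) / INR n * u) (INR (S k) / INR n * v)) in Ht by ring.
      lra. }
  exists (Rabs (g 0 0) + INR n). split.
  - pose proof (Rabs_pos (g 0 0)); lra.
  - intros u v. destruct (periodic2_reduce g 0 0 u v Hp) as (u' & v' & Hu & Hv & ->).
    specialize (Hstep n u' v' (le_n _)). replace (INR n / INR n) with 1 in Hstep by (field; lra).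
    rewrite !Rmult_1_l in Hstep. apply Hstep; lra.
Qed.

(* If the supremum were not attained, 1/(sup - g) would be continuous, periodic and unbounded. *)
Lemma periodic2_max g : cont2 g -> periodic2 g -> exists u0 v0, forall u v, g u v <= g u0 v0.
Proof.
  intros Hc Hp.
  destruct (periodic2_bounded g Hc Hp) as [B [_ HB]].
  destruct (completeness (fun y => exists u v, y = g u v)) as [S [HS1 HS2]].
  { exists B. intros y (u & v & ->). specialize (HB u v). apply Rabs_le_between in HB. lra. }
  { exists (g 0 0); eauto. }
  destruct (classic (exists u v, g u v = S)) as [(u & v & HE)|HN].
  { exists u, v. intros u' v'. rewrite HE. apply HS1; eauto. }
  exfalso.
  assert (Hlt : forall u v, 0 < S - g u v).
  { intros u v. assert (g u v <= S) by (apply HS1; eauto).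
    destruct (Req_dec (g u v) S); [exfalso; eauto | lra]. }
  destruct (periodic2_bounded (fun u v => / (S - g u v))) as [B' [HB'0 HB']].
  { apply cont2_inv. intros u v; specialize (Hlt u v); lra.
    apply cont2_minus; auto using cont2_const. }
  { apply (periodic2_comp (fun y => / (S - y))), Hp. }
  assert (HH : S <= S - / B').
  { apply HS2. intros y (u & v & ->). specialize (HB' u v). specialize (Hlt u v).
    apply Rabs_le_between in HB'.
    assert (/ B' <= S - g u v); [|lra].
    rewrite <- (Rinv_inv (S - g u v)). apply Rinv_le_contravar; [|lra].
    apply Rinv_0_lt_compat, Hlt. }
  pose proof (Rinv_0_lt_compat _ HB'0). lra.
Qed.

Lemma is_derive_at_max (k : R -> R) t l :
  is_derive k t l -> (forall s, k s <= k t) -> l = 0.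
Proof.
  intros Hd Hm. apply is_derive_Reals in Hd.
  assert (pr : derivable_pt k t) by (exists l; exact Hd).
  rewrite <- (derive_pt_eq_0 k t l pr Hd).
  apply (deriv_maximum k (t - 1) (t + 1) t pr); try lra. intros; apply Hm.
Qed.

Lemma partials_zero_const g : partial_u g (fun _ _ => 0) -> partial_v g (fun _ _ => 0) ->
  forall u v u' v', g u v = g u' v'.
Proof.
  intros Hu Hv u v u' v'.
  assert (H0 : forall k : R -> R, (forall t, is_derive k t 0) -> forall a b, k a = k b).
  { intros k Hk a b. destruct (MVT_gen k a b (fun _ => 0)) as (c & _ & Hc).
    intros; apply Hk. intros; apply derivable_continuous_pt. exists 0. apply is_derive_Reals, Hk.
    lra. }
  rewrite (H0 (fun t => g t v) (fun t => Hu t v) u u').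
  apply (H0 (fun t => g u' t) (fun t => Hv u' t)).
Qed.

(** * The Poincare lemma on the plane *)

(** The primitive integrates along the axis v = 0 and then vertically. The common derivative [S]
    expresses closedness and supplies the continuity needed to differentiate under the integral. *)
Lemma closed_form_exact P Q S :
  cont2 P -> cont2 Q -> cont2 S -> partial_v P S -> partial_u Q S ->
  exists phi, partial_u phi P /\ partial_v phi Q /\ cont2 phi.
Proof.
  intros CP CQ CS HP HQ.
  set (phi := fun u v => RInt (fun s => P s 0) 0 u + RInt (fun s => Q u s) 0 v).
  assert (Hu : partial_u phi P).
  { intros u v. unfold phi.
    replace (P u v) with (P u 0 + RInt (fun s => S u s) 0 v).
    - apply (is_derive_plus (V := R_NormedModule)).
      + apply (is_derive_RInt (V := R_NormedModule) (fun s => P s 0) _ 0 u).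
        * apply filter_forall. intros b. apply (RInt_correct (V := R_CompleteNormedModule)), cont2_RInt_u, CP.
        * apply cont2_section_u, CP.
      + apply is_derive_RInt_parameter; auto.
    - assert (H := is_RInt_derive (V := R_CompleteNormedModule) (fun s => P u s) (fun s => S u s) 0 v).
      rewrite (is_RInt_unique _ _ _ _ (H (fun x _ => HP u x) (fun x _ => cont2_section_v S u CS x))).
      unfold minus, plus, opp; simpl. ring. }
  assert (Hv : partial_v phi Q).
  { intros u v. unfold phi.
    replace (Q u v) with (0 + Q u v) by ring.
    apply (is_derive_plus (V := R_NormedModule)).
    - apply (is_derive_const (V := R_NormedModule)).
    - apply (is_derive_RInt (V := R_NormedModule) (fun s => Q u s) _ 0 v).
      + apply filter_forall. intros b. apply (RInt_correct (V := R_CompleteNormedModule)), cont2_RInt_v, CQ.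
      + apply cont2_section_v, CQ. }
  exists phi. split; [exact Hu | split; [exact Hv|]].
  intros u v.
  apply (filterdiff_continuous (fun p : R * R => phi (fst p) (snd p))).
  eexists. apply (is_derive_filterdiff phi u v P (Q u v)).
  - apply filter_forall. intros p; apply Hu.
  - apply Hv.
  - apply CP.
Qed.

(** * Logarithms of planar maps with small Cauchy-Riemann defect *)

Lemma is_derive_nonneg_le (k k' : R -> R) a b : a <= b ->
  (forall t, a <= t <= b -> is_derive k t (k' t)) ->
  (forall t, a <= t <= b -> 0 <= k' t) -> k a <= k b.
Proof.
  intros Hab Hd Hp.
  destruct (MVT_gen k a b k') as (c & Hc & HE).
  - rewrite Rmin_left, Rmax_right by lra. intros x Hx; apply Hd; lra.
  - rewrite Rmin_left, Rmax_right by lra. intros x Hx. apply derivable_continuous_pt.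
    exists (k' x). apply is_derive_Reals, Hd, Hx.
  - rewrite Rmin_left, Rmax_right in Hc by lra. specialize (Hp c Hc). nra.
Qed.

Lemma RInt_subinterval_le (k : R -> R) a b c d : (forall z, continuous k z) ->
  (forall z, 0 <= k z) -> a <= b -> b <= c -> c <= d -> RInt k b c <= RInt k a d.
Proof.
  intros Hc Hp Hab Hbc Hcd.
  assert (Hex : forall x y, ex_RInt k x y).
  { intros x y. apply (ex_RInt_continuous (V := R_CompleteNormedModule)). intros; apply Hc. }
  rewrite <- (RInt_Chasles k a b d), <- (RInt_Chasles k b c d) by auto.
  pose proof (RInt_ge_0 k a b Hab (Hex a b) (fun x _ => Hp x)).
  pose proof (RInt_ge_0 k c d Hcd (Hex c d) (fun x _ => Hp x)).
  unfold plus; simpl. lra.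
Qed.

Section LogEnergy.

(** [EE] is a primitive in u of the energy of the vertical lines. It replaces double integrals: its
    increment over a period, [E], is the total energy of the torus, and integration in u becomes
    monotonicity of a function of u. *)
Variables (w wu wv e : R -> R -> R) (EE : R -> R) (u0 v0 E : R).
Hypothesis w_cont : cont2 w.
Hypothesis wu_cont : cont2 wu.
Hypothesis wv_cont : cont2 wv.
Hypothesis e_cont : cont2 e.
Hypothesis w_partial_u : partial_u w wu.
Hypothesis w_partial_v : partial_v w wv.
Hypothesis w_periodic : periodic2 w.
Hypothesis energy : forall u v, wu u v ^ 2 + wv u v ^ 2 <= e u v.
Hypothesis EE_derive : forall u, is_derive EE u (RInt (fun v => e u v) v0 (v0 + 1)).
Hypothesis EE_period : EE (u0 + 1) = EE u0 + E.

Lemma energy_nonneg u v : 0 <= e u v.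
Proof.
  pose proof (energy u v). pose proof (pow2_ge_0 (wu u v)). pose proof (pow2_ge_0 (wv u v)). lra.
Qed.

Lemma EE_nondecreasing a b : a <= b -> EE a <= EE b.
Proof.
  intros Hab. apply (is_derive_nonneg_le EE (fun u => RInt (fun v => e u v) v0 (v0 + 1))); auto.
  intros t _. apply RInt_ge_0; [lra | apply cont2_RInt_v, e_cont | intros; apply energy_nonneg].
Qed.

(** The mean [m t] of w over the vertical segment of length t at abscissa u0 + t is followed from t
    = rho to t = 1; these segments sweep a triangle with vertex (u0, v0), and the last one is a full
    period, identified with the line over u0. The derivative of m exceeds the line energy by at most
    1/(2t), which integrates to - (1/2) ln rho. *)
Lemma triangle_average_growth rho : 0 < rho <= 1 ->
  RInt (fun v => w u0 v) v0 (v0 + 1)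
  <= RInt (fun s => w (u0 + rho) (v0 + rho * s)) 0 1 + E - / 2 * ln rho.
Proof.
  intros Hrho.
  set (g := fun t s => w (u0 + t) (v0 + t * s)).
  set (gt := fun t s => wu (u0 + t) (v0 + t * s) * 1 + wv (u0 + t) (v0 + t * s) * s).
  assert (Ca : cont2 (fun t _ : R => u0 + t)) by (apply cont2_plus; [apply cont2_const | apply cont2_fst]).
  assert (Cb : cont2 (fun t s => v0 + t * s)).
  { apply cont2_plus; [apply cont2_const | apply cont2_mult; [apply cont2_fst | apply cont2_snd]]. }
  assert (Cg : cont2 g) by (apply (cont2_comp2 w); auto).
  assert (Cgt : cont2 gt).
  { apply cont2_plus; apply cont2_mult; try apply cont2_const; try apply cont2_snd; apply cont2_comp2; auto. }
  assert (Hgt : partial_u g gt).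
  { intros t s. apply (is_derive_chain2 w wu wv (fun t => u0 + t) (fun t => v0 + t * s)); auto.
    auto_derive; auto; ring. auto_derive; auto; ring. }
  assert (Hbound : forall t, 0 < t <= 1 ->
    RInt (fun s => gt t s) 0 1 <= RInt (fun v => e (u0 + t) v) v0 (v0 + 1) + / (2 * t)).
  { intros t Ht.
    set (k := fun v => e (u0 + t) v).
    assert (Hk : forall z, continuous k z) by (intros z; apply (cont2_section_v e), e_cont).
    apply Rle_trans with (RInt (fun s => t * k (t * s + v0) + / (2 * t)) 0 1).
    - apply RInt_le; [lra | apply cont2_RInt_v, Cgt | |].
      + apply (ex_RInt_continuous (V := R_CompleteNormedModule)). intros z _.
        apply (continuous_plus (V := R_NormedModule)); [|apply continuous_const].
        apply (continuous_mult (K := R_AbsRing) (fun _ => t)); [apply continuous_const|].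
        apply (continuous_comp (fun s => t * s + v0) k); [|apply Hk].
        apply (ex_derive_continuous (fun s => t * s + v0)). auto_derive; auto.
      + intros s Hs. unfold k, gt. replace (t * s + v0) with (v0 + t * s) by ring.
        pose proof (energy (u0 + t) (v0 + t * s)) as He.
        set (p := wu (u0 + t) (v0 + t * s)) in *. set (q := wv (u0 + t) (v0 + t * s)) in *.
        set (ee := e (u0 + t) (v0 + t * s)) in *.
        (* The weight t in this arithmetic-geometric inequality is the Jacobian of s -> v0 + t s, so
           t e becomes the energy of the segment. The two remainders 1/(4t), here and in [H2], add
           up to 1/(2t) and fix the coefficient 1/2 of the logarithm. *)
        assert (H1 : p <= t * p ^ 2 + / (4 * t)).
        { assert (t * p ^ 2 + / (4 * t) - p = / (4 * t) * (2 * t * p - 1) ^ 2) by (field; lra).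
          assert (0 < / (4 * t)) by (apply Rinv_0_lt_compat; lra).
          pose proof (pow2_ge_0 (2 * t * p - 1)). nra. }
        assert (H2 : q * s <= t * q ^ 2 + / (4 * t)).
        { assert (t * q ^ 2 + / (4 * t) - q = / (4 * t) * (2 * t * q - 1) ^ 2) by (field; lra).
          assert (0 < / (4 * t)) by (apply Rinv_0_lt_compat; lra).
          pose proof (pow2_ge_0 (2 * t * q - 1)).
          destruct (Rle_dec 0 q); [|pose proof (pow2_ge_0 q)]; nra. }
        assert (Hq : / (2 * t) = / (4 * t) + / (4 * t)) by (field; lra).
        rewrite Hq. assert (t * (p ^ 2 + q ^ 2) <= t * ee) by (apply Rmult_le_compat_l; lra). lra.
    - rewrite (RInt_plus (V := R_CompleteNormedModule) (fun s => t * k (t * s + v0)) (fun _ => / (2 * t))).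
      2: { apply (ex_RInt_comp_lin (V := R_NormedModule) k t v0 0 1).
           apply (ex_RInt_continuous (V := R_CompleteNormedModule)). intros; apply Hk. }
      2: { apply ex_RInt_const. }
      rewrite RInt_const.
      assert (Hlin : RInt (fun s => t * k (t * s + v0)) 0 1 = RInt k (t * 0 + v0) (t * 1 + v0)).
      { apply (RInt_comp_lin (V := R_CompleteNormedModule) k t v0 0 1).
        apply (ex_RInt_continuous (V := R_CompleteNormedModule)). intros; apply Hk. }
      rewrite Hlin.
      assert (RInt k (t * 0 + v0) (t * 1 + v0) <= RInt k v0 (v0 + 1)).
      { apply RInt_subinterval_le; auto; try lra. intros; apply energy_nonneg. }
      unfold plus, scal; simpl; unfold mult; simpl. lra. }
  set (m := fun t => RInt (fun s => g t s) 0 1).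
  assert (Hmono : EE (u0 + rho) + / 2 * ln rho - m rho <= EE (u0 + 1) + / 2 * ln 1 - m 1).
  { apply (is_derive_nonneg_le (fun t => EE (u0 + t) + / 2 * ln t - m t)
      (fun t => RInt (fun v => e (u0 + t) v) v0 (v0 + 1) + / (2 * t) - RInt (fun s => gt t s) 0 1)).
    - lra.
    - intros t Ht. apply is_derive_Rminus; [apply is_derive_Rplus|].
      + assert (Hsh : is_derive (fun t => u0 + t) t 1) by (auto_derive; auto).
        assert (HH := is_derive_Rcomp EE (fun t => u0 + t) t _ _ (EE_derive (u0 + t)) Hsh).
        rewrite Rmult_1_l in HH. exact HH.
      + auto_derive; [lra | field; lra].
      + apply is_derive_RInt_parameter; auto.
    - intros t Ht. specialize (Hbound t ltac:(lra)). lra. }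
  rewrite ln_1 in Hmono.
  assert (Hm1 : m 1 = RInt (fun v => w u0 v) v0 (v0 + 1)).
  { unfold m, g.
    rewrite (RInt_ext (fun s => w (u0 + 1) (v0 + 1 * s)) (fun s => scal 1 (w u0 (1 * s + v0)))).
    - rewrite (RInt_comp_lin (V := R_CompleteNormedModule) (fun v => w u0 v)).
      + now replace (1 * 0 + v0) with v0 by ring; replace (1 * 1 + v0) with (v0 + 1) by ring.
      + apply cont2_RInt_v, w_cont.
    - intros s _. rewrite (proj1 (w_periodic u0 _)). unfold scal; simpl; unfold mult; simpl.
      rewrite !Rmult_1_l. now rewrite Rplus_comm. }
  assert (EE u0 <= EE (u0 + rho)) by (apply EE_nondecreasing; lra).
  rewrite <- Hm1. unfold m in *. unfold g in Hmono at 1. lra.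
Qed.

(** From w_u <= w_u^2 + 1, the line average grows in u at most at the rate of the line energy plus
    1. *)
Lemma line_average_growth u : u0 <= u <= u0 + 1 ->
  RInt (fun v => w u v) v0 (v0 + 1) <= RInt (fun v => w u0 v) v0 (v0 + 1) + E + 1.
Proof.
  intros Hu.
  assert (Hmono : EE u0 + u0 - RInt (fun v => w u0 v) v0 (v0 + 1)
               <= EE u + u - RInt (fun v => w u v) v0 (v0 + 1)).
  { apply (is_derive_nonneg_le (fun u => EE u + u - RInt (fun v => w u v) v0 (v0 + 1))
      (fun u => RInt (fun v => e u v) v0 (v0 + 1) + 1 - RInt (fun v => wu u v) v0 (v0 + 1))).
    - lra.
    - intros t _. apply is_derive_Rminus; [apply is_derive_Rplus|].
      + apply EE_derive.
      + apply (is_derive_id (K := R_AbsRing)).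
      + apply is_derive_RInt_parameter; auto.
    - intros t _.
      assert (RInt (fun v => wu t v) v0 (v0 + 1) <= RInt (fun v => e t v + 1) v0 (v0 + 1)).
      { apply RInt_le; [lra | apply cont2_RInt_v, wu_cont | |].
        - apply (cont2_RInt_v (fun u v => e u v + 1)), cont2_plus; auto using cont2_const.
        - intros v _. pose proof (energy t v). pose proof (pow2_ge_0 (wv t v)).
          pose proof (pow2_ge_0 (wu t v - 1)). nra. }
      rewrite (RInt_plus (V := R_CompleteNormedModule) (fun v => e t v) (fun _ => 1)) in H.
      2: apply cont2_RInt_v, e_cont.
      2: apply ex_RInt_const.
      rewrite RInt_const in H. unfold plus, scal in H; simpl in H; unfold mult in H; simpl in H. lra. }
  assert (EE u <= EE (u0 + 1)) by (apply EE_nondecreasing; lra). lra.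
Qed.

(** Along a line, w oscillates by at most the integral of |w_v| <= e + 1, whose primitive is [k].
    The energy of that very line enters; it may be large for some u, so the bound is meant to be
    integrated in u. *)
Lemma value_le_line_average u v1 : v0 <= v1 <= v0 + 1 ->
  w u v1 <= RInt (fun v => w u v) v0 (v0 + 1) + 1 + RInt (fun v => e u v) v0 (v0 + 1).
Proof.
  intros Hv1. set (I := RInt (fun v => e u v) v0 (v0 + 1)).
  set (k := fun v => RInt (fun s => e u s + 1) v0 v).
  assert (Ce1 : cont2 (fun u v => e u v + 1)) by (apply cont2_plus; auto using cont2_const).
  assert (Hk : forall v, is_derive k v (e u v + 1)).
  { intros v. apply (is_derive_RInt (V := R_NormedModule) (fun s => e u s + 1) _ v0 v).
    - apply filter_forall. intros b. apply (RInt_correct (V := R_CompleteNormedModule)).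
      apply (cont2_RInt_v _ u v0 b Ce1).
    - apply (cont2_section_v _ u Ce1). }
  assert (Hk0 : k v0 = 0) by (unfold k; now rewrite RInt_point).
  assert (Hk1 : k (v0 + 1) = I + 1).
  { unfold k. rewrite (RInt_plus (V := R_CompleteNormedModule) (fun v => e u v) (fun _ => 1)).
    2: apply cont2_RInt_v, e_cont.
    2: apply ex_RInt_const.
    rewrite RInt_const. unfold plus, scal; simpl; unfold mult; simpl. unfold I. ring. }
  assert (Hkm : forall a b, a <= b -> k a <= k b).
  { intros a b Hab. apply (is_derive_nonneg_le k (fun v => e u v + 1)); auto.
    intros t _. pose proof (energy_nonneg u t). lra. }
  assert (Hpt : forall v, v0 <= v <= v0 + 1 -> w u v1 - I - 1 <= w u v).
  { intros v Hv.
    assert (Hup : forall a b, a <= b -> w u b - w u a <= k b - k a).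
    { intros a b Hab.
      assert (k a - w u a <= k b - w u b); [|lra].
      apply (is_derive_nonneg_le (fun v => k v - w u v) (fun v => e u v + 1 - wv u v)); auto.
      - intros t _. apply is_derive_Rminus; auto.
      - intros t _. pose proof (energy u t). pose proof (pow2_ge_0 (wu u t)).
        pose proof (pow2_ge_0 (wv u t - 1)). nra. }
    assert (Hdn : forall a b, a <= b -> w u a - w u b <= k b - k a).
    { intros a b Hab.
      assert (k a + w u a <= k b + w u b); [|lra].
      apply (is_derive_nonneg_le (fun v => k v + w u v) (fun v => e u v + 1 + wv u v)); auto.
      - intros t _. apply is_derive_Rplus; auto.
      - intros t _. pose proof (energy u t). pose proof (pow2_ge_0 (wu u t)).
        pose proof (pow2_ge_0 (wv u t + 1)). nra. }
    destruct (Rle_dec v v1).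
    - pose proof (Hup v v1 ltac:(lra)). pose proof (Hkm v0 v ltac:(lra)).
      pose proof (Hkm v1 (v0 + 1) ltac:(lra)). lra.
    - pose proof (Hdn v1 v ltac:(lra)). pose proof (Hkm v0 v1 ltac:(lra)).
      pose proof (Hkm v (v0 + 1) ltac:(lra)). lra. }
  assert (RInt (fun _ => w u v1 - I - 1) v0 (v0 + 1) <= RInt (fun v => w u v) v0 (v0 + 1)).
  { apply RInt_le; [lra | apply ex_RInt_const | apply cont2_RInt_v, w_cont |].
    intros v Hv; apply Hpt; lra. }
  rewrite RInt_const in H. unfold scal in H; simpl in H; unfold mult in H; simpl in H. lra.
Qed.

(** The three preceding bounds chain to: the bracket is at most the energy of the line over u, for
    each u in [u1, u2]. Integrating in u leaves at most the total energy. This is why w must be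
    bounded below on a segment transversal to the lines. *)
Lemma log_energy_estimate rho K k u1 u2 v1 : 0 < rho <= 1 ->
  (forall s, 0 <= s <= 1 -> w (u0 + rho) (v0 + rho * s) <= K) ->
  u0 <= u1 -> u1 <= u2 -> u2 <= u0 + 1 -> v0 <= v1 <= v0 + 1 ->
  (forall u, u1 <= u <= u2 -> k <= w u v1) ->
  (u2 - u1) * (k - K - 2 * E - 2 + / 2 * ln rho) <= E.
Proof.
  intros Hrho HK H01 H12 H2 Hv1 Hk.
  assert (HKI : RInt (fun s => w (u0 + rho) (v0 + rho * s)) 0 1 <= K).
  { replace K with (RInt (fun _ : R => K) 0 1).
    2: { rewrite RInt_const. unfold scal; simpl; unfold mult; simpl. ring. }
    apply RInt_le; [lra | | apply ex_RInt_const | intros; apply HK; lra].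
    apply (cont2_RInt_v (fun t s => w (u0 + t) (v0 + t * s))).
    apply (cont2_comp2 w); auto.
    - apply cont2_plus; [apply cont2_const | apply cont2_fst].
    - apply cont2_plus; [apply cont2_const | apply cont2_mult; [apply cont2_fst | apply cont2_snd]]. }
  pose proof (triangle_average_growth rho Hrho) as HT.
  set (c := k - K - 2 * E - 2 + / 2 * ln rho).
  assert (EE u1 - c * u1 <= EE u2 - c * u2).
  { apply (is_derive_nonneg_le (fun u => EE u - c * u)
      (fun u => RInt (fun v => e u v) v0 (v0 + 1) - c)); auto.
    - intros t _. apply is_derive_Rminus; auto. auto_derive; auto; ring.
    - intros t Ht. pose proof (line_average_growth t ltac:(lra)).
      pose proof (value_le_line_average t v1 Hv1). specialize (Hk t Ht). unfold c. lra. }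
  pose proof (EE_nondecreasing u0 u1 H01). pose proof (EE_nondecreasing u2 (u0 + 1) H2). nra.
Qed.

End LogEnergy.

(* With s = sqrt (y^2 + eps), the function atan (x / s) / s is a primitive in x of 1 / (x^2 + y^2 + eps),
   so the pullback of the area form weighted by 1 / (x^2 + y^2 + eps) is exact on the torus. *)
Definition area_primitive (eps x y : R) : R := atan (x / sqrt (y ^ 2 + eps)) / sqrt (y ^ 2 + eps).

(** The derivative of [area_primitive] in y; its two contributions to the Jacobian identity cancel,
    as dy wedge dy = 0. *)
Definition area_primitive_y (eps x y : R) : R :=
  - (x * y) / ((x ^ 2 + y ^ 2 + eps) * (y ^ 2 + eps))
  - y * atan (x / sqrt (y ^ 2 + eps)) / ((y ^ 2 + eps) * sqrt (y ^ 2 + eps)).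

Lemma is_derive_area_primitive eps (a b : R -> R) t a' b' : 0 < eps ->
  is_derive a t a' -> is_derive b t b' ->
  is_derive (fun s => area_primitive eps (a s) (b s)) t
    (a' / (a t ^ 2 + b t ^ 2 + eps) + b' * area_primitive_y eps (a t) (b t)).
Proof.
  intros He Ha Hb. unfold area_primitive, area_primitive_y.
  assert (Hy : 0 < b t ^ 2 + eps) by (pose proof (pow2_ge_0 (b t)); lra).
  pose proof (sqrt_lt_R0 _ Hy) as Hs. pose proof (sqrt_sqrt (b t ^ 2 + eps) (Rlt_le _ _ Hy)) as Hss.
  pose proof (pow2_ge_0 (a t)) as Ha2.
  assert (Hda := is_derive_unique _ _ _ Ha). assert (Hdb := is_derive_unique _ _ _ Hb).
  change (Derive (fun x => a x) t = a') in Hda. change (Derive (fun x => b x) t = b') in Hdb.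
  auto_derive.
  - simpl in Hy, Hs. repeat split; try lra; try (eexists; eassumption).
  - rewrite Hda, Hdb. clear Ha Hb Hda Hdb. generalize dependent (a t). generalize dependent (b t).
    intros y Hy Hs Hss x Hx.
    replace (y * (y * 1) + eps) with (y ^ 2 + eps) by ring.
    replace (x / sqrt (y ^ 2 + eps)) with (x * / sqrt (y ^ 2 + eps)) by reflexivity.
    generalize (atan (x * / sqrt (y ^ 2 + eps))). intros A.
    generalize dependent (sqrt (y ^ 2 + eps)). intros s Hs Hss.
    (* Eliminating eps in favour of the square root s turns the claim into a rational identity. *)
    assert (Heps : eps = s * s - y ^ 2) by lra. subst eps.
    change (R_NormedModule : Type) with R in *. simpl in a', b'.
    field. repeat split; nra.
Qed.

(** With Psi the area primitive at (q1, q2), the weighted Jacobian is (Psi q2_v)_u - (Psi q2_u)_v,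
    that is d(Psi dq2). Over a period in v the second term integrates to 0, and the first leaves the
    derivative of a periodic function of u: Stokes on the torus, one variable at a time. *)
Lemma periodic_jacobian_primitive q1 q2 eps v0 :
  smooth2 q1 -> smooth2 q2 -> periodic2 q1 -> periodic2 q2 -> 0 < eps ->
  exists X : R -> R, (forall u, X (u + 1) = X u) /\
    forall u, is_derive X u (RInt (fun v =>
      (pu q1 u v * pv q2 u v - pv q1 u v * pu q2 u v) / (q1 u v ^ 2 + q2 u v ^ 2 + eps)) v0 (v0 + 1)).
Proof.
  intros S1 S2 P1 P2 He.
  assert (C1 := smooth2_cont2 _ S1). assert (C2 := smooth2_cont2 _ S2).
  assert (C1u := smooth2_cont2 _ (smooth2_pu _ S1)). assert (C1v := smooth2_cont2 _ (smooth2_pv _ S1)).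
  assert (C2u := smooth2_cont2 _ (smooth2_pu _ S2)). assert (C2v := smooth2_cont2 _ (smooth2_pv _ S2)).
  assert (C2uv := smooth2_cont2 _ (smooth2_pu _ (smooth2_pv _ S2))).
  assert (C2vu := smooth2_cont2 _ (smooth2_pv _ (smooth2_pu _ S2))).
  assert (Csq : forall g, cont2 g -> cont2 (fun u v => g u v ^ 2)).
  { intros g Hg. apply cont2_mult; [exact Hg|]. apply cont2_mult; auto using cont2_const. }
  assert (Hpos : forall y, 0 < y ^ 2 + eps) by (intros y; pose proof (pow2_ge_0 y); lra).
  assert (Hpos2 : forall x y, 0 < x ^ 2 + y ^ 2 + eps).
  { intros x y; pose proof (pow2_ge_0 x); pose proof (pow2_ge_0 y); lra. }
  set (W := fun u v => q1 u v ^ 2 + q2 u v ^ 2 + eps).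
  assert (CW : cont2 W) by (repeat apply cont2_plus; auto using cont2_const).
  assert (HW : forall u v, W u v <> 0) by (intros u v; specialize (Hpos2 (q1 u v) (q2 u v)); unfold W; lra).
  set (Y2 := fun u v => q2 u v ^ 2 + eps).
  assert (CY2 : cont2 Y2) by (apply cont2_plus; auto using cont2_const).
  assert (HY2 : forall u v, Y2 u v <> 0) by (intros u v; specialize (Hpos (q2 u v)); unfold Y2; lra).
  set (s := fun u v => sqrt (Y2 u v)).
  assert (Cs : cont2 s) by (apply cont2_sqrt, CY2).
  assert (Hs : forall u v, s u v <> 0).
  { intros u v. pose proof (sqrt_lt_R0 _ (Hpos (q2 u v))). unfold s, Y2. lra. }
  assert (CA : cont2 (fun u v => atan (q1 u v / s u v))).
  { apply (cont2_comp atan); [|apply cont2_div; auto].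
    intros u v. apply (ex_derive_continuous atan). eexists; apply is_derive_atan. }
  set (Psi := fun u v => area_primitive eps (q1 u v) (q2 u v)).
  set (Psy := fun u v => area_primitive_y eps (q1 u v) (q2 u v)).
  assert (CPsi : cont2 Psi) by (apply (cont2_div _ s); auto).
  assert (CPsy : cont2 Psy).
  { apply cont2_minus.
    - apply (cont2_div (fun u v => - (q1 u v * q2 u v)) (fun u v => W u v * Y2 u v)).
      + apply cont2_opp, cont2_mult; auto.
      + apply cont2_mult; auto.
      + intros; apply Rmult_integral_contrapositive; auto.
    - apply (cont2_div (fun u v => q2 u v * atan (q1 u v / s u v)) (fun u v => Y2 u v * s u v)).
      + apply cont2_mult; auto.
      + apply cont2_mult; auto.
      + intros; apply Rmult_integral_contrapositive; auto. }
  assert (Hu : partial_u Psi (fun u v => pu q1 u v / W u v + pu q2 u v * Psy u v)).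
  { intros u v. apply (is_derive_area_primitive eps (fun t => q1 t v) (fun t => q2 t v)); auto;
    apply smooth2_partial_u; auto. }
  assert (Hv : partial_v Psi (fun u v => pv q1 u v / W u v + pv q2 u v * Psy u v)).
  { intros u v. apply (is_derive_area_primitive eps (fun t => q1 u t) (fun t => q2 u t)); auto;
    apply smooth2_partial_v; auto. }
  set (X := fun u v => Psi u v * pv q2 u v).
  set (Xu := fun u v => (pu q1 u v / W u v + pu q2 u v * Psy u v) * pv q2 u v + Psi u v * pu (pv q2) u v).
  set (Y := fun u v => Psi u v * pu q2 u v).
  set (Yv := fun u v => (pv q1 u v / W u v + pv q2 u v * Psy u v) * pu q2 u v + Psi u v * pv (pu q2) u v).
  assert (HXu : partial_u X Xu).
  { apply partial_u_mult; auto. apply smooth2_partial_u, smooth2_pv, S2. }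
  assert (HYv : partial_v Y Yv).
  { apply partial_v_mult; auto. apply smooth2_partial_v, smooth2_pu, S2. }
  assert (CX : cont2 X) by (apply cont2_mult; auto).
  assert (CXu : cont2 Xu).
  { apply cont2_plus; apply cont2_mult; auto. apply cont2_plus; [apply cont2_div; auto | apply cont2_mult; auto]. }
  assert (CYv : cont2 Yv).
  { apply cont2_plus; apply cont2_mult; auto. apply cont2_plus; [apply cont2_div; auto | apply cont2_mult; auto]. }
  assert (PPsi : periodic2 Psi) by (apply (periodic2_comp2 (area_primitive eps)); auto).
  assert (PX : periodic2 X) by (apply (periodic2_comp2 Rmult); auto using periodic2_pv).
  assert (PY : periodic2 Y) by (apply (periodic2_comp2 Rmult); auto using periodic2_pu).
  exists (fun u => RInt (fun v => X u v) v0 (v0 + 1)). split.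
  - intros u. apply RInt_ext. intros v _. apply PX.
  - intros u.
    assert (HYI : RInt (fun v => Yv u v) v0 (v0 + 1) = 0).
    { rewrite (is_RInt_unique _ _ _ _ (is_RInt_derive (V := R_CompleteNormedModule) (fun v => Y u v)
        (fun v => Yv u v) v0 (v0 + 1) (fun v _ => HYv u v) (fun v _ => cont2_section_v Yv u CYv v))).
      rewrite (proj2 (PY u v0)). unfold minus, plus, opp; simpl. ring. }
    replace (RInt _ v0 (v0 + 1)) with (RInt (fun v => Xu u v) v0 (v0 + 1)).
    { apply is_derive_RInt_parameter; auto. }
    transitivity (RInt (fun v => Xu u v) v0 (v0 + 1) - RInt (fun v => Yv u v) v0 (v0 + 1)).
    { rewrite HYI. symmetry. apply Rminus_0_r. }
    rewrite <- (RInt_minus (V := R_CompleteNormedModule) (fun v => Xu u v) (fun v => Yv u v))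
      by (apply cont2_RInt_v; auto).
    apply RInt_ext. intros v _. unfold minus, plus, opp; simpl. unfold Xu, Yv.
    rewrite (pv_pu_comm q2 u v S2). specialize (HW u v). unfold W in *. field. intros HH; apply HW; lra.
Qed.

Lemma Cauchy_Schwarz_2 a b x y : (a * x + b * y) ^ 2 <= (a ^ 2 + b ^ 2) * (x ^ 2 + y ^ 2).
Proof. pose proof (pow2_ge_0 (a * y - b * x)). nra. Qed.

(** For W = a^2 + b^2 + eps the left side is the squared gradient of (1/2) ln W; the bound is
    Cauchy-Schwarz in each direction. *)
Lemma log_gradient_bound a b au bu av bv W : 0 < W -> a ^ 2 + b ^ 2 <= W ->
  ((a * au + b * bu) / W) ^ 2 + ((a * av + b * bv) / W) ^ 2
  <= (au ^ 2 + av ^ 2 + bu ^ 2 + bv ^ 2) / W.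
Proof.
  intros HW HabW.
  pose proof (Cauchy_Schwarz_2 a b au bu) as H1. pose proof (Cauchy_Schwarz_2 a b av bv) as H2.
  assert (HiW : 0 < / W) by (apply Rinv_0_lt_compat, HW).
  assert (H3 : (a ^ 2 + b ^ 2) * (au ^ 2 + bu ^ 2) <= W * (au ^ 2 + bu ^ 2)).
  { apply Rmult_le_compat_r; auto. pose proof (pow2_ge_0 au); pose proof (pow2_ge_0 bu); lra. }
  assert (H4 : (a ^ 2 + b ^ 2) * (av ^ 2 + bv ^ 2) <= W * (av ^ 2 + bv ^ 2)).
  { apply Rmult_le_compat_r; auto. pose proof (pow2_ge_0 av); pose proof (pow2_ge_0 bv); lra. }
  replace (((a * au + b * bu) / W) ^ 2 + ((a * av + b * bv) / W) ^ 2)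
    with (((a * au + b * bu) ^ 2 + (a * av + b * bv) ^ 2) * (/ W * / W)) by (field; lra).
  replace ((au ^ 2 + av ^ 2 + bu ^ 2 + bv ^ 2) / W)
    with (W * (au ^ 2 + bu ^ 2 + (av ^ 2 + bv ^ 2)) * (/ W * / W)) by (field; lra).
  apply Rmult_le_compat_r; [|lra]. apply Rlt_le, Rmult_lt_0_compat; auto.
Qed.

Lemma periodic2_lipschitz q : smooth2 q -> periodic2 q ->
  exists B, 0 < B /\ forall u v u' v', Rabs (q u v - q u' v') <= B * (Rabs (u - u') + Rabs (v - v')).
Proof.
  intros Sq Pq.
  destruct (periodic2_bounded (pu q)) as [B1 [HB1 H1]].
  { apply smooth2_cont2, smooth2_pu, Sq. } { apply periodic2_pu, Pq. }
  destruct (periodic2_bounded (pv q)) as [B2 [HB2 H2]].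
  { apply smooth2_cont2, smooth2_pv, Sq. } { apply periodic2_pv, Pq. }
  assert (HM : forall (k k' : R -> R) B a b, (forall t, is_derive k t (k' t)) ->
    (forall t, Rabs (k' t) <= B) -> Rabs (k a - k b) <= B * Rabs (a - b)).
  { intros k k' B a b Hd HB. destruct (MVT_gen k b a k') as (c & _ & Hc).
    - intros; apply Hd.
    - intros x _. apply derivable_continuous_pt. exists (k' x). apply is_derive_Reals, Hd.
    - rewrite Hc, Rabs_mult. apply Rmult_le_compat_r; [apply Rabs_pos | apply HB]. }
  exists (B1 + B2). split; [lra|]. intros u v u' v'.
  pose proof (HM (fun t => q t v) (fun t => pu q t v) B1 u u'
    (fun t => smooth2_partial_u q Sq t v) (fun t => H1 t v)) as HA.
  pose proof (HM (fun t => q u' t) (fun t => pv q u' t) B2 v v'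
    (fun t => smooth2_partial_v q Sq u' t) (fun t => H2 u' t)) as HB.
  simpl in HA, HB.
  replace (q u v - q u' v') with ((q u v - q u' v) + (q u' v - q u' v')) by ring.
  eapply Rle_trans; [apply Rabs_triang|].
  pose proof (Rabs_pos (u - u')). pose proof (Rabs_pos (v - v')). nra.
Qed.

(* At a zero, the averages of log |q| over segments of length rho tend to -oo like log rho, whereas the
   Jacobian identity bounds the Dirichlet energy of log |q| on the torus, hence allows only growth
   sqrt |log rho|. *)
Theorem quasiregular_torus_zero q1 q2 c1 c2 :
  smooth2 q1 -> smooth2 q2 -> periodic2 q1 -> periodic2 q2 ->
  (forall u v, pu q1 u v ^ 2 + pv q1 u v ^ 2 + pu q2 u v ^ 2 + pv q2 u v ^ 2
     <= c1 * (pu q1 u v * pv q2 u v - pv q1 u v * pu q2 u v) + c2 * (q1 u v ^ 2 + q2 u v ^ 2)) ->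
  (exists u0 v0, q1 u0 v0 = 0 /\ q2 u0 v0 = 0) -> forall u v, q1 u v = 0 /\ q2 u v = 0.
Proof.
  intros S1 S2 P1 P2 Hqr (u0 & v0 & Z1 & Z2) ua va.
  destruct (periodic2_reduce (fun u v => (q1 u v, q2 u v)) u0 v0 ua va) as (u1 & v1 & Hu1 & Hv1 & Heq).
  { intros u v. destruct (P1 u v) as [-> ->], (P2 u v) as [-> ->]. auto. }
  injection Heq as -> ->.
  destruct (Req_dec (q1 u1 v1 ^ 2 + q2 u1 v1 ^ 2) 0) as [H0|H0].
  { pose proof (pow2_ge_0 (q1 u1 v1)). pose proof (pow2_ge_0 (q2 u1 v1)).
    split; apply Rsqr_0_uniq; unfold Rsqr; nra. }
  exfalso.
  assert (Hd : 0 < q1 u1 v1 ^ 2 + q2 u1 v1 ^ 2).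
  { pose proof (pow2_ge_0 (q1 u1 v1)). pose proof (pow2_ge_0 (q2 u1 v1)). lra. }
  set (d := (q1 u1 v1 ^ 2 + q2 u1 v1 ^ 2) / 2). assert (Hd0 : 0 < d) by (unfold d; lra).
  set (E := Rmax c2 0).
  assert (HE0 : 0 <= E) by apply Rmax_r. assert (HEc : c2 <= E) by apply Rmax_l.
  (* By continuity |q|^2 stays above half its value on a horizontal segment; the strict inequality
     u1 < u0 + 1 keeps it inside the cell. *)
  assert (Hdelta : exists u2, u1 < u2 <= u0 + 1 /\ forall u, u1 <= u <= u2 -> d <= q1 u v1 ^ 2 + q2 u v1 ^ 2).
  { assert (Hcont : continuous (fun u => q1 u v1 ^ 2 + q2 u v1 ^ 2) u1).
    { assert (Hc : cont2 (fun u v => q1 u v ^ 2 + q2 u v ^ 2)).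
      { apply smooth2_cont2, smooth2_plus; apply smooth2_sqr; auto. }
      apply (cont2_section_u _ v1 Hc). }
    assert (Hloc : locally u1 (fun u => d < q1 u v1 ^ 2 + q2 u v1 ^ 2)).
    { apply (Hcont (fun y => d < y)). apply open_gt. unfold d; lra. }
    destruct Hloc as [r Hr].
    exists (Rmin (u1 + r / 2) (u0 + 1)). pose proof (cond_pos r). split.
    - split; [apply Rmin_glb_lt; lra | apply Rmin_r].
    - intros u Hu. apply Rlt_le, Hr.
      pose proof (Rmin_l (u1 + r / 2) (u0 + 1)).
      unfold ball; simpl; unfold AbsRing_ball, abs, minus, plus, opp; simpl.
      apply Rabs_def1; lra. }
  destruct Hdelta as (u2 & Hu2 & Hd2).
  destruct (periodic2_lipschitz q1 S1 P1) as [B1 [HB1 L1]].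
  destruct (periodic2_lipschitz q2 S2 P2) as [B2 [HB2 L2]].
  (* On the short segment both coordinates differ from those of the zero by at most rho, so |q_i| <=
     2 B_i rho. The final 1 pays for eps = rho^2, giving W <= CC rho^2 there. *)
  set (CC := 4 * B1 ^ 2 + 4 * B2 ^ 2 + 1).
  assert (HCC : 0 < CC) by (unfold CC; nra).
  set (Q := / 2 * ln d - / 2 * ln CC - 2 * E - 2).
  (* rho is chosen so that the conclusion of log_energy_estimate fails. *)
  set (T := Rmax 0 (2 * (E + 1) / (u2 - u1) - 2 * Q)).
  set (rho := exp (- T)).
  assert (HT0 : 0 <= T) by apply Rmax_l.
  assert (HTQ : 2 * (E + 1) / (u2 - u1) - 2 * Q <= T) by apply Rmax_r.
  assert (Hrho : 0 < rho <= 1).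
  { split; [apply exp_pos|]. unfold rho. rewrite <- exp_0.
    destruct (Req_dec T 0) as [->|]; [rewrite Ropp_0; lra|]. apply Rlt_le, exp_increasing. lra. }
  assert (Hlnr : ln rho = - T) by apply ln_exp.
  set (eps := rho ^ 2). assert (Heps : 0 < eps) by (unfold eps; apply pow_lt; lra).
  set (W := fun u v => q1 u v ^ 2 + q2 u v ^ 2 + eps).
  assert (HW : forall u v, 0 < W u v).
  { intros u v. pose proof (pow2_ge_0 (q1 u v)). pose proof (pow2_ge_0 (q2 u v)). unfold W. lra. }
  assert (SW : smooth2 W).
  { apply smooth2_plus; [apply smooth2_plus; apply smooth2_sqr; auto | apply smooth2_const]. }
  destruct (periodic_jacobian_primitive q1 q2 eps v0 S1 S2 P1 P2 Heps) as (X & HXp & HXd).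
  set (J := fun u v => (pu q1 u v * pv q2 u v - pv q1 u v * pu q2 u v) / W u v) in *.
  assert (CJ : cont2 J).
  { apply smooth2_cont2, smooth2_div; auto.
    - apply smooth2_minus; apply smooth2_mult; auto using smooth2_pu, smooth2_pv.
    - intros u v; specialize (HW u v); lra. }
  assert (CE : cont2 (fun u v => c1 * J u v + E)).
  { apply cont2_plus; [apply cont2_mult|]; auto using cont2_const. }
  set (wu := fun u v => (q1 u v * pu q1 u v + q2 u v * pu q2 u v) / W u v).
  set (wv := fun u v => (q1 u v * pv q1 u v + q2 u v * pv q2 u v) / W u v).
  assert (Hln : forall (a b : R -> R) t a' b', is_derive a t a' -> is_derive b t b' ->
     is_derive (fun s => / 2 * ln (a s ^ 2 + b s ^ 2 + eps)) t ((a t * a' + b t * b') / (a t ^ 2 + b t ^ 2 + eps))).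
  { intros a b t a' b' Ha Hb.
    assert (Hp : 0 < a t ^ 2 + b t ^ 2 + eps) by (pose proof (pow2_ge_0 (a t)); pose proof (pow2_ge_0 (b t)); lra).
    assert (Hda := is_derive_unique _ _ _ Ha). assert (Hdb := is_derive_unique _ _ _ Hb).
    change (Derive (fun x => a x) t = a') in Hda. change (Derive (fun x => b x) t = b') in Hdb.
    auto_derive.
    - simpl in Hp. repeat split; try lra; eexists; eassumption.
    - rewrite Hda, Hdb. simpl in a', b'. field. lra. }
  assert (HlnW : cont2 (fun u v => / 2 * ln (W u v))).
  { apply cont2_mult; [apply cont2_const|]. apply (cont2_comp ln); [|apply smooth2_cont2, SW].
    intros u v. apply (ex_derive_continuous ln). eexists; apply is_derive_ln, HW. }
  assert (HWn : forall u v, W u v <> 0) by (intros u v; specialize (HW u v); lra).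
  (* The hypothesis on q bounds the energy density of (1/2) ln W by c1 J + E. Its line integrals
     have the primitive c1 X + E u with X periodic, so the total energy is E = max(c2, 0),
     independent of eps. *)
  assert (Hest := log_energy_estimate (fun u v => / 2 * ln (W u v)) wu wv (fun u v => c1 * J u v + E)
    (fun u => c1 * X u + E * u) u0 v0 E HlnW).
  assert (Cwu : cont2 wu).
  { apply smooth2_cont2, smooth2_div; auto. apply smooth2_plus; apply smooth2_mult; auto using smooth2_pu. }
  assert (Cwv : cont2 wv).
  { apply smooth2_cont2, smooth2_div; auto. apply smooth2_plus; apply smooth2_mult; auto using smooth2_pv. }
  specialize (Hest Cwu Cwv CE).
  assert (Hpu : partial_u (fun u v => / 2 * ln (W u v)) wu).
  { intros u v. apply (Hln (fun t => q1 t v) (fun t => q2 t v)); apply smooth2_partial_u; auto. }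
  assert (Hpv : partial_v (fun u v => / 2 * ln (W u v)) wv).
  { intros u v. apply (Hln (fun t => q1 u t) (fun t => q2 u t)); apply smooth2_partial_v; auto. }
  specialize (Hest Hpu Hpv).
  assert (HP : periodic2 (fun u v => / 2 * ln (W u v))).
  { apply (periodic2_comp2 (fun a b => / 2 * ln (a ^ 2 + b ^ 2 + eps))); auto. }
  specialize (Hest HP).
  assert (Hen : forall u v, wu u v ^ 2 + wv u v ^ 2 <= c1 * J u v + E).
  { intros u v. eapply Rle_trans; [apply log_gradient_bound; auto; unfold W; lra|].
    specialize (HW u v). specialize (Hqr u v).
    assert (Hi : 0 < / W u v) by (apply Rinv_0_lt_compat, HW).
    assert (HcW : c2 * (q1 u v ^ 2 + q2 u v ^ 2) <= E * W u v).
    { pose proof (pow2_ge_0 (q1 u v)). pose proof (pow2_ge_0 (q2 u v)). unfold W. nra. }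
    replace (c1 * J u v + E)
      with ((c1 * (pu q1 u v * pv q2 u v - pv q1 u v * pu q2 u v) + E * W u v) / W u v)
      by (unfold J; field; lra).
    apply Rmult_le_compat_r; lra. }
  specialize (Hest Hen).
  assert (HEd : forall u, is_derive (fun u => c1 * X u + E * u) u
     (RInt (fun v => c1 * J u v + E) v0 (v0 + 1))).
  { intros u.
    replace (RInt (fun v => c1 * J u v + E) v0 (v0 + 1))
      with ((0 * X u + c1 * RInt (fun v => J u v) v0 (v0 + 1)) + E).
    - apply is_derive_Rplus.
      + apply is_derive_Rmult; [apply (is_derive_const (V := R_NormedModule)) | apply HXd].
      + auto_derive; auto; ring.
    - rewrite (RInt_plus (V := R_CompleteNormedModule) (fun v => c1 * J u v) (fun _ => E)).
      + rewrite (RInt_scal (V := R_CompleteNormedModule) (fun v => J u v)) by (apply cont2_RInt_v, CJ).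
        rewrite RInt_const. unfold plus, scal; simpl; unfold mult; simpl. ring.
      + apply (cont2_RInt_v (fun u v => c1 * J u v)), cont2_mult; auto using cont2_const.
      + apply ex_RInt_const. }
  specialize (Hest HEd).
  assert (HEp : c1 * X (u0 + 1) + E * (u0 + 1) = c1 * X u0 + E * u0 + E) by (rewrite HXp; ring).
  specialize (Hest HEp rho (/ 2 * ln CC + ln rho) (/ 2 * ln d) u1 u2 v1 Hrho).
  assert (Hfin : (u2 - u1) * (/ 2 * ln d - (/ 2 * ln CC + ln rho) - 2 * E - 2 + / 2 * ln rho) <= E).
  { apply Hest; try lra.
    - intros s Hs.
      assert (HB : forall B, 0 < B -> B * (Rabs (u0 + rho - u0) + Rabs (v0 + rho * s - v0)) <= 2 * B * rho).
      { intros B HB.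
        assert (0 <= rho * s) by (apply Rmult_le_pos; lra).
        assert (rho * s <= rho * 1) by (apply Rmult_le_compat_l; lra).
        rewrite !Rabs_pos_eq by lra.
        replace (2 * B * rho) with (B * (2 * rho)) by ring. apply Rmult_le_compat_l; lra. }
      assert (A1 := L1 (u0 + rho) (v0 + rho * s) u0 v0). assert (A2 := L2 (u0 + rho) (v0 + rho * s) u0 v0).
      rewrite Z1, Rminus_0_r in A1. rewrite Z2, Rminus_0_r in A2.
      pose proof (HB B1 HB1). pose proof (HB B2 HB2).
      assert (Hsq : forall a M, Rabs a <= M -> a ^ 2 <= M ^ 2).
      { intros a M Ha. rewrite <- (pow2_abs a). apply pow_incr. split; [apply Rabs_pos | exact Ha]. }
      assert (Q1 := Hsq _ _ (Rle_trans _ _ _ A1 H)). assert (Q2 := Hsq _ _ (Rle_trans _ _ _ A2 H1)).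
      assert (HWle : W (u0 + rho) (v0 + rho * s) <= CC * rho ^ 2) by (unfold W, CC, eps; nra).
      apply ln_le in HWle; [|apply HW].
      rewrite ln_mult in HWle; [|lra|apply pow_lt; lra].
      replace (rho ^ 2) with (rho * rho) in HWle by ring. rewrite ln_mult in HWle by lra. lra.
    - intros u Hu.
      assert (ln d <= ln (W u v1)); [|lra]. apply ln_le; auto. specialize (Hd2 u Hu). unfold W. lra. }
  (* Now ln rho = - T, and the bracket equals Q + T/2; by the choice of T the left side is at least
     E + 1. *)
  rewrite Hlnr in Hfin.
  assert (Hpos : 0 < u2 - u1) by lra.
  assert (HX2 : (u2 - u1) * (2 * (E + 1) / (u2 - u1) - 2 * Q) <= (u2 - u1) * T) by (apply Rmult_le_compat_l; lra).
  replace ((u2 - u1) * (2 * (E + 1) / (u2 - u1) - 2 * Q)) with (2 * (E + 1) - 2 * (u2 - u1) * Q) in HX2 by (field; lra).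
  unfold Q in HX2. lra.
Qed.

(** * Smooth functions and vector fields on the torus *)

Definition torus_fun (g : R -> R -> R) : Prop := smooth2 g /\ periodic2 g.

Lemma torus_fun_const c : torus_fun (fun _ _ => c).
Proof. split; [apply smooth2_const | apply periodic2_const]. Qed.
Lemma torus_fun_pu g : torus_fun g -> torus_fun (pu g).
Proof. intros [S P]; split; [apply smooth2_pu, S | apply periodic2_pu, P]. Qed.
Lemma torus_fun_pv g : torus_fun g -> torus_fun (pv g).
Proof. intros [S P]; split; [apply smooth2_pv, S | apply periodic2_pv, P]. Qed.
Lemma torus_fun_plus g h : torus_fun g -> torus_fun h -> torus_fun (fun u v => g u v + h u v).
Proof. intros [S P] [S' P']; split; [apply smooth2_plus | apply (periodic2_comp2 Rplus)]; auto. Qed.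
Lemma torus_fun_minus g h : torus_fun g -> torus_fun h -> torus_fun (fun u v => g u v - h u v).
Proof. intros [S P] [S' P']; split; [apply smooth2_minus | apply (periodic2_comp2 Rminus)]; auto. Qed.
Lemma torus_fun_mult g h : torus_fun g -> torus_fun h -> torus_fun (fun u v => g u v * h u v).
Proof. intros [S P] [S' P']; split; [apply smooth2_mult | apply (periodic2_comp2 Rmult)]; auto. Qed.
Lemma torus_fun_sqr g : torus_fun g -> torus_fun (fun u v => g u v ^ 2).
Proof. intros [S P]; split; [apply smooth2_sqr | apply (periodic2_comp (fun y => y ^ 2))]; auto. Qed.
Lemma torus_fun_inv g : torus_fun g -> (forall u v, g u v <> 0) -> torus_fun (fun u v => / g u v).
Proof. intros [S P] H; split; [apply smooth2_inv | apply (periodic2_comp Rinv)]; auto. Qed.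
Lemma torus_fun_div g h : torus_fun g -> torus_fun h -> (forall u v, h u v <> 0) ->
  torus_fun (fun u v => g u v / h u v).
Proof. intros Hg Hh H. apply torus_fun_mult; auto. apply torus_fun_inv; auto. Qed.
Lemma torus_fun_sqrt g : torus_fun g -> (forall u v, 0 < g u v) -> torus_fun (fun u v => sqrt (g u v)).
Proof. intros [S P] H; split; [apply smooth2_sqrt | apply (periodic2_comp sqrt)]; auto. Qed.

Lemma torus_fun_bounded g : torus_fun g -> exists B, 0 < B /\ forall u v, Rabs (g u v) <= B.
Proof. intros [S P]. apply periodic2_bounded; auto. apply smooth2_cont2, S. Qed.

(** The relation g = O(|a| + |b|), uniform on the plane: a module over the bounded functions, in
    which all lower-order terms of the elliptic systems are collected. *)
Definition dominated (a b g : R -> R -> R) : Prop :=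
  exists C, 0 < C /\ forall u v, Rabs (g u v) <= C * (Rabs (a u v) + Rabs (b u v)).

Lemma dominated_l a b : dominated a b a.
Proof. exists 1. split; [lra|]. intros u v. pose proof (Rabs_pos (b u v)). lra. Qed.
Lemma dominated_r a b : dominated a b b.
Proof. exists 1. split; [lra|]. intros u v. pose proof (Rabs_pos (a u v)). lra. Qed.
Lemma dominated_ext a b g h : (forall u v, h u v = g u v) -> dominated a b g -> dominated a b h.
Proof. intros He (C & HC & H). exists C. split; auto. intros u v. now rewrite He. Qed.
Lemma dominated_opp a b g : dominated a b g -> dominated a b (fun u v => - g u v).
Proof. intros (C & HC & H). exists C. split; auto. intros u v. now rewrite Rabs_Ropp. Qed.
Lemma dominated_plus a b g h : dominated a b g -> dominated a b h ->
  dominated a b (fun u v => g u v + h u v).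
Proof.
  intros (C & HC & H) (C' & HC' & H'). exists (C + C'). split; [lra|]. intros u v.
  eapply Rle_trans; [apply Rabs_triang|]. specialize (H u v). specialize (H' u v). lra.
Qed.
Lemma dominated_minus a b g h : dominated a b g -> dominated a b h ->
  dominated a b (fun u v => g u v - h u v).
Proof. intros Hg Hh. apply dominated_plus; auto using dominated_opp. Qed.
Lemma dominated_mult_bounded a b m g B : (forall u v, Rabs (m u v) <= B) -> dominated a b g ->
  dominated a b (fun u v => m u v * g u v).
Proof.
  intros Hm (C & HC & H). exists ((Rabs B + 1) * C). split; [pose proof (Rabs_pos B); nra|]. intros u v.
  rewrite Rabs_mult, Rmult_assoc. specialize (H u v). specialize (Hm u v).
  pose proof (Rle_abs B). pose proof (Rabs_pos (m u v)). pose proof (Rabs_pos (g u v)).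
  apply Rmult_le_compat; lra.
Qed.
Lemma dominated_mult a b m g : torus_fun m -> dominated a b g -> dominated a b (fun u v => m u v * g u v).
Proof. intros Hm. destruct (torus_fun_bounded m Hm) as (B & _ & HB). now apply (dominated_mult_bounded a b m g B). Qed.

Lemma dominated_sqr a b g : dominated a b g ->
  exists C, forall u v, g u v ^ 2 <= C * (a u v ^ 2 + b u v ^ 2).
Proof.
  intros (C & HC & H). exists (2 * C ^ 2). intros u v. specialize (H u v).
  rewrite <- (pow2_abs (g u v)), <- (pow2_abs (a u v)), <- (pow2_abs (b u v)).
  apply Rle_trans with ((C * (Rabs (a u v) + Rabs (b u v))) ^ 2).
  - apply pow_incr. split; [apply Rabs_pos | exact H].
  - pose proof (pow2_ge_0 (C * (Rabs (a u v) - Rabs (b u v)))). nra.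
Qed.

(** * First-order elliptic systems on the torus *)

Lemma elliptic_jacobian_bound p s av bv al ga B k : 0 < k -> Rabs al <= B -> Rabs ga <= B ->
  k <= ga - al ^ 2 ->
  let K1 := 2 + (1 + 2 * B ^ 2) / k in let K2 := 3 + 12 * B ^ 2 in
  let R1 := av - s in let R3 := bv - 2 * al * s + ga * p in
  p ^ 2 + av ^ 2 + s ^ 2 + bv ^ 2
  <= - (2 * K1 * K2) * (p * bv - av * s) + (K2 * K1 ^ 2 + 3) * (R1 ^ 2 + R3 ^ 2).
Proof.
  intros Hk Hal Hga Hell K1 K2 R1 R3.
  assert (Hal2 : al ^ 2 <= B ^ 2) by (rewrite <- (pow2_abs al); apply pow_incr; split; [apply Rabs_pos | auto]).
  assert (Hga2 : ga ^ 2 <= B ^ 2) by (rewrite <- (pow2_abs ga); apply pow_incr; split; [apply Rabs_pos | auto]).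
  assert (HB2 : 0 <= B ^ 2) by apply pow2_ge_0.
  assert (HK1 : 2 <= K1).
  { assert (0 <= (1 + 2 * B ^ 2) / k) by (apply Rdiv_le_0_compat; lra). unfold K1; lra. }
  assert (HK2 : 3 <= K2) by (unfold K2; lra).
  assert (HK1k : K1 * k = 2 * k + (1 + 2 * B ^ 2)) by (unfold K1; field; lra).
  (* Here p = a_u, s = b_u, and R1, R3 are the residuals of the system. When these vanish, minus the
     Jacobian is the form s^2 - 2 al p s + ga p^2, positive definite by ellipticity. K1 measures its
     definiteness, and K2 the recovery of a_v, b_v from p, s. *)
  assert (HJ : - (p * bv - av * s) = (s - al * p) ^ 2 + (ga - al ^ 2) * p ^ 2 - p * R3 + s * R1)
    by (unfold R1, R3; ring).
  assert (H1 : p ^ 2 + s ^ 2 <= K1 * ((s - al * p) ^ 2 + (ga - al ^ 2) * p ^ 2)).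
  { assert (Hs : s ^ 2 <= 2 * (s - al * p) ^ 2 + 2 * (al ^ 2 * p ^ 2)) by (pose proof (pow2_ge_0 (s - 2 * (al * p))); nra).
    assert (Hp2 : al ^ 2 * p ^ 2 <= B ^ 2 * p ^ 2) by (apply Rmult_le_compat_r; [apply pow2_ge_0 | auto]).
    assert (Hkp : k * p ^ 2 <= (ga - al ^ 2) * p ^ 2) by (apply Rmult_le_compat_r; [apply pow2_ge_0 | auto]).
    assert (HKk : K1 * (k * p ^ 2) <= K1 * ((ga - al ^ 2) * p ^ 2)) by (apply Rmult_le_compat_l; lra).
    replace (K1 * (k * p ^ 2)) with ((K1 * k) * p ^ 2) in HKk by ring. rewrite HK1k in HKk.
    assert (H2s : 2 * (s - al * p) ^ 2 <= K1 * (s - al * p) ^ 2) by (apply Rmult_le_compat_r; [apply pow2_ge_0 | auto]).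
    pose proof (pow2_ge_0 p). nra. }
  (* The cross terms K1 p R3 and K1 s R1 are absorbed into half of p^2 + s^2, whence the factor
     2. *)
  assert (H2 : (p ^ 2 + s ^ 2) <= 2 * K1 * - (p * bv - av * s) + K1 ^ 2 * (R1 ^ 2 + R3 ^ 2)).
  { rewrite HJ. pose proof (pow2_ge_0 (p - K1 * R3)). pose proof (pow2_ge_0 (s + K1 * R1)). nra. }
  assert (H3 : p ^ 2 + av ^ 2 + s ^ 2 + bv ^ 2 <= K2 * (p ^ 2 + s ^ 2) + 3 * (R1 ^ 2 + R3 ^ 2)).
  { replace av with (s + R1) by (unfold R1; ring). replace bv with (2 * al * s - ga * p + R3) by (unfold R3; ring).
    assert (A1 : (s + R1) ^ 2 <= 2 * s ^ 2 + 2 * R1 ^ 2) by (pose proof (pow2_ge_0 (s - R1)); nra).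
    assert (A2 : (2 * al * s - ga * p + R3) ^ 2 <= 3 * (4 * (al ^ 2 * s ^ 2) + ga ^ 2 * p ^ 2 + R3 ^ 2)).
    { pose proof (pow2_ge_0 (2 * al * s + ga * p)). pose proof (pow2_ge_0 (2 * al * s - R3)).
      pose proof (pow2_ge_0 (ga * p + R3)). nra. }
    assert (A3 : al ^ 2 * s ^ 2 <= B ^ 2 * s ^ 2) by (apply Rmult_le_compat_r; [apply pow2_ge_0 | auto]).
    assert (A4 : ga ^ 2 * p ^ 2 <= B ^ 2 * p ^ 2) by (apply Rmult_le_compat_r; [apply pow2_ge_0 | auto]).
    pose proof (pow2_ge_0 R1). pose proof (pow2_ge_0 p). pose proof (pow2_ge_0 s).
    assert (0 <= B ^ 2 * p ^ 2) by (apply Rmult_le_pos; auto).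
    unfold K2. lra. }
  assert (H4 : K2 * (p ^ 2 + s ^ 2) <= K2 * (2 * K1 * - (p * bv - av * s) + K1 ^ 2 * (R1 ^ 2 + R3 ^ 2)))
    by (apply Rmult_le_compat_l; lra).
  lra.
Qed.

(** Boundedness of 1 / (ga - al^2) on the torus makes the ellipticity uniform, and the residuals are
    O(|a| + |b|); so the pointwise bound gives the hypothesis of [quasiregular_torus_zero]. The
    factor of the Jacobian is negative because (a, b) reverses orientation to leading order. *)
Theorem elliptic_system_zero a b al ga :
  torus_fun a -> torus_fun b -> torus_fun al -> torus_fun ga ->
  (forall u v, 0 < ga u v - al u v ^ 2) ->
  dominated a b (fun u v => pv a u v - pu b u v) ->
  dominated a b (fun u v => pv b u v - 2 * al u v * pu b u v + ga u v * pu a u v) ->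
  (exists u0 v0, a u0 v0 = 0 /\ b u0 v0 = 0) -> forall u v, a u v = 0 /\ b u v = 0.
Proof.
  intros Ta Tb Tal Tga Hell D1 D3 Hz.
  destruct (torus_fun_bounded al Tal) as (B1 & HB1 & HB1').
  destruct (torus_fun_bounded ga Tga) as (B2 & HB2 & HB2').
  destruct (torus_fun_bounded (fun u v => / (ga u v - al u v ^ 2))) as (B3 & HB3 & HB3').
  { apply torus_fun_inv. apply torus_fun_minus; auto using torus_fun_sqr.
    intros u v; specialize (Hell u v); lra. }
  destruct (dominated_sqr _ _ _ D1) as (C1 & HC1). destruct (dominated_sqr _ _ _ D3) as (C3 & HC3).
  set (B := B1 + B2). set (k := / B3).
  set (K1 := 2 + (1 + 2 * B ^ 2) / k). set (K2 := 3 + 12 * B ^ 2).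
  apply (quasiregular_torus_zero a b (- (2 * K1 * K2)) ((K2 * K1 ^ 2 + 3) * (C1 + C3)));
    try apply Ta; try apply Tb; auto.
  intros u v.
  assert (Hk : 0 < k) by (apply Rinv_0_lt_compat; auto).
  assert (Hke : k <= ga u v - al u v ^ 2).
  { specialize (HB3' u v). specialize (Hell u v). unfold k.
    rewrite <- (Rinv_inv (ga u v - al u v ^ 2)). apply Rinv_le_contravar.
    - apply Rinv_0_lt_compat, Hell.
    - eapply Rle_trans; [apply Rle_abs | exact HB3']. }
  specialize (HB1' u v). specialize (HB2' u v). specialize (HC1 u v). specialize (HC3 u v).
  pose proof (elliptic_jacobian_bound (pu a u v) (pu b u v) (pv a u v) (pv b u v) (al u v) (ga u v) B k Hk
    ltac:(unfold B; lra) ltac:(unfold B; lra) Hke) as Hj. cbv zeta in Hj. fold K1 K2 in Hj.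
  eapply Rle_trans; [exact Hj|].
  assert (HK : 0 <= K2 * K1 ^ 2 + 3).
  { assert (0 <= K2) by (unfold K2; pose proof (pow2_ge_0 B); lra).
    assert (0 <= K2 * K1 ^ 2) by (apply Rmult_le_pos; auto using pow2_ge_0). lra. }
  apply Rplus_le_compat_l. rewrite (Rmult_assoc (K2 * K1 ^ 2 + 3)). apply Rmult_le_compat_l; auto. lra.
Qed.

(** * Vector fields along a torus *)

Definition torus_vec (X : R -> R -> V3) : Prop :=
  torus_fun (fun u v => Defs.c1 (X u v)) /\ torus_fun (fun u v => c2 (X u v)) /\ torus_fun (fun u v => c3 (X u v)).

Lemma torus_vec_intro X : smooth_V3 X -> periodic2 X -> torus_vec X.
Proof.
  intros (S1 & S2 & S3) P. split; [|split]; (split; [assumption|]);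
  [apply (periodic2_comp Defs.c1 X P) | apply (periodic2_comp c2 X P) | apply (periodic2_comp c3 X P)].
Qed.

Lemma V3_eq a b : Defs.c1 a = Defs.c1 b -> c2 a = c2 b -> c3 a = c3 b -> a = b.
Proof. destruct a, b; simpl; intros; subst; reflexivity. Qed.

Lemma torus_vec_elim X : torus_vec X -> smooth_V3 X /\ periodic2 X.
Proof.
  intros ((S1 & P1) & (S2 & P2) & (S3 & P3)). split; [split; auto|].
  intros u v. split; apply V3_eq; [apply P1 | apply P2 | apply P3 | apply P1 | apply P2 | apply P3].
Qed.

Lemma torus_vec_dU X : torus_vec X -> torus_vec (dU X).
Proof.
  intros (T1 & T2 & T3). split; [|split]; simpl; apply torus_fun_pu; assumption.
Qed.
Lemma torus_vec_dV X : torus_vec X -> torus_vec (dV X).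
Proof.
  intros (T1 & T2 & T3). split; [|split]; simpl; apply torus_fun_pv; assumption.
Qed.
Lemma torus_vec_const w : torus_vec (fun _ _ => w).
Proof. split; [|split]; apply torus_fun_const. Qed.
Lemma torus_vec_cross X Y : torus_vec X -> torus_vec Y -> torus_vec (fun u v => cross (X u v) (Y u v)).
Proof.
  intros (T1 & T2 & T3) (T1' & T2' & T3').
  split; [|split]; simpl; apply torus_fun_minus; apply torus_fun_mult; auto.
Qed.
Lemma torus_vec_scal k X : torus_fun k -> torus_vec X -> torus_vec (fun u v => Defs.scal (k u v) (X u v)).
Proof. intros Tk (T1 & T2 & T3). split; [|split]; simpl; apply torus_fun_mult; auto. Qed.
Lemma torus_fun_dot X Y : torus_vec X -> torus_vec Y -> torus_fun (fun u v => dot (X u v) (Y u v)).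
Proof.
  intros (T1 & T2 & T3) (T1' & T2' & T3'). unfold dot.
  apply torus_fun_plus; [apply torus_fun_plus|]; apply torus_fun_mult; auto.
Qed.

Lemma torus_fun_partial_u g : torus_fun g -> partial_u g (pu g).
Proof. intros [S _]; apply smooth2_partial_u, S. Qed.
Lemma torus_fun_partial_v g : torus_fun g -> partial_v g (pv g).
Proof. intros [S _]; apply smooth2_partial_v, S. Qed.

Lemma smooth_dot_partial_u X Y : smooth_V3 X -> smooth_V3 Y ->
  partial_u (fun u v => dot (X u v) (Y u v)) (fun u v => dot (dU X u v) (Y u v) + dot (X u v) (dU Y u v)).
Proof.
  intros (T1 & T2 & T3) (T1' & T2' & T3') u v.
  assert (H := partial_u_plus _ _ _ _
    (partial_u_plus _ _ _ _
       (partial_u_mult _ _ _ _ (smooth2_partial_u _ T1) (smooth2_partial_u _ T1'))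
       (partial_u_mult _ _ _ _ (smooth2_partial_u _ T2) (smooth2_partial_u _ T2')))
    (partial_u_mult _ _ _ _ (smooth2_partial_u _ T3) (smooth2_partial_u _ T3')) u v).
  unfold dot. simpl in *.
  match type of H with is_derive _ _ ?l => match goal with |- is_derive _ _ ?r => replace r with l by ring end end.
  exact H.
Qed.
Lemma smooth_dot_partial_v X Y : smooth_V3 X -> smooth_V3 Y ->
  partial_v (fun u v => dot (X u v) (Y u v)) (fun u v => dot (dV X u v) (Y u v) + dot (X u v) (dV Y u v)).
Proof.
  intros (T1 & T2 & T3) (T1' & T2' & T3') u v.
  assert (H := partial_v_plus _ _ _ _
    (partial_v_plus _ _ _ _
       (partial_v_mult _ _ _ _ (smooth2_partial_v _ T1) (smooth2_partial_v _ T1'))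
       (partial_v_mult _ _ _ _ (smooth2_partial_v _ T2) (smooth2_partial_v _ T2')))
    (partial_v_mult _ _ _ _ (smooth2_partial_v _ T3) (smooth2_partial_v _ T3')) u v).
  unfold dot. simpl in *.
  match type of H with is_derive _ _ ?l => match goal with |- is_derive _ _ ?r => replace r with l by ring end end.
  exact H.
Qed.

Lemma pu_dot X Y u v : smooth_V3 X -> smooth_V3 Y ->
  pu (fun u v => dot (X u v) (Y u v)) u v = dot (dU X u v) (Y u v) + dot (X u v) (dU Y u v).
Proof. intros HX HY. exact (is_derive_unique _ _ _ (smooth_dot_partial_u X Y HX HY u v)). Qed.
Lemma pv_dot X Y u v : smooth_V3 X -> smooth_V3 Y ->
  pv (fun u v => dot (X u v) (Y u v)) u v = dot (dV X u v) (Y u v) + dot (X u v) (dV Y u v).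
Proof. intros HX HY. exact (is_derive_unique _ _ _ (smooth_dot_partial_v X Y HX HY u v)). Qed.
Lemma pu_ext g h u v : (forall a b, g a b = h a b) -> pu g u v = pu h u v.
Proof. intros H. apply Derive_ext. intros; apply H. Qed.
Lemma pv_ext g h u v : (forall a b, g a b = h a b) -> pv g u v = pv h u v.
Proof. intros H. apply Derive_ext. intros; apply H. Qed.
Lemma pu_const c u v : pu (fun _ _ => c) u v = 0.
Proof. exact (Derive_const c u). Qed.
Lemma pv_const c u v : pv (fun _ _ => c) u v = 0.
Proof. exact (Derive_const c v). Qed.
Lemma pu_minus g h u v : smooth2 g -> smooth2 h ->
  pu (fun u v => g u v - h u v) u v = pu g u v - pu h u v.
Proof. intros Hg Hh. exact (is_derive_unique _ _ _ (partial_u_minus _ _ _ _ (smooth2_partial_u _ Hg) (smooth2_partial_u _ Hh) u v)). Qed.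
Lemma pv_minus g h u v : smooth2 g -> smooth2 h ->
  pv (fun u v => g u v - h u v) u v = pv g u v - pv h u v.
Proof. intros Hg Hh. exact (is_derive_unique _ _ _ (partial_v_minus _ _ _ _ (smooth2_partial_v _ Hg) (smooth2_partial_v _ Hh) u v)). Qed.
Lemma pu_plus g h u v : smooth2 g -> smooth2 h ->
  pu (fun u v => g u v + h u v) u v = pu g u v + pu h u v.
Proof. intros Hg Hh. exact (is_derive_unique _ _ _ (partial_u_plus _ _ _ _ (smooth2_partial_u _ Hg) (smooth2_partial_u _ Hh) u v)). Qed.
Lemma pv_plus g h u v : smooth2 g -> smooth2 h ->
  pv (fun u v => g u v + h u v) u v = pv g u v + pv h u v.
Proof. intros Hg Hh. exact (is_derive_unique _ _ _ (partial_v_plus _ _ _ _ (smooth2_partial_v _ Hg) (smooth2_partial_v _ Hh) u v)). Qed.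
Lemma pu_mult g h u v : smooth2 g -> smooth2 h ->
  pu (fun u v => g u v * h u v) u v = pu g u v * h u v + g u v * pu h u v.
Proof. intros Hg Hh. exact (is_derive_unique _ _ _ (partial_u_mult _ _ _ _ (smooth2_partial_u _ Hg) (smooth2_partial_u _ Hh) u v)). Qed.
Lemma pv_mult g h u v : smooth2 g -> smooth2 h ->
  pv (fun u v => g u v * h u v) u v = pv g u v * h u v + g u v * pv h u v.
Proof. intros Hg Hh. exact (is_derive_unique _ _ _ (partial_v_mult _ _ _ _ (smooth2_partial_v _ Hg) (smooth2_partial_v _ Hh) u v)). Qed.

Lemma dV_dU_comm X u v : smooth_V3 X -> dV (dU X) u v = dU (dV X) u v.
Proof. intros (S1 & S2 & S3). apply V3_eq; simpl; apply pv_pu_comm; assumption. Qed.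

Lemma dot_comm a b : dot a b = dot b a.
Proof. unfold dot; ring. Qed.

(** * The structure equations of an immersed torus *)

Section Immersion.

Variable x : R -> R -> V3.
Hypothesis x_immersion : torus_immersion x.

Lemma x_vec : torus_vec x.
Proof. destruct x_immersion as (S & P & _). now apply torus_vec_intro. Qed.

Lemma xu_vec : torus_vec (dU x). Proof. apply torus_vec_dU, x_vec. Qed.
Lemma xv_vec : torus_vec (dV x). Proof. apply torus_vec_dV, x_vec. Qed.
Lemma xuu_vec : torus_vec (dU (dU x)). Proof. apply torus_vec_dU, xu_vec. Qed.
Lemma xuv_vec : torus_vec (dV (dU x)). Proof. apply torus_vec_dV, xu_vec. Qed.
Lemma xvv_vec : torus_vec (dV (dV x)). Proof. apply torus_vec_dV, xv_vec. Qed.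

Lemma smooth_of_fun g : torus_fun g -> smooth2 g.
Proof. intros [S _]; exact S. Qed.
Lemma smooth_of_vec X : torus_vec X -> smooth_V3 X.
Proof. apply torus_vec_elim. Qed.

Lemma fE_fun : torus_fun (fE x). Proof. apply torus_fun_dot; apply xu_vec. Qed.
Lemma fF_fun : torus_fun (fF x). Proof. apply torus_fun_dot; [apply xu_vec | apply xv_vec]. Qed.
Lemma fG_fun : torus_fun (fG x). Proof. apply torus_fun_dot; apply xv_vec. Qed.

Definition gdet u v := fE x u v * fG x u v - fF x u v ^ 2.

(** Lagrange's identity; through it the immersion condition becomes positivity of the metric
    determinant. *)
Lemma gdet_cross u v :
  dot (cross (dU x u v) (dV x u v)) (cross (dU x u v) (dV x u v)) = gdet u v.
Proof. unfold gdet, fE, fF, fG, dot, cross; simpl; ring. Qed.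

Lemma gdet_pos u v : 0 < gdet u v.
Proof.
  rewrite <- gdet_cross. destruct x_immersion as (_ & _ & Hn). specialize (Hn u v).
  destruct (cross (dU x u v) (dV x u v)) as [a b c]. unfold dot; simpl.
  destruct (Req_dec a 0); [destruct (Req_dec b 0); [destruct (Req_dec c 0)|]|].
  - subst. congruence.
  - nra.
  - nra.
  - nra.
Qed.

Lemma gdet_fun : torus_fun gdet.
Proof.
  apply torus_fun_minus; [apply torus_fun_mult; [apply fE_fun | apply fG_fun] | apply torus_fun_sqr, fF_fun].
Qed.

Lemma fE_pos u v : 0 < fE x u v.
Proof.
  pose proof (gdet_pos u v) as H. unfold gdet in H.
  assert (0 <= fE x u v) by (unfold fE, dot; nra).
  destruct (Req_dec (fE x u v) 0) as [E0|]; [|lra].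
  rewrite E0 in H. pose proof (pow2_ge_0 (fF x u v)). lra.
Qed.

Lemma gdet_neq u v : gdet u v <> 0. Proof. pose proof (gdet_pos u v); lra. Qed.
Lemma fE_neq u v : fE x u v <> 0. Proof. pose proof (fE_pos u v); lra. Qed.

Lemma vnorm_cross u v : vnorm (cross (dU x u v) (dV x u v)) = sqrt (gdet u v).
Proof. unfold vnorm. now rewrite gdet_cross. Qed.

Lemma unitN_vec : torus_vec (unitN x).
Proof.
  assert (H : torus_vec (fun u v => Defs.scal (/ sqrt (gdet u v)) (cross (dU x u v) (dV x u v)))).
  { apply torus_vec_scal.
    - apply torus_fun_inv; [apply torus_fun_sqrt; [apply gdet_fun | apply gdet_pos]|].
      intros u v. pose proof (sqrt_lt_R0 _ (gdet_pos u v)). lra.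
    - apply torus_vec_cross; [apply xu_vec | apply xv_vec]. }
  replace (unitN x) with (fun u v => Defs.scal (/ sqrt (gdet u v)) (cross (dU x u v) (dV x u v))); auto.
  extensionality u; extensionality v. unfold unitN. now rewrite vnorm_cross.
Qed.

Lemma unitN_xu u v : dot (unitN x u v) (dU x u v) = 0.
Proof. unfold unitN, dot, cross, Defs.scal; simpl; ring. Qed.
Lemma unitN_xv u v : dot (unitN x u v) (dV x u v) = 0.
Proof. unfold unitN, dot, cross, Defs.scal; simpl; ring. Qed.
Lemma unitN_unit u v : dot (unitN x u v) (unitN x u v) = 1.
Proof.
  unfold unitN. rewrite vnorm_cross.
  replace (dot _ _) with (/ sqrt (gdet u v) * / sqrt (gdet u v)
    * dot (cross (dU x u v) (dV x u v)) (cross (dU x u v) (dV x u v))) by (unfold dot, Defs.scal; simpl; ring).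
  rewrite gdet_cross. pose proof (sqrt_lt_R0 _ (gdet_pos u v)).
  rewrite <- (sqrt_sqrt (gdet u v)) at 3 by (pose proof (gdet_pos u v); lra). field. lra.
Qed.

(** Expansion of y in the basis x_u, x_v, N. On second derivatives of x, [coefA] and [coefB] are
    thus the Christoffel symbols; they are kept in this form throughout. *)
Lemma dot_decomposition u v y A :
  dot y A = coefA x u v y * dot A (dU x u v) + coefB x u v y * dot A (dV x u v)
            + dot y (unitN x u v) * dot A (unitN x u v).
Proof.
  assert (H : gdet u v * dot y A =
    (dot y (dU x u v) * fG x u v - dot y (dV x u v) * fF x u v) * dot A (dU x u v)
    + (dot y (dV x u v) * fE x u v - dot y (dU x u v) * fF x u v) * dot A (dV x u v)
    + dot y (cross (dU x u v) (dV x u v)) * dot A (cross (dU x u v) (dV x u v))).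
  { unfold gdet, fE, fF, fG, dot, cross; simpl; ring. }
  assert (HN : dot y (unitN x u v) * dot A (unitN x u v)
    = dot y (cross (dU x u v) (dV x u v)) * dot A (cross (dU x u v) (dV x u v)) / gdet u v).
  { unfold unitN. rewrite vnorm_cross.
    replace (dot y (cross (dU x u v) (dV x u v)) * dot A (cross (dU x u v) (dV x u v)) / gdet u v)
      with (dot y (cross (dU x u v) (dV x u v)) * dot A (cross (dU x u v) (dV x u v)) / (sqrt (gdet u v) * sqrt (gdet u v)))
      by (rewrite sqrt_sqrt; auto; pose proof (gdet_pos u v); lra).
    pose proof (sqrt_lt_R0 _ (gdet_pos u v)). unfold dot, Defs.scal; simpl. field. lra. }
  rewrite HN. unfold coefA, coefB. fold (gdet u v).
  pose proof (gdet_neq u v) as Hg.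
  apply (Rmult_eq_reg_l (gdet u v)); auto. rewrite H. field. exact Hg.
Qed.

Lemma coefA_fun Y : torus_vec Y -> torus_fun (fun u v => coefA x u v (Y u v)).
Proof.
  intros TY. apply torus_fun_div; [|apply gdet_fun | apply gdet_neq].
  apply torus_fun_minus; apply torus_fun_mult; try apply torus_fun_dot;
    auto using xu_vec, xv_vec, fG_fun, fF_fun.
Qed.
Lemma coefB_fun Y : torus_vec Y -> torus_fun (fun u v => coefB x u v (Y u v)).
Proof.
  intros TY. apply torus_fun_div; [|apply gdet_fun | apply gdet_neq].
  apply torus_fun_minus; apply torus_fun_mult; try apply torus_fun_dot;
    auto using xu_vec, xv_vec, fE_fun, fF_fun.
Qed.

Lemma sL_fun : torus_fun (sL x). Proof. apply torus_fun_dot; [apply xuu_vec | apply unitN_vec]. Qed.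
Lemma sM_fun : torus_fun (sM x). Proof. apply torus_fun_dot; [apply xuv_vec | apply unitN_vec]. Qed.
Lemma sN_fun : torus_fun (sN x). Proof. apply torus_fun_dot; [apply xvv_vec | apply unitN_vec]. Qed.

Lemma meanH_fun : torus_fun (meanH x).
Proof.
  apply torus_fun_div.
  - apply torus_fun_plus; [apply torus_fun_minus|]; repeat apply torus_fun_mult;
    auto using fE_fun, fF_fun, fG_fun, sL_fun, sM_fun, sN_fun, torus_fun_const.
  - apply torus_fun_mult; [apply torus_fun_const | apply gdet_fun].
  - intros u v. pose proof (gdet_pos u v) as H. unfold gdet in H. lra.
Qed.
Lemma gaussK_fun : torus_fun (gaussK x).
Proof.
  apply torus_fun_div; [|apply gdet_fun | apply gdet_neq].
  apply torus_fun_minus; [apply torus_fun_mult | apply torus_fun_sqr]; auto using sL_fun, sM_fun, sN_fun.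
Qed.

Lemma dU_unitN_N u v : dot (dU (unitN x) u v) (unitN x u v) = 0.
Proof.
  pose proof (smooth_of_vec _ unitN_vec) as S.
  pose proof (pu_dot (unitN x) (unitN x) u v S S) as H.
  rewrite (pu_ext _ (fun _ _ => 1)) in H by apply unitN_unit. rewrite pu_const in H.
  rewrite (dot_comm (unitN x u v)) in H. lra.
Qed.
Lemma dV_unitN_N u v : dot (dV (unitN x) u v) (unitN x u v) = 0.
Proof.
  pose proof (smooth_of_vec _ unitN_vec) as S.
  pose proof (pv_dot (unitN x) (unitN x) u v S S) as H.
  rewrite (pv_ext _ (fun _ _ => 1)) in H by apply unitN_unit. rewrite pv_const in H.
  rewrite (dot_comm (unitN x u v)) in H. lra.
Qed.
Lemma dU_unitN_xu u v : dot (dU (unitN x) u v) (dU x u v) = - sL x u v.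
Proof.
  pose proof (pu_dot (unitN x) (dU x) u v (smooth_of_vec _ unitN_vec) (smooth_of_vec _ xu_vec)) as H.
  rewrite (pu_ext _ (fun _ _ => 0)) in H by apply unitN_xu. rewrite pu_const in H.
  rewrite (dot_comm (unitN x u v)) in H. unfold sL. lra.
Qed.
Lemma dV_unitN_xu u v : dot (dV (unitN x) u v) (dU x u v) = - sM x u v.
Proof.
  pose proof (pv_dot (unitN x) (dU x) u v (smooth_of_vec _ unitN_vec) (smooth_of_vec _ xu_vec)) as H.
  rewrite (pv_ext _ (fun _ _ => 0)) in H by apply unitN_xu. rewrite pv_const in H.
  rewrite (dot_comm (unitN x u v)) in H. unfold sM. lra.
Qed.
Lemma dU_unitN_xv u v : dot (dU (unitN x) u v) (dV x u v) = - sM x u v.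
Proof.
  pose proof (pu_dot (unitN x) (dV x) u v (smooth_of_vec _ unitN_vec) (smooth_of_vec _ xv_vec)) as H.
  rewrite (pu_ext _ (fun _ _ => 0)) in H by apply unitN_xv. rewrite pu_const in H.
  rewrite (dot_comm (unitN x u v)), <- (dV_dU_comm x u v (smooth_of_vec _ x_vec)) in H. unfold sM. lra.
Qed.
Lemma dV_unitN_xv u v : dot (dV (unitN x) u v) (dV x u v) = - sN x u v.
Proof.
  pose proof (pv_dot (unitN x) (dV x) u v (smooth_of_vec _ unitN_vec) (smooth_of_vec _ xv_vec)) as H.
  rewrite (pv_ext _ (fun _ _ => 0)) in H by apply unitN_xv. rewrite pv_const in H.
  rewrite (dot_comm (unitN x u v)) in H. unfold sN. lra.
Qed.

Lemma pu_fE u v : pu (fE x) u v = 2 * dot (dU (dU x) u v) (dU x u v).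
Proof.
  pose proof (pu_dot (dU x) (dU x) u v (smooth_of_vec _ xu_vec) (smooth_of_vec _ xu_vec)) as H.
  rewrite (dot_comm (dU x u v)) in H. unfold fE. change (pu (fun u v => dot (dU x u v) (dU x u v)) u v = 2 * dot (dU (dU x) u v) (dU x u v)). lra.
Qed.
Lemma pv_fE u v : pv (fE x) u v = 2 * dot (dV (dU x) u v) (dU x u v).
Proof.
  pose proof (pv_dot (dU x) (dU x) u v (smooth_of_vec _ xu_vec) (smooth_of_vec _ xu_vec)) as H.
  rewrite (dot_comm (dU x u v)) in H. change (pv (fun u v => dot (dU x u v) (dU x u v)) u v = 2 * dot (dV (dU x) u v) (dU x u v)). lra.
Qed.
Lemma pu_fF u v : pu (fF x) u v = dot (dU (dU x) u v) (dV x u v) + dot (dV (dU x) u v) (dU x u v).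
Proof.
  pose proof (pu_dot (dU x) (dV x) u v (smooth_of_vec _ xu_vec) (smooth_of_vec _ xv_vec)) as H.
  rewrite (dot_comm (dU x u v) (dU (dV x) u v)), <- (dV_dU_comm x u v (smooth_of_vec _ x_vec)) in H. exact H.
Qed.
Lemma pv_fF u v : pv (fF x) u v = dot (dV (dU x) u v) (dV x u v) + dot (dV (dV x) u v) (dU x u v).
Proof.
  pose proof (pv_dot (dU x) (dV x) u v (smooth_of_vec _ xu_vec) (smooth_of_vec _ xv_vec)) as H.
  rewrite (dot_comm (dU x u v) (dV (dV x) u v)) in H. exact H.
Qed.
Lemma pu_fG u v : pu (fG x) u v = 2 * dot (dV (dU x) u v) (dV x u v).
Proof.
  pose proof (pu_dot (dV x) (dV x) u v (smooth_of_vec _ xv_vec) (smooth_of_vec _ xv_vec)) as H.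
  rewrite (dot_comm (dV x u v)), <- (dV_dU_comm x u v (smooth_of_vec _ x_vec)) in H.
  change (pu (fun u v => dot (dV x u v) (dV x u v)) u v = 2 * dot (dV (dU x) u v) (dV x u v)). lra.
Qed.
Lemma pv_fG u v : pv (fG x) u v = 2 * dot (dV (dV x) u v) (dV x u v).
Proof.
  pose proof (pv_dot (dV x) (dV x) u v (smooth_of_vec _ xv_vec) (smooth_of_vec _ xv_vec)) as H.
  rewrite (dot_comm (dV x u v)) in H.
  change (pv (fun u v => dot (dV x u v) (dV x u v)) u v = 2 * dot (dV (dV x) u v) (dV x u v)). lra.
Qed.

Lemma dot_dU_unitN u v y :
  dot y (dU (unitN x) u v) = - coefA x u v y * sL x u v - coefB x u v y * sM x u v.
Proof. rewrite (dot_decomposition u v), dU_unitN_xu, dU_unitN_xv, dU_unitN_N. ring. Qed.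
Lemma dot_dV_unitN u v y :
  dot y (dV (unitN x) u v) = - coefA x u v y * sM x u v - coefB x u v y * sN x u v.
Proof. rewrite (dot_decomposition u v), dV_unitN_xu, dV_unitN_xv, dV_unitN_N. ring. Qed.

Lemma coef_dot_xu u v y : coefA x u v y * fE x u v + coefB x u v y * fF x u v = dot y (dU x u v).
Proof. rewrite (dot_decomposition u v y (dU x u v)), (dot_comm (dU x u v) (unitN x u v)), unitN_xu.
  unfold fE, fF. rewrite (dot_comm (dU x u v) (dV x u v)). ring. Qed.
Lemma coef_dot_xv u v y : coefA x u v y * fF x u v + coefB x u v y * fG x u v = dot y (dV x u v).
Proof. rewrite (dot_decomposition u v y (dV x u v)), (dot_comm (dV x u v) (unitN x u v)), unitN_xv.
  unfold fG, fF. rewrite (dot_comm (dU x u v) (dV x u v)). ring. Qed.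

(** The third derivatives of x cancel by symmetry; the derivatives of N on the right are expanded in
    the tangent basis later. *)
Lemma Codazzi_1 u v : pv (sL x) u v - pu (sM x) u v =
  dot (dU (dU x) u v) (dV (unitN x) u v) - dot (dV (dU x) u v) (dU (unitN x) u v).
Proof.
  pose proof (pv_dot (dU (dU x)) (unitN x) u v (smooth_of_vec _ xuu_vec) (smooth_of_vec _ unitN_vec)) as H1.
  pose proof (pu_dot (dV (dU x)) (unitN x) u v (smooth_of_vec _ xuv_vec) (smooth_of_vec _ unitN_vec)) as H2.
  rewrite (dV_dU_comm (dU x) u v (smooth_of_vec _ xu_vec)) in H1.
  change (pv (sL x) u v = dot (dU (dV (dU x)) u v) (unitN x u v) + dot (dU (dU x) u v) (dV (unitN x) u v)) in H1.
  change (pu (sM x) u v = dot (dU (dV (dU x)) u v) (unitN x u v) + dot (dV (dU x) u v) (dU (unitN x) u v)) in H2.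
  lra.
Qed.

Lemma Codazzi_2 u v : pv (sM x) u v - pu (sN x) u v =
  dot (dV (dU x) u v) (dV (unitN x) u v) - dot (dV (dV x) u v) (dU (unitN x) u v).
Proof.
  pose proof (pv_dot (dV (dU x)) (unitN x) u v (smooth_of_vec _ xuv_vec) (smooth_of_vec _ unitN_vec)) as H1.
  pose proof (pu_dot (dV (dV x)) (unitN x) u v (smooth_of_vec _ xvv_vec) (smooth_of_vec _ unitN_vec)) as H2.
  rewrite <- (dV_dU_comm (dV x) u v (smooth_of_vec _ xv_vec)) in H2.
  assert (Hc : dU (dV x) = dV (dU x)).
  { extensionality a; extensionality b. symmetry. apply dV_dU_comm, smooth_of_vec, x_vec. }
  rewrite Hc in H2.
  change (pv (sM x) u v = dot (dV (dV (dU x)) u v) (unitN x u v) + dot (dV (dU x) u v) (dV (unitN x) u v)) in H1.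
  change (pu (sN x) u v = dot (dV (dV (dU x)) u v) (unitN x u v) + dot (dV (dV x) u v) (dU (unitN x) u v)) in H2.
  lra.
Qed.

(** * The trace-free second fundamental form *)

Definition tL u v := sL x u v - meanH x u v * fE x u v.
Definition tM u v := sM x u v - meanH x u v * fF x u v.
Definition tN u v := sN x u v - meanH x u v * fG x u v.

Lemma tL_fun : torus_fun tL.
Proof. apply torus_fun_minus; [|apply torus_fun_mult]; auto using sL_fun, meanH_fun, fE_fun. Qed.
Lemma tM_fun : torus_fun tM.
Proof. apply torus_fun_minus; [|apply torus_fun_mult]; auto using sM_fun, meanH_fun, fF_fun. Qed.
Lemma tN_fun : torus_fun tN.
Proof. apply torus_fun_minus; [|apply torus_fun_mult]; auto using sN_fun, meanH_fun, fG_fun. Qed.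

(** As E > 0, this eliminates [tN]: the trace-free form has the two unknowns [tL], [tM]. *)
Lemma trace_free u v : fE x u v * tN u v = 2 * fF x u v * tM u v - fG x u v * tL u v.
Proof.
  unfold tL, tM, tN, meanH. pose proof (gdet_neq u v) as H. unfold gdet in H. field. exact H.
Qed.

Definition defect u v := meanH x u v ^ 2 - gaussK x u v.

Lemma defect_fun : torus_fun defect.
Proof. apply torus_fun_minus; [apply torus_fun_sqr, meanH_fun | apply gaussK_fun]. Qed.

Lemma defect_gdet u v : defect u v * gdet u v = tM u v ^ 2 - tL u v * tN u v.
Proof.
  assert (HK : gaussK x u v * gdet u v = sL x u v * sN x u v - sM x u v ^ 2).
  { unfold gaussK. fold (gdet u v). field. apply gdet_neq. }
  pose proof (trace_free u v) as Ht.
  assert (HH : sL x u v * sN x u v - sM x u v ^ 2 = tL u v * tN u v - tM u v ^ 2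
     + meanH x u v * (fE x u v * tN u v - 2 * fF x u v * tM u v + fG x u v * tL u v) + meanH x u v ^ 2 * gdet u v).
  { unfold tL, tM, tN, gdet. ring. }
  unfold defect. rewrite Ht in HH. replace ((meanH x u v ^ 2 - gaussK x u v) * gdet u v)
    with (meanH x u v ^ 2 * gdet u v - gaussK x u v * gdet u v) by ring. rewrite HK. lra.
Qed.

(** Completing the square after eliminating [tN] shows H^2 - K to be a positive definite form in
    (tL, tM), which yields both its sign and its zeros. *)
Lemma defect_squares u v : defect u v * gdet u v * fE x u v ^ 2 =
  (fE x u v * tM u v - fF x u v * tL u v) ^ 2 + gdet u v * tL u v ^ 2.
Proof.
  rewrite defect_gdet.
  replace ((tM u v ^ 2 - tL u v * tN u v) * fE x u v ^ 2)
    with (fE x u v ^ 2 * tM u v ^ 2 - fE x u v * tL u v * (fE x u v * tN u v)) by ring.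
  rewrite trace_free. unfold gdet. ring.
Qed.

Lemma defect_nonneg u v : 0 <= defect u v.
Proof.
  pose proof (defect_squares u v) as H. pose proof (gdet_pos u v) as Hg. pose proof (fE_pos u v) as HE.
  pose proof (pow2_ge_0 (fE x u v * tM u v - fF x u v * tL u v)). pose proof (pow2_ge_0 (tL u v)).
  assert (0 < gdet u v * fE x u v ^ 2) by (apply Rmult_lt_0_compat; [|apply pow_lt]; lra).
  assert (0 <= gdet u v * tL u v ^ 2) by (apply Rmult_le_pos; lra).
  destruct (Rle_dec 0 (defect u v)); auto. exfalso. nra.
Qed.

Lemma defect_zero_iff u v : defect u v = 0 <-> tL u v = 0 /\ tM u v = 0.
Proof.
  pose proof (defect_squares u v) as H. pose proof (gdet_pos u v) as Hg. pose proof (fE_pos u v) as HE.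
  split.
  - intros H0. rewrite H0, !Rmult_0_l in H.
    pose proof (pow2_ge_0 (fE x u v * tM u v - fF x u v * tL u v)). pose proof (pow2_ge_0 (tL u v)).
    assert (0 <= gdet u v * tL u v ^ 2) by (apply Rmult_le_pos; lra).
    assert (HL : tL u v = 0).
    { assert (Hz : gdet u v * tL u v ^ 2 = 0) by lra. apply Rmult_integral in Hz as [|]; [lra|].
      apply Rsqr_0_uniq. unfold Rsqr. lra. }
    split; auto. rewrite HL in H.
    assert (HM : (fE x u v * tM u v) * (fE x u v * tM u v) = 0) by nra.
    apply Rmult_integral in HM. assert (HM' : fE x u v * tM u v = 0) by tauto.
    apply Rmult_integral in HM' as [|]; lra.
  - intros [HL HM]. rewrite HL, HM in H.
    assert (0 < gdet u v * fE x u v ^ 2) by (apply Rmult_lt_0_compat; [|apply pow_lt]; lra).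
    apply (Rmult_eq_reg_r (gdet u v * fE x u v ^ 2)); [|lra]. lra.
Qed.

Lemma umbilic_iff u v : umbilic x u v <-> defect u v = 0.
Proof.
  unfold umbilic, kappa1, kappa2. fold (defect u v). pose proof (defect_nonneg u v) as H0. split; intros H.
  - apply sqrt_eq_0; lra.
  - rewrite H, sqrt_0. lra.
Qed.

(** In II = t + H g the metric g is parallel, so H g contributes dH only, and the Christoffel
    symbols multiply nothing but the trace-free components. *)
Lemma Codazzi_trace_free_1 u v : pv tL u v - pu tM u v =
  - coefA x u v (dU (dU x) u v) * tM u v - coefB x u v (dU (dU x) u v) * tN u v
  + coefA x u v (dV (dU x) u v) * tL u v + coefB x u v (dV (dU x) u v) * tM u v
  - pv (meanH x) u v * fE x u v + pu (meanH x) u v * fF x u v.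
Proof.
  unfold tL at 1, tM at 1.
  rewrite pv_minus, pu_minus, pv_mult, pu_mult
    by auto using smooth2_mult, smooth_of_fun, sL_fun, sM_fun, sN_fun, meanH_fun, fE_fun, fF_fun, fG_fun.
  pose proof (Codazzi_1 u v) as HC. rewrite dot_dV_unitN, dot_dU_unitN in HC.
  rewrite pv_fE, pu_fF.
  pose proof (coef_dot_xv u v (dU (dU x) u v)) as H1. pose proof (coef_dot_xu u v (dV (dU x) u v)) as H2.
  unfold tL, tM, tN in *. rewrite <- H1, <- H2. lra.
Qed.

Lemma Codazzi_trace_free_2 u v : pv tM u v - pu tN u v =
  - coefA x u v (dV (dU x) u v) * tM u v - coefB x u v (dV (dU x) u v) * tN u v
  + coefA x u v (dV (dV x) u v) * tL u v + coefB x u v (dV (dV x) u v) * tM u v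
  - pv (meanH x) u v * fF x u v + pu (meanH x) u v * fG x u v.
Proof.
  unfold tM at 1, tN at 1.
  rewrite pv_minus, pu_minus, pv_mult, pu_mult
    by auto using smooth2_mult, smooth_of_fun, sL_fun, sM_fun, sN_fun, meanH_fun, fE_fun, fF_fun, fG_fun.
  pose proof (Codazzi_2 u v) as HC. rewrite dot_dV_unitN, dot_dU_unitN in HC.
  rewrite pv_fF, pu_fG.
  pose proof (coef_dot_xv u v (dV (dU x) u v)) as H1. pose proof (coef_dot_xu u v (dV (dV x) u v)) as H2.
  unfold tL, tM, tN in *. rewrite <- H1, <- H2. lra.
Qed.

End Immersion.

(** * The elliptic system for the trace-free form under the Weingarten relation *)

Section Weingarten.

Variables (x : R -> R -> V3) (f : R -> R) (eps : R).
Hypothesis x_immersion : torus_immersion x.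
Hypothesis eps_pos : 0 < eps.
Hypothesis f_smooth : smooth_on_ray eps f.
Hypothesis weingarten : forall u v, meanH x u v = f (meanH x u v ^ 2 - gaussK x u v).

Local Notation dom := (dominated (tL x) (tM x)).
Let TL := tL_fun x x_immersion.
Let TM := tM_fun x x_immersion.
Let TN := tN_fun x x_immersion.
Let TD := defect_fun x x_immersion.
Let Tg := gdet_fun x x_immersion.
Let TE := fE_fun x x_immersion.
Let TF := fF_fun x x_immersion.
Let TG := fG_fun x x_immersion.

(** At an umbilic the argument is 0, an interior point of the domain of f since eps > 0; so the
    derivative there is two-sided. *)
Lemma is_derive_f_defect u v : is_derive f (defect x u v) (Derive f (defect x u v)).
Proof.
  apply Derive_correct. apply (f_smooth 0%nat). pose proof (defect_nonneg x x_immersion u v). lra.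
Qed.

Lemma continuous_Derive_f t : 0 <= t -> continuous (Derive f) t.
Proof. intros Ht. apply (ex_derive_continuous (Derive f)). apply (f_smooth 1%nat). lra. Qed.

Lemma pu_meanH u v : pu (meanH x) u v = pu (defect x) u v * Derive f (defect x u v).
Proof.
  rewrite (pu_ext (meanH x) (fun u v => f (defect x u v))) by (intros; apply weingarten).
  exact (is_derive_unique _ _ _ (partial_u_comp (defect x) (pu (defect x)) f (Derive f) is_derive_f_defect
    (torus_fun_partial_u _ TD) u v)).
Qed.
Lemma pv_meanH u v : pv (meanH x) u v = pv (defect x) u v * Derive f (defect x u v).
Proof.
  rewrite (pv_ext (meanH x) (fun u v => f (defect x u v))) by (intros; apply weingarten).
  exact (is_derive_unique _ _ _ (partial_v_comp (defect x) (pv (defect x)) f (Derive f) is_derive_f_defect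
    (torus_fun_partial_v _ TD) u v)).
Qed.

Lemma tN_dominated : dom (tN x).
Proof.
  apply (dominated_ext _ _ (fun u v => 2 * fF x u v / fE x u v * tM x u v - fG x u v / fE x u v * tL x u v)).
  - intros u v. pose proof (fE_neq x x_immersion u v) as HE. pose proof (trace_free x x_immersion u v) as Ht.
    apply (Rmult_eq_reg_l (fE x u v)); auto. rewrite Ht. field. exact HE.
  - apply dominated_minus; apply dominated_mult; try apply dominated_l; try apply dominated_r;
    apply torus_fun_div; auto using torus_fun_mult, torus_fun_const; apply fE_neq; auto.
Qed.

Lemma defect_dominated : dom (defect x).
Proof.
  apply (dominated_ext _ _ (fun u v => / gdet x u v * (tM x u v * tM x u v - tL x u v * tN x u v))).
  - intros u v. pose proof (gdet_neq x x_immersion u v) as Hg.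
    pose proof (defect_gdet x x_immersion u v) as Hd.
    apply (Rmult_eq_reg_r (gdet x u v)); auto. rewrite Hd. field. exact Hg.
  - apply dominated_mult; [apply torus_fun_inv; auto; apply gdet_neq; auto|].
    apply dominated_minus; apply dominated_mult; auto using tN_dominated, dominated_r.
Qed.

(** The product of [defect] and [gdet] is quadratic in the trace-free form, so every term of its
    derivative retains an undifferentiated factor. *)
Lemma pu_defect_dominated : dom (pu (defect x)).
Proof.
  apply (dominated_ext _ _ (fun u v => / gdet x u v * (2 * pu (tM x) u v * tM x u v
    - pu (tL x) u v * tN x u v - pu (tN x) u v * tL x u v - pu (gdet x) u v * defect x u v))).
  - intros u v. pose proof (gdet_neq x x_immersion u v) as Hg.
    pose proof (pu_ext (fun u v => defect x u v * gdet x u v)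
      (fun u v => tM x u v * tM x u v - tL x u v * tN x u v) u v) as He.
    rewrite pu_minus, !pu_mult in He by auto using smooth2_mult, smooth_of_fun.
    assert (Hd := He ltac:(intros a b; rewrite defect_gdet by auto; ring)).
    apply (Rmult_eq_reg_r (gdet x u v)); auto. field_simplify; auto. lra.
  - apply dominated_mult; [apply torus_fun_inv; auto; apply gdet_neq; auto|].
    repeat apply dominated_minus; apply dominated_mult;
    auto using tN_dominated, dominated_r, dominated_l, defect_dominated, torus_fun_pu, torus_fun_mult, torus_fun_const.
Qed.

Lemma pv_defect_dominated : dom (pv (defect x)).
Proof.
  apply (dominated_ext _ _ (fun u v => / gdet x u v * (2 * pv (tM x) u v * tM x u v
    - pv (tL x) u v * tN x u v - pv (tN x) u v * tL x u v - pv (gdet x) u v * defect x u v))).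
  - intros u v. pose proof (gdet_neq x x_immersion u v) as Hg.
    pose proof (pv_ext (fun u v => defect x u v * gdet x u v)
      (fun u v => tM x u v * tM x u v - tL x u v * tN x u v) u v) as He.
    rewrite pv_minus, !pv_mult in He by auto using smooth2_mult, smooth_of_fun.
    assert (Hd := He ltac:(intros a b; rewrite defect_gdet by auto; ring)).
    apply (Rmult_eq_reg_r (gdet x u v)); auto. field_simplify; auto. lra.
  - apply dominated_mult; [apply torus_fun_inv; auto; apply gdet_neq; auto|].
    repeat apply dominated_minus; apply dominated_mult;
    auto using tN_dominated, dominated_r, dominated_l, defect_dominated, torus_fun_pv, torus_fun_mult, torus_fun_const.
Qed.

Lemma Derive_f_defect_bounded : exists B, forall u v, Rabs (Derive f (defect x u v)) <= B.
Proof.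
  destruct (periodic2_bounded (fun u v => Derive f (defect x u v))) as (B & _ & HB); [| |exists B; exact HB].
  - apply (cont2_comp (Derive f)); [|apply smooth2_cont2, smooth_of_fun, TD].
    intros u v. apply continuous_Derive_f, defect_nonneg; auto.
  - apply (periodic2_comp (Derive f)), TD.
Qed.

Lemma pu_meanH_dominated : dom (pu (meanH x)).
Proof.
  destruct Derive_f_defect_bounded as [B HB].
  apply (dominated_ext _ _ (fun u v => Derive f (defect x u v) * pu (defect x) u v)).
  - intros u v. rewrite pu_meanH. ring.
  - apply (dominated_mult_bounded _ _ _ _ B HB), pu_defect_dominated.
Qed.

Lemma pv_meanH_dominated : dom (pv (meanH x)).
Proof.
  destruct Derive_f_defect_bounded as [B HB].
  apply (dominated_ext _ _ (fun u v => Derive f (defect x u v) * pv (defect x) u v)).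
  - intros u v. rewrite pv_meanH. ring.
  - apply (dominated_mult_bounded _ _ _ _ B HB), pv_defect_dominated.
Qed.

(* The Weingarten relation makes dH a multiple of d(H^2 - K), hence of first order in the trace-free
   second fundamental form; the Codazzi equations thus become a homogeneous elliptic system for it. *)
Theorem umbilic_everywhere : (exists u0 v0, umbilic x u0 v0) ->
  forall u v, tL x u v = 0 /\ tM x u v = 0.
Proof.
  intros (u0 & v0 & Hu).
  assert (VA : forall Y, torus_vec Y -> torus_fun (fun u v => coefA x u v (Y u v)))
    by (intros; apply coefA_fun; auto).
  assert (VB : forall Y, torus_vec Y -> torus_fun (fun u v => coefB x u v (Y u v)))
    by (intros; apply coefB_fun; auto).
  assert (Vuu := xuu_vec x x_immersion). assert (Vuv := xuv_vec x x_immersion).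
  assert (Vvv := xvv_vec x x_immersion).
  assert (Hout : dom (fun u v => pv (tL x) u v - pu (tM x) u v)).
  { apply (dominated_ext _ _ (fun u v =>
      coefA x u v (dV (dU x) u v) * tL x u v + coefB x u v (dV (dU x) u v) * tM x u v
      - coefA x u v (dU (dU x) u v) * tM x u v - coefB x u v (dU (dU x) u v) * tN x u v
      - fE x u v * pv (meanH x) u v + fF x u v * pu (meanH x) u v)).
    - intros u v. rewrite Codazzi_trace_free_1 by auto. ring.
    - repeat first [apply dominated_minus | apply dominated_plus]; apply dominated_mult;
      auto using dominated_l, dominated_r, tN_dominated, pu_meanH_dominated, pv_meanH_dominated. }
  assert (Hout2 : dom (fun u v => pv (tM x) u v - pu (tN x) u v)).
  { apply (dominated_ext _ _ (fun u v =>
      coefA x u v (dV (dV x) u v) * tL x u v + coefB x u v (dV (dV x) u v) * tM x u v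
      - coefA x u v (dV (dU x) u v) * tM x u v - coefB x u v (dV (dU x) u v) * tN x u v
      - fF x u v * pv (meanH x) u v + fG x u v * pu (meanH x) u v)).
    - intros u v. rewrite Codazzi_trace_free_2 by auto. ring.
    - repeat first [apply dominated_minus | apply dominated_plus]; apply dominated_mult;
      auto using dominated_l, dominated_r, tN_dominated, pu_meanH_dominated, pv_meanH_dominated. }
  assert (HEn : forall u v, fE x u v <> 0) by (intros; apply fE_neq; auto).
  (* The coefficients are read off from tN = 2 (F/E) tM - (G/E) tL. *)
  apply (elliptic_system_zero (tL x) (tM x) (fun u v => fF x u v / fE x u v) (fun u v => fG x u v / fE x u v)); auto.
  - apply torus_fun_div; auto.
  - apply torus_fun_div; auto.
  - intros u v. pose proof (gdet_pos x x_immersion u v) as Hg. pose proof (fE_pos x x_immersion u v) as HE.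
    replace (fG x u v / fE x u v - (fF x u v / fE x u v) ^ 2) with (gdet x u v * / (fE x u v * fE x u v))
      by (unfold gdet; field; lra).
    apply Rmult_lt_0_compat; auto. apply Rinv_0_lt_compat. nra.
  (* The second Codazzi equation contains the u-derivative of [tN]. Differentiating the trace-free
     relation trades it for those of [tM] and [tL], up to terms of order zero in the trace-free
     form. *)
  - apply (dominated_ext _ _ (fun u v => (pv (tM x) u v - pu (tN x) u v)
      + / fE x u v * (2 * pu (fF x) u v * tM x u v - pu (fG x) u v * tL x u v - pu (fE x) u v * tN x u v))).
    + intros u v.
      pose proof (pu_ext (fun u v => fE x u v * tN x u v)
        (fun u v => 2 * (fF x u v * tM x u v) - fG x u v * tL x u v) u v
        ltac:(intros a b; cbv beta; rewrite trace_free by auto; ring)) as He.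
      rewrite pu_minus, !pu_mult, pu_const in He by auto using smooth2_mult, smooth_of_fun, smooth2_const.
      specialize (HEn u v).
      apply (Rmult_eq_reg_l (fE x u v)); auto. field_simplify; auto. lra.
    + apply dominated_plus; auto. apply dominated_mult; [apply torus_fun_inv; auto|].
      repeat apply dominated_minus; apply dominated_mult;
      auto using dominated_l, dominated_r, tN_dominated, torus_fun_pu, torus_fun_mult, torus_fun_const.
  - exists u0, v0. apply defect_zero_iff; auto. now apply umbilic_iff.
Qed.

End Weingarten.

(* For a fixed vector w, write w = al x_u + be x_v + h N. Where the immersion is totally umbilic the
   tangential part of w is a conformal field, so (be, al) solves a homogeneous elliptic system; it vanishes
   where the height <x, w> is maximal, hence everywhere, which is absurd for w = x_u(0,0). *)
Theorem torus_not_totally_umbilic x : torus_immersion x ->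
  ~ (forall u v, tL x u v = 0 /\ tM x u v = 0).
Proof.
  intros Hx Hum.
  assert (HN0 : forall u v, tN x u v = 0).
  { intros u v. pose proof (trace_free x Hx u v) as Ht. destruct (Hum u v) as [-> ->] in Ht.
    apply (Rmult_eq_reg_l (fE x u v)); [lra|]. apply fE_neq; auto. }
  set (w := dU x 0 0).
  set (al := fun u v => coefA x u v w). set (be := fun u v => coefB x u v w).
  assert (Tw := torus_vec_const w).
  assert (Tal : torus_fun al) by (apply (coefA_fun x Hx (fun _ _ => w)); auto).
  assert (Tbe : torus_fun be) by (apply (coefB_fun x Hx (fun _ _ => w)); auto).
  assert (Vxu := xu_vec x Hx). assert (Vxv := xv_vec x Hx).
  assert (TE := fE_fun x Hx). assert (TF := fF_fun x Hx). assert (TG := fG_fun x Hx).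
  assert (VA : forall Y, torus_vec Y -> torus_fun (fun u v => coefA x u v (Y u v)))
    by (intros; apply coefA_fun; auto).
  assert (VB : forall Y, torus_vec Y -> torus_fun (fun u v => coefB x u v (Y u v)))
    by (intros; apply coefB_fun; auto).
  assert (Vuu := xuu_vec x Hx). assert (Vuv := xuv_vec x Hx). assert (Vvv := xvv_vec x Hx).
  assert (Hd0 : forall y, dot (mkV 0 0 0) y = 0) by (intros y; unfold dot; simpl; ring).
  assert (HUw : forall u v, dU (fun _ _ => w) u v = mkV 0 0 0) by (intros; apply V3_eq; simpl; apply pu_const).
  assert (HVw : forall u v, dV (fun _ _ => w) u v = mkV 0 0 0) by (intros; apply V3_eq; simpl; apply pv_const).
  assert (Hxu : forall u v, al u v * fE x u v + be u v * fF x u v = dot w (dU x u v))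
    by (intros; apply coef_dot_xu; auto).
  assert (Hxv : forall u v, al u v * fF x u v + be u v * fG x u v = dot w (dV x u v))
    by (intros; apply coef_dot_xv; auto).
  assert (SS := smooth_of_vec). assert (SF := smooth_of_fun).
  assert (Huu : forall u v, pu al u v * fE x u v + al u v * pu (fE x) u v + (pu be u v * fF x u v + be u v * pu (fF x) u v)
     = dot w (dU (dU x) u v)).
  { intros u v. pose proof (pu_ext _ _ u v Hxu) as H.
    rewrite (pu_dot (fun _ _ => w) (dU x)), HUw, Hd0, pu_plus, !pu_mult in H by auto using smooth2_mult. lra. }
  assert (Huv : forall u v, pv al u v * fE x u v + al u v * pv (fE x) u v + (pv be u v * fF x u v + be u v * pv (fF x) u v)
     = dot w (dV (dU x) u v)).
  { intros u v. pose proof (pv_ext _ _ u v Hxu) as H.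
    rewrite (pv_dot (fun _ _ => w) (dU x)), HVw, Hd0, pv_plus, !pv_mult in H by auto using smooth2_mult. lra. }
  assert (Hvu : forall u v, pu al u v * fF x u v + al u v * pu (fF x) u v + (pu be u v * fG x u v + be u v * pu (fG x) u v)
     = dot w (dV (dU x) u v)).
  { intros u v. pose proof (pu_ext _ _ u v Hxv) as H. rewrite (dV_dU_comm x u v) by (apply SS, x_vec; auto).
    rewrite (pu_dot (fun _ _ => w) (dV x)), HUw, Hd0, pu_plus, !pu_mult in H by auto using smooth2_mult. lra. }
  assert (Hvv : forall u v, pv al u v * fF x u v + al u v * pv (fF x) u v + (pv be u v * fG x u v + be u v * pv (fG x) u v)
     = dot w (dV (dV x) u v)).
  { intros u v. pose proof (pv_ext _ _ u v Hxv) as H.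
    rewrite (pv_dot (fun _ _ => w) (dV x)), HVw, Hd0, pv_plus, !pv_mult in H by auto using smooth2_mult. lra. }
  (* At umbilics the normal components of the second derivatives of x are H E, H F, H G, so the
     normal part of w acts on them through the single function h times the metric. *)
  set (h := fun u v => meanH x u v * dot w (unitN x u v)).
  assert (Hdec : forall u v y k, dot y (unitN x u v) = meanH x u v * k ->
     dot w y = al u v * dot y (dU x u v) + be u v * dot y (dV x u v) + h u v * k).
  { intros u v y k Hk. rewrite (dot_decomposition x Hx u v w y), Hk. unfold h, al, be. ring. }
  assert (HsL : forall u v, dot (dU (dU x) u v) (unitN x u v) = meanH x u v * fE x u v).
  { intros u v. destruct (Hum u v) as [HL _]. unfold tL, sL in HL. lra. }
  assert (HsM : forall u v, dot (dV (dU x) u v) (unitN x u v) = meanH x u v * fF x u v).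
  { intros u v. destruct (Hum u v) as [_ HM]. unfold tM, sM in HM. lra. }
  assert (HsN : forall u v, dot (dV (dV x) u v) (unitN x u v) = meanH x u v * fG x u v).
  { intros u v. specialize (HN0 u v). unfold tN, sN in HN0. lra. }
  assert (Hsolve : forall u v P Q r1 r2, P * fE x u v + Q * fF x u v = r1 * fE x u v + r2 * fF x u v ->
     P * fF x u v + Q * fG x u v = r1 * fF x u v + r2 * fG x u v -> P = r1 /\ Q = r2).
  { intros u v P Q r1 r2 H1 H2. pose proof (gdet_neq x Hx u v) as Hg.
    assert (K1 : gdet x u v * (P - r1) = 0).
    { replace (gdet x u v * (P - r1)) with (fG x u v * ((P * fE x u v + Q * fF x u v) - (r1 * fE x u v + r2 * fF x u v))
        - fF x u v * ((P * fF x u v + Q * fG x u v) - (r1 * fF x u v + r2 * fG x u v))) by (unfold gdet; ring).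
      rewrite H1, H2. ring. }
    assert (K2 : gdet x u v * (Q - r2) = 0).
    { replace (gdet x u v * (Q - r2)) with (fE x u v * ((P * fF x u v + Q * fG x u v) - (r1 * fF x u v + r2 * fG x u v))
        - fF x u v * ((P * fE x u v + Q * fF x u v) - (r1 * fE x u v + r2 * fF x u v))) by (unfold gdet; ring).
      rewrite H1, H2. ring. }
    apply Rmult_integral in K1 as [|]; [contradiction|]. apply Rmult_integral in K2 as [|]; [contradiction|]. lra. }
  (* Together with [Hv]: the covariant derivative of the tangential part of w is h times the
     identity. *)
  assert (Hu : forall u v,
    pu al u v = h u v - al u v * coefA x u v (dU (dU x) u v) - be u v * coefA x u v (dV (dU x) u v) /\
    pu be u v = - al u v * coefB x u v (dU (dU x) u v) - be u v * coefB x u v (dV (dU x) u v)).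
  { intros u v. apply (Hsolve u v).
    - specialize (Huu u v). rewrite (Hdec u v _ _ (HsL u v)), pu_fE, pu_fF in Huu by auto.
      pose proof (coef_dot_xu x Hx u v (dU (dU x) u v)). pose proof (coef_dot_xu x Hx u v (dV (dU x) u v)). nra.
    - specialize (Hvu u v). rewrite (Hdec u v _ _ (HsM u v)), pu_fF, pu_fG in Hvu by auto.
      pose proof (coef_dot_xv x Hx u v (dU (dU x) u v)). pose proof (coef_dot_xv x Hx u v (dV (dU x) u v)). nra. }
  assert (Hv : forall u v,
    pv al u v = - al u v * coefA x u v (dV (dU x) u v) - be u v * coefA x u v (dV (dV x) u v) /\
    pv be u v = h u v - al u v * coefB x u v (dV (dU x) u v) - be u v * coefB x u v (dV (dV x) u v)).
  { intros u v. apply (Hsolve u v).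
    - specialize (Huv u v). rewrite (Hdec u v _ _ (HsM u v)), pv_fE, pv_fF in Huv by auto.
      pose proof (coef_dot_xu x Hx u v (dV (dU x) u v)). pose proof (coef_dot_xu x Hx u v (dV (dV x) u v)). nra.
    - specialize (Hvv u v). rewrite (Hdec u v _ _ (HsN u v)), pv_fF, pv_fG in Hvv by auto.
      pose proof (coef_dot_xv x Hx u v (dV (dU x) u v)). pose proof (coef_dot_xv x Hx u v (dV (dV x) u v)). nra. }
  assert (Hzero : forall u v, be u v = 0 /\ al u v = 0).
  { apply (elliptic_system_zero be al (fun _ _ => 0) (fun _ _ => 1)); auto using torus_fun_const.
    - intros; lra.
    - apply (dominated_ext _ _ (fun u v =>
        coefA x u v (dU (dU x) u v) * al u v + coefA x u v (dV (dU x) u v) * be u v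
        - coefB x u v (dV (dU x) u v) * al u v - coefB x u v (dV (dV x) u v) * be u v)).
      + intros u v. rewrite (proj1 (Hu u v)), (proj2 (Hv u v)). ring.
      + repeat first [apply dominated_minus | apply dominated_plus]; apply dominated_mult;
        auto using dominated_l, dominated_r.
    - apply (dominated_ext _ _ (fun u v => -
        (coefA x u v (dV (dU x) u v) * al u v + coefA x u v (dV (dV x) u v) * be u v
        + coefB x u v (dU (dU x) u v) * al u v + coefB x u v (dV (dU x) u v) * be u v))).
      + intros u v. rewrite (proj2 (Hu u v)), (proj1 (Hv u v)). ring.
      + apply dominated_opp. repeat apply dominated_plus; apply dominated_mult; auto using dominated_l, dominated_r.
    - assert (Th : torus_fun (fun u v => dot (x u v) w)) by (apply torus_fun_dot; auto; apply x_vec; auto).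
      destruct (periodic2_max (fun u v => dot (x u v) w)) as (u0 & v0 & Hmax).
      { apply smooth2_cont2, SF, Th. } { apply Th. }
      exists u0, v0.
      assert (Hmu : dot w (dU x u0 v0) = 0).
      { pose proof (smooth_dot_partial_u x (fun _ _ => w) (SS _ (x_vec x Hx)) (SS _ Tw) u0 v0) as Hd.
        apply is_derive_at_max in Hd; [|intros s; apply Hmax].
        rewrite HUw, (dot_comm (x u0 v0)), Hd0, dot_comm in Hd. lra. }
      assert (Hmv : dot w (dV x u0 v0) = 0).
      { pose proof (smooth_dot_partial_v x (fun _ _ => w) (SS _ (x_vec x Hx)) (SS _ Tw) u0 v0) as Hd.
        apply is_derive_at_max in Hd; [|intros s; apply Hmax].
        rewrite HVw, (dot_comm (x u0 v0)), Hd0, dot_comm in Hd. lra. }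
      unfold al, be, coefA, coefB. rewrite Hmu, Hmv. split; unfold Rdiv; ring. }
  destruct (Hzero 0 0) as [Hb0 Ha0].
  pose proof (Hxu 0 0) as HH. rewrite Hb0, Ha0 in HH.
  pose proof (fE_pos x Hx 0 0) as HE. unfold w in HH. change (dot (dU x 0 0) (dU x 0 0)) with (fE x 0 0) in HH. lra.
Qed.

(** * Lifting angles and periods of closed forms *)

Lemma unit_circle_angle C S : C ^ 2 + S ^ 2 = 1 -> exists phi, cos phi = C /\ sin phi = S.
Proof.
  intros H. assert (HC : -1 <= C <= 1) by nra.
  assert (HS : sqrt (1 - C²) = Rabs S).
  { replace (1 - C²) with (S²) by (unfold Rsqr; lra). apply sqrt_Rsqr_abs. }
  destruct (Rle_dec 0 S) as [H0|H0].
  - exists (acos C). rewrite cos_acos, sin_acos, HS by lra. split; auto. now apply Rabs_pos_eq.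
  - exists (- acos C). rewrite cos_neg, sin_neg, cos_acos, sin_acos, HS by lra. split; auto.
    rewrite Rabs_left by lra. ring.
Qed.

(** The angle is a primitive of P dQ - Q dP, closed because dP and dQ are proportional when P^2 +
    Q^2 is constant. The angle may have periods, so only its partial derivatives are claimed
    periodic. *)
Lemma angle_lift P Q : torus_fun P -> torus_fun Q -> (forall u v, P u v ^ 2 + Q u v ^ 2 = 1) ->
  exists th, smooth2 th /\ torus_fun (pu th) /\ torus_fun (pv th) /\
    forall u v, cos (th u v) = P u v /\ sin (th u v) = Q u v.
Proof.
  intros TP TQ H1.
  assert (SP := smooth_of_fun _ TP). assert (SQ := smooth_of_fun _ TQ).
  assert (SPu := smooth2_pu _ SP). assert (SPv := smooth2_pv _ SP).
  assert (SQu := smooth2_pu _ SQ). assert (SQv := smooth2_pv _ SQ).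
  assert (Hu : forall u v, P u v * pu P u v + Q u v * pu Q u v = 0).
  { intros u v. pose proof (pu_ext (fun u v => P u v * P u v + Q u v * Q u v) (fun _ _ => 1) u v) as H.
    rewrite pu_plus, !pu_mult, pu_const in H by auto using smooth2_mult.
    assert (H' := H ltac:(intros a b; rewrite <- (H1 a b); ring)). lra. }
  assert (Hv : forall u v, P u v * pv P u v + Q u v * pv Q u v = 0).
  { intros u v. pose proof (pv_ext (fun u v => P u v * P u v + Q u v * Q u v) (fun _ _ => 1) u v) as H.
    rewrite pv_plus, !pv_mult, pv_const in H by auto using smooth2_mult.
    assert (H' := H ltac:(intros a b; rewrite <- (H1 a b); ring)). lra. }
  set (ou := fun u v => P u v * pu Q u v - Q u v * pu P u v).
  set (ov := fun u v => P u v * pv Q u v - Q u v * pv P u v).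
  assert (Tou : torus_fun ou) by (apply torus_fun_minus; apply torus_fun_mult; auto using torus_fun_pu).
  assert (Tov : torus_fun ov) by (apply torus_fun_minus; apply torus_fun_mult; auto using torus_fun_pv).
  assert (Hclosed : forall u v, pv ou u v = pu ov u v).
  { intros u v. unfold ou, ov. rewrite pv_minus, pu_minus, !pv_mult, !pu_mult by auto using smooth2_mult.
    rewrite !pv_pu_comm by auto.
    specialize (Hu u v). specialize (Hv u v). specialize (H1 u v).
    assert (Hz : (P u v ^ 2 + Q u v ^ 2) * (pv P u v * pu Q u v - pv Q u v * pu P u v) = 0).
    { replace ((P u v ^ 2 + Q u v ^ 2) * (pv P u v * pu Q u v - pv Q u v * pu P u v))
        with (P u v * pu Q u v * (P u v * pv P u v + Q u v * pv Q u v)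
              - P u v * pv Q u v * (P u v * pu P u v + Q u v * pu Q u v)
              + Q u v * pv P u v * (P u v * pu P u v + Q u v * pu Q u v)
              - Q u v * pu P u v * (P u v * pv P u v + Q u v * pv Q u v)) by ring.
      rewrite Hu, Hv. ring. }
    rewrite H1 in Hz. lra. }
  destruct (closed_form_exact ou ov (pv ou)) as (th & Htu & Htv & Hc).
  { apply smooth2_cont2, smooth_of_fun, Tou. } { apply smooth2_cont2, smooth_of_fun, Tov. }
  { apply smooth2_cont2, smooth2_pv, smooth_of_fun, Tou. } { apply torus_fun_partial_v, Tou. }
  { intros u v. rewrite Hclosed. apply torus_fun_partial_u, Tov. }
  assert (Sth : smooth2 th) by (apply (smooth2_intro th ou ov); auto using smooth_of_fun).
  assert (Eu : pu th = ou) by (extensionality u; extensionality v; apply is_derive_unique, Htu).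
  assert (Ev : pv th = ov) by (extensionality u; extensionality v; apply is_derive_unique, Htv).
  assert (Hcu : partial_u (fun u v => cos (th u v)) (fun u v => ou u v * - sin (th u v)))
    by (apply (partial_u_comp th ou cos (fun y => - sin y)); auto; intros; apply is_derive_cos).
  assert (Hcv : partial_v (fun u v => cos (th u v)) (fun u v => ov u v * - sin (th u v)))
    by (apply (partial_v_comp th ov cos (fun y => - sin y)); auto; intros; apply is_derive_cos).
  assert (Hsu : partial_u (fun u v => sin (th u v)) (fun u v => ou u v * cos (th u v)))
    by (apply (partial_u_comp th ou sin cos); auto; intros; apply is_derive_sin).
  assert (Hsv : partial_v (fun u v => sin (th u v)) (fun u v => ov u v * cos (th u v)))
    by (apply (partial_v_comp th ov sin cos); auto; intros; apply is_derive_sin).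
  assert (PPu := torus_fun_partial_u _ TP). assert (PPv := torus_fun_partial_v _ TP).
  assert (PQu := torus_fun_partial_u _ TQ). assert (PQv := torus_fun_partial_v _ TQ).
  (* CC + i SS = (P + i Q) exp(- i th) turns out to be constant; its argument [phi] corrects the
     primitive. *)
  set (CC := fun u v => P u v * cos (th u v) + Q u v * sin (th u v)).
  set (SS := fun u v => Q u v * cos (th u v) - P u v * sin (th u v)).
  assert (Halg : forall p q p' q' c s, p ^ 2 + q ^ 2 = 1 -> p * p' + q * q' = 0 ->
    p' * c + p * ((p * q' - q * p') * - s) + (q' * s + q * ((p * q' - q * p') * c)) = 0 /\
    q' * c + q * ((p * q' - q * p') * - s) - (p' * s + p * ((p * q' - q * p') * c)) = 0).
  { intros p q p' q' c s E1 E2.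
    assert (F1 : p' + q * (p * q' - q * p') = 0).
    { replace (p' + q * (p * q' - q * p')) with (p' * (1 - (p ^ 2 + q ^ 2)) + p * (p * p' + q * q')) by ring.
      rewrite E1, E2. ring. }
    assert (F2 : q' - p * (p * q' - q * p') = 0).
    { replace (q' - p * (p * q' - q * p')) with (q' * (1 - (p ^ 2 + q ^ 2)) + q * (p * p' + q * q')) by ring.
      rewrite E1, E2. ring. }
    split.
    - replace (p' * c + p * ((p * q' - q * p') * - s) + (q' * s + q * ((p * q' - q * p') * c)))
        with (c * (p' + q * (p * q' - q * p')) + s * (q' - p * (p * q' - q * p'))) by ring. rewrite F1, F2. ring.
    - replace (q' * c + q * ((p * q' - q * p') * - s) - (p' * s + p * ((p * q' - q * p') * c)))
        with (c * (q' - p * (p * q' - q * p')) - s * (p' + q * (p * q' - q * p'))) by ring. rewrite F1, F2. ring. }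
  assert (HCC : forall u v, CC u v = CC 0 0).
  { intros u v. apply partials_zero_const.
    - intros a b. pose proof (partial_u_plus _ _ _ _ (partial_u_mult _ _ _ _ PPu Hcu) (partial_u_mult _ _ _ _ PQu Hsu) a b) as H.
      cbv beta in H. unfold ou in H. rewrite (proj1 (Halg _ _ _ _ _ _ (H1 a b) (Hu a b))) in H. exact H.
    - intros a b. pose proof (partial_v_plus _ _ _ _ (partial_v_mult _ _ _ _ PPv Hcv) (partial_v_mult _ _ _ _ PQv Hsv) a b) as H.
      cbv beta in H. unfold ov in H. rewrite (proj1 (Halg _ _ _ _ _ _ (H1 a b) (Hv a b))) in H. exact H. }
  assert (HSS : forall u v, SS u v = SS 0 0).
  { intros u v. apply partials_zero_const.
    - intros a b. pose proof (partial_u_minus _ _ _ _ (partial_u_mult _ _ _ _ PQu Hcu) (partial_u_mult _ _ _ _ PPu Hsu) a b) as H.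
      cbv beta in H. unfold ou in H. rewrite (proj2 (Halg _ _ _ _ _ _ (H1 a b) (Hu a b))) in H. exact H.
    - intros a b. pose proof (partial_v_minus _ _ _ _ (partial_v_mult _ _ _ _ PQv Hcv) (partial_v_mult _ _ _ _ PPv Hsv) a b) as H.
      cbv beta in H. unfold ov in H. rewrite (proj2 (Halg _ _ _ _ _ _ (H1 a b) (Hv a b))) in H. exact H. }
  assert (Hcs : forall y, cos y ^ 2 + sin y ^ 2 = 1).
  { intros y. pose proof (sin2_cos2 y) as H. unfold Rsqr in H. lra. }
  destruct (unit_circle_angle (CC 0 0) (SS 0 0)) as (phi & Hcp & Hsp).
  { unfold CC, SS. specialize (H1 0 0). specialize (Hcs (th 0 0)).
    replace (_ + _) with ((P 0 0 ^ 2 + Q 0 0 ^ 2) * (cos (th 0 0) ^ 2 + sin (th 0 0) ^ 2)) by ring.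
    rewrite H1, Hcs. ring. }
  exists (fun u v => th u v + phi).
  assert (Eu' : pu (fun u v => th u v + phi) = ou).
  { extensionality u; extensionality v. rewrite pu_plus, pu_const, Eu by auto using smooth2_const. ring. }
  assert (Ev' : pv (fun u v => th u v + phi) = ov).
  { extensionality u; extensionality v. rewrite pv_plus, pv_const, Ev by auto using smooth2_const. ring. }
  rewrite Eu', Ev'. repeat split; try apply Tou; try apply Tov.
  - apply smooth2_plus; auto using smooth2_const.
  - rewrite cos_plus, Hcp, Hsp, <- (HCC u v), <- (HSS u v). unfold CC, SS. specialize (Hcs (th u v)).
    transitivity (P u v * (cos (th u v) ^ 2 + sin (th u v) ^ 2)); [ring | rewrite Hcs; ring].
  - rewrite sin_plus, Hcp, Hsp, <- (HCC u v), <- (HSS u v). unfold CC, SS. specialize (Hcs (th u v)).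
    transitivity (Q u v * (cos (th u v) ^ 2 + sin (th u v) ^ 2)); [ring | rewrite Hcs; ring].
Qed.

Lemma shift_u_partials g gu gv : partial_u g gu -> partial_v g gv ->
  partial_u (fun u v => g (u + 1) v) (fun u v => gu (u + 1) v) /\
  partial_v (fun u v => g (u + 1) v) (fun u v => gv (u + 1) v).
Proof.
  intros Hu Hv. split; [|intros u v; apply Hv].
  intros u v. rewrite <- (Rmult_1_l (gu (u + 1) v)).
  apply (is_derive_Rcomp (fun t => g t v) (fun t => t + 1)); [apply Hu|].
  auto_derive; auto.
Qed.

Lemma shift_v_partials g gu gv : partial_u g gu -> partial_v g gv ->
  partial_u (fun u v => g u (v + 1)) (fun u v => gu u (v + 1)) /\
  partial_v (fun u v => g u (v + 1)) (fun u v => gv u (v + 1)).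
Proof.
  intros Hu Hv. split; [intros u v; apply Hu|].
  intros u v. rewrite <- (Rmult_1_l (gv u (v + 1))).
  apply (is_derive_Rcomp (fun t => g u t) (fun t => t + 1)); [apply Hv|].
  auto_derive; auto.
Qed.

(** The shifted function and the multiple of g have the same differential. Used with factors 1 for
    the lifted angle and with signs for the primitive of the principal form. *)
Lemma quasiperiodic_constants g gu gv s1 s2 : partial_u g gu -> partial_v g gv ->
  (forall u v, gu (u + 1) v = s1 * gu u v /\ gv (u + 1) v = s1 * gv u v) ->
  (forall u v, gu u (v + 1) = s2 * gu u v /\ gv u (v + 1) = s2 * gv u v) ->
  exists k1 k2, forall u v, g (u + 1) v = s1 * g u v + k1 /\ g u (v + 1) = s2 * g u v + k2.
Proof.
  intros Hu Hv H1 H2.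
  exists (g (0 + 1) 0 - s1 * g 0 0), (g 0 (0 + 1) - s2 * g 0 0). intros u v.
  destruct (shift_u_partials g gu gv Hu Hv) as [A1 A2]. destruct (shift_v_partials g gu gv Hu Hv) as [B1 B2].
  split.
  - assert (H : g (u + 1) v - s1 * g u v = g (0 + 1) 0 - s1 * g 0 0); [|lra].
    apply (partials_zero_const (fun u v => g (u + 1) v - s1 * g u v)).
    + intros a b. pose proof (partial_u_minus _ _ _ _ A1 (partial_u_mult _ _ _ _ (partial_u_const s1) Hu) a b) as H.
      cbv beta in H. rewrite (proj1 (H1 a b)) in H.
      replace (s1 * gu a b - (0 * g a b + s1 * gu a b)) with 0 in H by ring. exact H.
    + intros a b. pose proof (partial_v_minus _ _ _ _ A2 (partial_v_mult _ _ _ _ (partial_v_const s1) Hv) a b) as H.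
      cbv beta in H. rewrite (proj2 (H1 a b)) in H.
      replace (s1 * gv a b - (0 * g a b + s1 * gv a b)) with 0 in H by ring. exact H.
  - assert (H : g u (v + 1) - s2 * g u v = g 0 (0 + 1) - s2 * g 0 0); [|lra].
    apply (partials_zero_const (fun u v => g u (v + 1) - s2 * g u v)).
    + intros a b. pose proof (partial_u_minus _ _ _ _ B1 (partial_u_mult _ _ _ _ (partial_u_const s2) Hu) a b) as H.
      cbv beta in H. rewrite (proj1 (H2 a b)) in H.
      replace (s2 * gu a b - (0 * g a b + s2 * gu a b)) with 0 in H by ring. exact H.
    + intros a b. pose proof (partial_v_minus _ _ _ _ B2 (partial_v_mult _ _ _ _ (partial_v_const s2) Hv) a b) as H.
      cbv beta in H. rewrite (proj2 (H2 a b)) in H.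
      replace (s2 * gv a b - (0 * g a b + s2 * gv a b)) with 0 in H by ring. exact H.
Qed.

(** The square of g is periodic, so g dg = 0 at its maximum; if g vanishes there, it vanishes
    identically. *)
Lemma signed_periodic_has_critical_point g gu gv s1 s2 :
  cont2 g -> partial_u g gu -> partial_v g gv -> s1 ^ 2 = 1 -> s2 ^ 2 = 1 ->
  (forall u v, g (u + 1) v = s1 * g u v /\ g u (v + 1) = s2 * g u v) ->
  exists u v, gu u v = 0 /\ gv u v = 0.
Proof.
  intros Hc Hu Hv Hs1 Hs2 Hp.
  destruct (periodic2_max (fun u v => g u v * g u v)) as (u0 & v0 & Hm).
  { apply cont2_mult; auto. }
  { intros u v. destruct (Hp u v) as [-> ->]. split; [rewrite <- (Rmult_1_l (g u v * g u v)), <- Hs1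
      | rewrite <- (Rmult_1_l (g u v * g u v)), <- Hs2]; ring. }
  pose proof (is_derive_at_max _ _ _ (partial_u_mult _ _ _ _ Hu Hu u0 v0) (fun s => Hm s v0)) as H1.
  pose proof (is_derive_at_max _ _ _ (partial_v_mult _ _ _ _ Hv Hv u0 v0) (fun s => Hm u0 s)) as H2.
  cbv beta in H1, H2.
  exists u0, v0. destruct (Req_dec (g u0 v0) 0) as [H0|H0].
  - assert (Hz : forall u v, g u v = 0).
    { intros u v. specialize (Hm u v). rewrite H0 in Hm. apply Rsqr_0_uniq. unfold Rsqr.
      pose proof (Rle_0_sqr (g u v)) as Hq. unfold Rsqr in Hq. lra. }
    split.
    + exact (partial_u_unique g (fun _ _ => 0) gu (fun _ _ => 0) u0 v0 Hu (partial_u_const 0) Hz).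
    + exact (partial_v_unique g (fun _ _ => 0) gv (fun _ _ => 0) u0 v0 Hv (partial_v_const 0) Hz).
  - split.
    + apply (Rmult_eq_reg_l (g u0 v0)); auto. lra.
    + apply (Rmult_eq_reg_l (g u0 v0)); auto. lra.
Qed.

(* If some sign is -1, a primitive can be normalised to change only by signs under the periods. *)
Lemma closed_form_untwisted P Q S s1 s2 :
  cont2 P -> cont2 Q -> cont2 S -> partial_v P S -> partial_u Q S ->
  (forall u v, P u v <> 0 \/ Q u v <> 0) ->
  s1 ^ 2 = 1 -> s2 ^ 2 = 1 ->
  (forall u v, P (u + 1) v = s1 * P u v /\ Q (u + 1) v = s1 * Q u v) ->
  (forall u v, P u (v + 1) = s2 * P u v /\ Q u (v + 1) = s2 * Q u v) ->
  s1 = 1 /\ s2 = 1.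
Proof.
  intros CP CQ CS HP HQ Hnz Hs1 Hs2 H1 H2.
  destruct (closed_form_exact P Q S) as (phi & Hu & Hv & Hc); auto.
  destruct (quasiperiodic_constants phi P Q s1 s2 Hu Hv H1 H2) as (k1 & k2 & Hk).
  (* A common fixed point c of the two affine monodromies y -> s_i y + k_i would make phi - c
     periodic up to sign. *)
  assert (Hno : forall c, s1 * c + k1 = c -> s2 * c + k2 = c -> False).
  { intros c Hc1 Hc2.
    destruct (signed_periodic_has_critical_point (fun u v => phi u v - c) (fun u v => P u v - 0) (fun u v => Q u v - 0) s1 s2)
      as (u & v & E1 & E2); auto.
    - apply cont2_minus; auto using cont2_const.
    - apply partial_u_minus; auto using partial_u_const.
    - apply partial_v_minus; auto using partial_v_const.
    - intros u v. destruct (Hk u v) as [-> ->]. split; nra.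
    - destruct (Hnz u v); lra. }
  (* The monodromies commute, as both orders compute phi at (1, 1). If some s_i = -1, its unique
     fixed point k_i / 2 is therefore fixed by the other one too. *)
  assert (Hcomm : s2 * k1 + k2 = s1 * k2 + k1).
  { pose proof (proj2 (Hk (0 + 1) 0)) as A. rewrite (proj1 (Hk 0 0)) in A.
    pose proof (proj1 (Hk 0 (0 + 1))) as B. rewrite (proj2 (Hk 0 0)) in B. lra. }
  assert (D1 : s1 = 1 \/ s1 = -1).
  { assert (Hf : (s1 - 1) * (s1 + 1) = 0) by lra. apply Rmult_integral in Hf. lra. }
  assert (D2 : s2 = 1 \/ s2 = -1).
  { assert (Hf : (s2 - 1) * (s2 + 1) = 0) by lra. apply Rmult_integral in Hf. lra. }
  destruct D1 as [->| ->].
  - split; auto. destruct D2 as [|E2]; auto. exfalso. subst s2. apply (Hno (k2 / 2)); lra.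
  - exfalso. apply (Hno (k1 / 2)); [lra|]. destruct D2; subst s2; lra.
Qed.

(** * The principal frame *)

Definition vadd (a b : V3) : V3 := mkV (Defs.c1 a + Defs.c1 b) (c2 a + c2 b) (c3 a + c3 b).

Definition rot (c s : R) (a b : V3) : V3 := vadd (Defs.scal c a) (Defs.scal s b).

Lemma dot_rot c s a b y : dot (rot c s a b) y = c * dot a y + s * dot b y.
Proof. unfold rot, vadd, dot, Defs.scal; simpl; ring. Qed.

Lemma smooth_rot c s X Y : smooth2 c -> smooth2 s -> smooth_V3 X -> smooth_V3 Y ->
  smooth_V3 (fun u v => rot (c u v) (s u v) (X u v) (Y u v)).
Proof.
  intros Sc Ss (X1 & X2 & X3) (Y1 & Y2 & Y3).
  split; [|split]; simpl; apply smooth2_plus; apply smooth2_mult; assumption.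
Qed.

Lemma orthonormal_dot e1 e2 y z : dot e1 e1 = 1 -> dot e2 e2 = 1 -> dot e1 e2 = 0 ->
  dot y z = dot y e1 * dot z e1 + dot y e2 * dot z e2 + dot y (cross e1 e2) * dot z (cross e1 e2).
Proof.
  intros H1 H2 H3.
  assert (H : (dot e1 e1 * dot e2 e2 - dot e1 e2 ^ 2) * dot y z =
    (dot y e1 * dot e2 e2 - dot y e2 * dot e1 e2) * dot z e1
    + (dot y e2 * dot e1 e1 - dot y e1 * dot e1 e2) * dot z e2
    + dot y (cross e1 e2) * dot z (cross e1 e2)) by (unfold dot, cross; simpl; ring).
  rewrite H1, H2, H3 in H. lra.
Qed.

Section Frame.

Variables (x : R -> R -> V3) (f : R -> R) (eps : R).
Hypothesis x_immersion : torus_immersion x.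
Hypothesis eps_pos : 0 < eps.
Hypothesis f_smooth : smooth_on_ray eps f.
Hypothesis weingarten : forall u v, meanH x u v = f (meanH x u v ^ 2 - gaussK x u v).
Hypothesis defect_pos : forall u v, 0 < defect x u v.

(** With [b2], the Gram-Schmidt frame of (x_u, x_v): a periodic reference frame, against which the
    principal angle is measured. *)
Definition b1 u v := Defs.scal (/ sqrt (fE x u v)) (dU x u v).
Definition b2 u v := cross (unitN x u v) (b1 u v).

Lemma sqrt_fE_pos u v : 0 < sqrt (fE x u v).
Proof. apply sqrt_lt_R0, fE_pos; auto. Qed.
Lemma sqrt_gdet_pos u v : 0 < sqrt (gdet x u v).
Proof. apply sqrt_lt_R0, gdet_pos; auto. Qed.
Lemma sqrt_fE_sqr u v : sqrt (fE x u v) * sqrt (fE x u v) = fE x u v.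
Proof. apply sqrt_sqrt. pose proof (fE_pos x x_immersion u v); lra. Qed.
Lemma sqrt_gdet_sqr u v : sqrt (gdet x u v) * sqrt (gdet x u v) = gdet x u v.
Proof. apply sqrt_sqrt. pose proof (gdet_pos x x_immersion u v); lra. Qed.
Lemma sqrt_defect_pos u v : 0 < sqrt (defect x u v).
Proof. apply sqrt_lt_R0; auto. Qed.

Lemma b1_vec : torus_vec b1.
Proof.
  apply torus_vec_scal; [|apply xu_vec; auto].
  apply torus_fun_inv; [apply torus_fun_sqrt; [apply fE_fun | apply fE_pos]; auto|].
  intros u v. pose proof (sqrt_fE_pos u v). lra.
Qed.
Lemma b2_vec : torus_vec b2.
Proof. apply torus_vec_cross; [apply unitN_vec; auto | apply b1_vec]. Qed.

Lemma dot_b1 u v y : dot (b1 u v) y = dot (dU x u v) y / sqrt (fE x u v).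
Proof. unfold b1, dot, Defs.scal; simpl. field. pose proof (sqrt_fE_pos u v); lra. Qed.

Lemma dot_b2 u v y : dot (b2 u v) y =
  (fE x u v * dot (dV x u v) y - fF x u v * dot (dU x u v) y) / (sqrt (fE x u v) * sqrt (gdet x u v)).
Proof.
  unfold b2, b1, unitN. rewrite vnorm_cross by auto.
  pose proof (sqrt_fE_pos u v). pose proof (sqrt_gdet_pos u v).
  set (rE := sqrt (fE x u v)) in *. set (rg := sqrt (gdet x u v)) in *.
  unfold fE, fF, dot, cross, Defs.scal; simpl. field. lra.
Qed.

Lemma xu_b1 u v : dot (dU x u v) (b1 u v) = sqrt (fE x u v).
Proof.
  rewrite dot_comm, dot_b1. change (dot (dU x u v) (dU x u v)) with (fE x u v).
  rewrite <- sqrt_fE_sqr at 1. field. pose proof (sqrt_fE_pos u v); lra.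
Qed.
Lemma xv_b1 u v : dot (dV x u v) (b1 u v) = fF x u v / sqrt (fE x u v).
Proof. rewrite dot_comm, dot_b1. reflexivity. Qed.
Lemma xu_b2 u v : dot (dU x u v) (b2 u v) = 0.
Proof.
  rewrite dot_comm, dot_b2, (dot_comm (dV x u v)).
  change (dot (dU x u v) (dU x u v)) with (fE x u v). change (dot (dU x u v) (dV x u v)) with (fF x u v).
  field. pose proof (sqrt_fE_pos u v); pose proof (sqrt_gdet_pos u v); lra.
Qed.
Lemma xv_b2 u v : dot (dV x u v) (b2 u v) = sqrt (gdet x u v) / sqrt (fE x u v).
Proof.
  rewrite dot_comm, dot_b2.
  change (dot (dV x u v) (dV x u v)) with (fG x u v). change (dot (dU x u v) (dV x u v)) with (fF x u v).
  replace (fE x u v * fG x u v - fF x u v * fF x u v) with (sqrt (gdet x u v) * sqrt (gdet x u v))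
    by (rewrite sqrt_gdet_sqr; unfold gdet; ring).
  field. pose proof (sqrt_fE_pos u v); pose proof (sqrt_gdet_pos u v); lra.
Qed.
Lemma b1_b1 u v : dot (b1 u v) (b1 u v) = 1.
Proof. rewrite dot_b1, xu_b1. field. pose proof (sqrt_fE_pos u v); lra. Qed.
Lemma b1_b2 u v : dot (b1 u v) (b2 u v) = 0.
Proof. rewrite dot_b1, xu_b2. field. pose proof (sqrt_fE_pos u v); lra. Qed.
Lemma b2_b2 u v : dot (b2 u v) (b2 u v) = 1.
Proof.
  rewrite dot_b2, xu_b2, xv_b2. rewrite <- sqrt_fE_sqr at 1. field.
  pose proof (sqrt_fE_pos u v); pose proof (sqrt_gdet_pos u v); lra.
Qed.
Lemma b1_N u v : dot (b1 u v) (unitN x u v) = 0.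
Proof. rewrite dot_b1, dot_comm, unitN_xu. field. pose proof (sqrt_fE_pos u v); lra. Qed.
Lemma b2_N u v : dot (b2 u v) (unitN x u v) = 0.
Proof. unfold b2, dot, cross; simpl; ring. Qed.

Lemma cross_b1_b2 u v : cross (b1 u v) (b2 u v) = unitN x u v.
Proof.
  pose proof (b1_b1 u v) as H1. pose proof (b1_N u v) as H2. unfold b2.
  generalize dependent (b1 u v). generalize dependent (unitN x u v).
  intros [n1 n2 n3] [a1 a2 a3]. unfold dot, cross; simpl. intros H1 H2.
  f_equal.
  - transitivity (n1 * (a1 * a1 + a2 * a2 + a3 * a3) - a1 * (a1 * n1 + a2 * n2 + a3 * n3)); [ring | rewrite H1, H2; ring].
  - transitivity (n2 * (a1 * a1 + a2 * a2 + a3 * a3) - a2 * (a1 * n1 + a2 * n2 + a3 * n3)); [ring | rewrite H1, H2; ring].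
  - transitivity (n3 * (a1 * a1 + a2 * a2 + a3 * a3) - a3 * (a1 * n1 + a2 * n2 + a3 * n3)); [ring | rewrite H1, H2; ring].
Qed.

(* The matrix of the trace-free second fundamental form in (b1, b2) is [[fp, fr], [fr, - fp]]. *)
Definition fp u v := tL x u v / fE x u v.
Definition fr u v := (fE x u v * tM x u v - fF x u v * tL x u v) / (fE x u v * sqrt (gdet x u v)).

Lemma fp_fun : torus_fun fp.
Proof. apply torus_fun_div; [apply tL_fun | apply fE_fun | apply fE_neq]; auto. Qed.
Lemma fr_fun : torus_fun fr.
Proof.
  apply torus_fun_div.
  - apply torus_fun_minus; apply torus_fun_mult; auto using fE_fun, fF_fun, tL_fun, tM_fun.
  - apply torus_fun_mult; [apply fE_fun; auto | apply torus_fun_sqrt; [apply gdet_fun | apply gdet_pos]; auto].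
  - intros u v. pose proof (sqrt_gdet_pos u v). pose proof (fE_pos x x_immersion u v). nra.
Qed.

(** Hence (fp, fr) / sqrt(H^2 - K) is a map from the torus to the circle, and its angle can be
    lifted. *)
Lemma fp_fr_norm u v : fp u v ^ 2 + fr u v ^ 2 = defect x u v.
Proof.
  pose proof (defect_squares x x_immersion u v) as H.
  pose proof (sqrt_gdet_pos u v) as Hs. pose proof (fE_pos x x_immersion u v) as HE.
  pose proof (sqrt_gdet_sqr u v) as Hss. rewrite <- Hss in H.
  apply (Rmult_eq_reg_r (sqrt (gdet x u v) * sqrt (gdet x u v) * fE x u v ^ 2)).
  - rewrite <- !Rmult_assoc in *. rewrite H. unfold fp, fr. field. lra.
  - assert (0 < sqrt (gdet x u v) * sqrt (gdet x u v) * fE x u v ^ 2); [|lra].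
    apply Rmult_lt_0_compat; [nra | apply pow_lt; auto].
Qed.

Lemma sL_eq u v : sL x u v = fE x u v * (meanH x u v + fp u v).
Proof. unfold fp, tL. field. apply fE_neq; auto. Qed.
Lemma sM_eq u v : sM x u v = fF x u v * (meanH x u v + fp u v) + sqrt (gdet x u v) * fr u v.
Proof.
  pose proof (sqrt_gdet_pos u v). pose proof (fE_pos x x_immersion u v). unfold fp, fr, tL, tM. field. lra.
Qed.
Lemma sN_eq u v : fE x u v * sN x u v = fF x u v ^ 2 * (meanH x u v + fp u v)
  + 2 * fF x u v * sqrt (gdet x u v) * fr u v + gdet x u v * (meanH x u v - fp u v).
Proof.
  pose proof (trace_free x x_immersion u v) as Ht.
  assert (HL : tL x u v = fE x u v * fp u v) by (unfold fp; field; apply fE_neq; auto).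
  assert (HM : tM x u v = fF x u v * fp u v + sqrt (gdet x u v) * fr u v).
  { pose proof (sM_eq u v). unfold tM. lra. }
  rewrite HL, HM in Ht. unfold tN in Ht. unfold gdet in *. nra.
Qed.

Lemma dU_unitN_b1 u v : dot (dU (unitN x) u v) (b1 u v) =
  - (dot (dU x u v) (b1 u v) * (meanH x u v + fp u v) + dot (dU x u v) (b2 u v) * fr u v).
Proof.
  rewrite xu_b1, xu_b2, dot_comm, dot_b1, dot_comm, dU_unitN_xu, sL_eq by auto.
  rewrite <- sqrt_fE_sqr at 1. field. pose proof (sqrt_fE_pos u v); lra.
Qed.
Lemma dU_unitN_b2 u v : dot (dU (unitN x) u v) (b2 u v) =
  - (dot (dU x u v) (b1 u v) * fr u v + dot (dU x u v) (b2 u v) * (meanH x u v - fp u v)).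
Proof.
  rewrite xu_b1, xu_b2, dot_comm, dot_b2, !(dot_comm _ (dU (unitN x) u v)), dU_unitN_xu, dU_unitN_xv, sL_eq, sM_eq by auto.
  pose proof (sqrt_fE_sqr u v) as Hr. pose proof (sqrt_fE_pos u v). pose proof (sqrt_gdet_pos u v).
  set (rE := sqrt (fE x u v)) in *. rewrite <- Hr. field. lra.
Qed.
Lemma dV_unitN_b1 u v : dot (dV (unitN x) u v) (b1 u v) =
  - (dot (dV x u v) (b1 u v) * (meanH x u v + fp u v) + dot (dV x u v) (b2 u v) * fr u v).
Proof.
  rewrite xv_b1, xv_b2, dot_comm, dot_b1, dot_comm, dV_unitN_xu, sM_eq by auto.
  field. pose proof (sqrt_fE_pos u v); lra.
Qed.
Lemma dV_unitN_b2 u v : dot (dV (unitN x) u v) (b2 u v) =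
  - (dot (dV x u v) (b1 u v) * fr u v + dot (dV x u v) (b2 u v) * (meanH x u v - fp u v)).
Proof.
  rewrite xv_b1, xv_b2, dot_comm, dot_b2, !(dot_comm _ (dV (unitN x) u v)), dV_unitN_xu, dV_unitN_xv, sM_eq by auto.
  replace (fE x u v * - sN x u v) with (- (fE x u v * sN x u v)) by ring. rewrite sN_eq.
  rewrite <- sqrt_gdet_sqr at 2. field. pose proof (sqrt_fE_pos u v); pose proof (sqrt_gdet_pos u v); lra.
Qed.

Lemma II_shape u v w w' :
  II x u v w w' = - (coefA x u v w * dot w' (dU (unitN x) u v) + coefB x u v w * dot w' (dV (unitN x) u v)).
Proof. rewrite dot_dU_unitN, dot_dV_unitN by auto. unfold II. ring. Qed.

Lemma II_principal u v k w w' : dot w' (unitN x u v) = 0 ->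
  dot w' (dU (unitN x) u v) = - k * dot w' (dU x u v) ->
  dot w' (dV (unitN x) u v) = - k * dot w' (dV x u v) -> II x u v w w' = k * dot w w'.
Proof.
  intros HN Hu Hv. rewrite II_shape, Hu, Hv, (dot_decomposition x x_immersion u v w w'), HN. ring.
Qed.

(* The logarithmic derivative of the integrating factor of <e1, dx> prescribed by the Codazzi equation. *)
Definition log_factor' (t : R) : R := (Derive f t + / (2 * sqrt t)) / (2 * sqrt t).
(** The integrand is singular at t = 0, so a positive base point is taken; its choice only rescales
    the weight by a constant. *)
Definition log_factor (t : R) : R := RInt log_factor' 1 t.

Lemma continuous_log_factor' t : 0 < t -> continuous log_factor' t.
Proof.
  intros Ht. pose proof (sqrt_lt_R0 t Ht) as Hs. unfold log_factor'.
  assert (Hi : continuous (fun t => / (2 * sqrt t)) t).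
  { apply (ex_derive_continuous (fun t => / (2 * sqrt t))). auto_derive. repeat split; auto; lra. }
  apply (continuous_mult (K := R_AbsRing) (fun t => Derive f t + / (2 * sqrt t)) (fun t => / (2 * sqrt t))); auto.
  apply (continuous_plus (V := R_NormedModule) (Derive f) (fun t => / (2 * sqrt t))); auto.
  apply (continuous_Derive_f f eps eps_pos f_smooth). lra.
Qed.

Lemma is_derive_log_factor t : 0 < t -> is_derive log_factor t (log_factor' t).
Proof.
  intros Ht. apply (is_derive_RInt (V := R_NormedModule) log_factor' log_factor 1 t).
  - assert (Hl : locally t (fun b => 0 < b)) by (apply open_gt; auto).
    apply (filter_imp _ _ (fun b Hb => RInt_correct (V := R_CompleteNormedModule) log_factor' 1 b
      (ex_RInt_continuous (V := R_CompleteNormedModule) log_factor' 1 b (fun z Hz => continuous_log_factor' z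
        (Rlt_le_trans _ _ _ (Rmin_glb_lt _ _ _ Rlt_0_1 Hb) (proj1 Hz)))))).
    exact Hl.
  - now apply continuous_log_factor'.
Qed.

(** * The half-angle frame and its closed principal form *)

Section Lift.

Variable th : R -> R -> R.
Hypothesis th_smooth : smooth2 th.
Hypothesis th_cos : forall u v, fp u v = sqrt (defect x u v) * cos (th u v).
Hypothesis th_sin : forall u v, fr u v = sqrt (defect x u v) * sin (th u v).

(** A symmetric trace-free matrix with angle th has its positive eigenvector at angle th/2; halving
    an angle known modulo 2 pi creates the sign ambiguity. *)
Let c u v := cos (th u v / 2).
Let s u v := sin (th u v / 2).
Definition e1 u v := rot (c u v) (s u v) (b1 u v) (b2 u v).
Definition e2 u v := rot (- s u v) (c u v) (b1 u v) (b2 u v).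
Let k1 u v := meanH x u v + sqrt (defect x u v).
Let k2 u v := meanH x u v - sqrt (defect x u v).

Lemma half_angle u v : c u v ^ 2 + s u v ^ 2 = 1 /\
  cos (th u v) = c u v ^ 2 - s u v ^ 2 /\ sin (th u v) = 2 * s u v * c u v.
Proof.
  unfold c, s. set (h := th u v / 2). replace (th u v) with (2 * h) by (unfold h; field).
  rewrite cos_2a, sin_2a. pose proof (sin2_cos2 h) as H. unfold Rsqr in H. repeat split; lra.
Qed.

Lemma half_smooth : smooth2 c /\ smooth2 s.
Proof.
  assert (Sh : smooth2 (fun u v => th u v / 2)).
  { apply (smooth2_mult th (fun _ _ => / 2)); auto using smooth2_const. }
  split; [apply (smooth2_cos _ Sh) | apply (smooth2_sin _ Sh)].
Qed.

Lemma e1_smooth : smooth_V3 e1.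
Proof.
  destruct half_smooth as [Sc Ss]. apply (smooth_rot c s b1 b2); auto.
  apply smooth_of_vec, b1_vec. apply smooth_of_vec, b2_vec.
Qed.
Lemma e2_smooth : smooth_V3 e2.
Proof.
  destruct half_smooth as [Sc Ss]. apply (smooth_rot (fun u v => - s u v) c b1 b2); auto using smooth2_opp.
  apply smooth_of_vec, b1_vec. apply smooth_of_vec, b2_vec.
Qed.

Lemma e1_e1 u v : dot (e1 u v) (e1 u v) = 1.
Proof.
  unfold e1. rewrite dot_rot, !(dot_comm _ (rot _ _ _ _)), !dot_rot, (dot_comm (b2 u v) (b1 u v)), b1_b1, b1_b2, b2_b2.
  destruct (half_angle u v) as [H _]. lra.
Qed.
Lemma e2_e2 u v : dot (e2 u v) (e2 u v) = 1.
Proof.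
  unfold e2. rewrite dot_rot, !(dot_comm _ (rot _ _ _ _)), !dot_rot, (dot_comm (b2 u v) (b1 u v)), b1_b1, b1_b2, b2_b2.
  destruct (half_angle u v) as [H _]. lra.
Qed.
Lemma e1_e2 u v : dot (e1 u v) (e2 u v) = 0.
Proof.
  unfold e1, e2. rewrite dot_rot, !(dot_comm _ (rot _ _ _ _)), !dot_rot, (dot_comm (b2 u v) (b1 u v)), b1_b1, b1_b2, b2_b2.
  ring.
Qed.
Lemma e1_N u v : dot (e1 u v) (unitN x u v) = 0.
Proof. unfold e1. rewrite dot_rot, b1_N, b2_N. ring. Qed.
Lemma e2_N u v : dot (e2 u v) (unitN x u v) = 0.
Proof. unfold e2. rewrite dot_rot, b1_N, b2_N. ring. Qed.

Lemma cross_e1_e2 u v : cross (e1 u v) (e2 u v) = unitN x u v.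
Proof.
  rewrite <- cross_b1_b2. unfold e1, e2. destruct (half_angle u v) as [H _].
  generalize dependent (c u v). generalize (s u v). intros ss cc H.
  generalize (b1 u v) (b2 u v). intros a b.
  unfold rot, vadd, cross, Defs.scal; simpl. f_equal.
  - transitivity ((cc ^ 2 + ss ^ 2) * (c2 a * c3 b - c3 a * c2 b)); [ring | rewrite H; ring].
  - transitivity ((cc ^ 2 + ss ^ 2) * (c3 a * Defs.c1 b - Defs.c1 a * c3 b)); [ring | rewrite H; ring].
  - transitivity ((cc ^ 2 + ss ^ 2) * (Defs.c1 a * c2 b - c2 a * Defs.c1 b)); [ring | rewrite H; ring].
Qed.

Lemma rotated_shape cc ss X1 X2 h r : cc ^ 2 + ss ^ 2 = 1 ->
  cc * - (X1 * (h + r * (cc ^ 2 - ss ^ 2)) + X2 * (r * (2 * ss * cc)))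
  + ss * - (X1 * (r * (2 * ss * cc)) + X2 * (h - r * (cc ^ 2 - ss ^ 2)))
  = - (h + r) * (cc * X1 + ss * X2) /\
  - ss * - (X1 * (h + r * (cc ^ 2 - ss ^ 2)) + X2 * (r * (2 * ss * cc)))
  + cc * - (X1 * (r * (2 * ss * cc)) + X2 * (h - r * (cc ^ 2 - ss ^ 2)))
  = - (h - r) * (- ss * X1 + cc * X2).
Proof.
  intros H. split.
  - transitivity (- h * (cc * X1 + ss * X2) - r * (cc ^ 2 + ss ^ 2) * (cc * X1 + ss * X2)); [ring | rewrite H; ring].
  - transitivity (- h * (- ss * X1 + cc * X2) + r * (cc ^ 2 + ss ^ 2) * (- ss * X1 + cc * X2)); [ring | rewrite H; ring].
Qed.

Lemma e_shape_u u v : dot (e1 u v) (dU (unitN x) u v) = - k1 u v * dot (e1 u v) (dU x u v) /\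
  dot (e2 u v) (dU (unitN x) u v) = - k2 u v * dot (e2 u v) (dU x u v).
Proof.
  unfold e1, e2, k1, k2. rewrite !dot_rot, !(dot_comm _ (dU (unitN x) u v)), !(dot_comm _ (dU x u v)), dU_unitN_b1, dU_unitN_b2.
  destruct (half_angle u v) as (H1 & H2 & H3). rewrite th_cos, th_sin, H2, H3. now apply rotated_shape.
Qed.
Lemma e_shape_v u v : dot (e1 u v) (dV (unitN x) u v) = - k1 u v * dot (e1 u v) (dV x u v) /\
  dot (e2 u v) (dV (unitN x) u v) = - k2 u v * dot (e2 u v) (dV x u v).
Proof.
  unfold e1, e2, k1, k2. rewrite !dot_rot, !(dot_comm _ (dV (unitN x) u v)), !(dot_comm _ (dV x u v)), dV_unitN_b1, dV_unitN_b2.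
  destruct (half_angle u v) as (H1 & H2 & H3). rewrite th_cos, th_sin, H2, H3. now apply rotated_shape.
Qed.

Lemma e_principal u v : II x u v (e1 u v) (e2 u v) = 0 /\
  II x u v (e1 u v) (e1 u v) > II x u v (e2 u v) (e2 u v).
Proof.
  destruct (e_shape_u u v) as [U1 U2]. destruct (e_shape_v u v) as [V1 V2].
  rewrite (II_principal u v (k2 u v) (e1 u v) (e2 u v) (e2_N u v) U2 V2).
  rewrite (II_principal u v (k1 u v) (e1 u v) (e1 u v) (e1_N u v) U1 V1).
  rewrite (II_principal u v (k2 u v) (e2 u v) (e2 u v) (e2_N u v) U2 V2).
  rewrite e1_e1, e2_e2, e1_e2. pose proof (sqrt_defect_pos u v). unfold k1, k2. split; lra.
Qed.

Let su u v := dot (e1 u v) (dU x u v).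
Let sv u v := dot (e1 u v) (dV x u v).

Lemma frame_dot u v y z : dot y z = dot y (e1 u v) * dot z (e1 u v) + dot y (e2 u v) * dot z (e2 u v)
  + dot y (unitN x u v) * dot z (unitN x u v).
Proof. rewrite (orthonormal_dot (e1 u v) (e2 u v) y z (e1_e1 u v) (e2_e2 u v) (e1_e2 u v)), cross_e1_e2. reflexivity. Qed.

Lemma k1_smooth : smooth2 k1.
Proof.
  apply smooth2_plus; [apply smooth_of_fun, meanH_fun; auto|].
  apply smooth2_sqrt; auto. apply smooth_of_fun, defect_fun; auto.
Qed.

(** By the Weingarten relation k1 = f(t) + sqrt t with t = H^2 - K, so that dk1 = (k1 - k2)
    log_factor'(t) dt. *)
Lemma pu_k1 u v : pu k1 u v = 2 * sqrt (defect x u v) * (log_factor' (defect x u v) * pu (defect x) u v).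
Proof.
  assert (Sd := smooth_of_fun _ (defect_fun x x_immersion)).
  unfold k1. rewrite pu_plus by (try apply smooth2_sqrt; auto; apply smooth_of_fun, meanH_fun; auto).
  rewrite (pu_meanH x f eps) by auto.
  replace (pu (fun u v => sqrt (defect x u v)) u v) with (pu (defect x) u v / (2 * sqrt (defect x u v))).
  - unfold log_factor'. field. pose proof (sqrt_defect_pos u v); lra.
  - symmetry. exact (is_derive_unique _ _ _ (is_derive_sqrt _ _ _ (smooth2_partial_u _ Sd u v) (defect_pos u v))).
Qed.
Lemma pv_k1 u v : pv k1 u v = 2 * sqrt (defect x u v) * (log_factor' (defect x u v) * pv (defect x) u v).
Proof.
  assert (Sd := smooth_of_fun _ (defect_fun x x_immersion)).
  unfold k1. rewrite pv_plus by (try apply smooth2_sqrt; auto; apply smooth_of_fun, meanH_fun; auto).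
  rewrite (pv_meanH x f eps) by auto.
  replace (pv (fun u v => sqrt (defect x u v)) u v) with (pv (defect x) u v / (2 * sqrt (defect x u v))).
  - unfold log_factor'. field. pose proof (sqrt_defect_pos u v); lra.
  - symmetry. exact (is_derive_unique _ _ _ (is_derive_sqrt _ _ _ (smooth2_partial_v _ Sd u v) (defect_pos u v))).
Qed.

Lemma su_smooth : smooth2 su.
Proof.
  destruct e1_smooth as (A1 & A2 & A3). destruct (smooth_of_vec _ (xu_vec x x_immersion)) as (B1 & B2 & B3).
  unfold su, dot. repeat apply smooth2_plus; apply smooth2_mult; assumption.
Qed.
Lemma sv_smooth : smooth2 sv.
Proof.
  destruct e1_smooth as (A1 & A2 & A3). destruct (smooth_of_vec _ (xv_vec x x_immersion)) as (B1 & B2 & B3).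
  unfold sv, dot. repeat apply smooth2_plus; apply smooth2_mult; assumption.
Qed.

(** The derivatives of e1 are orthogonal to e1, and those of x and N to N; so their products see
    only the e2 components, where the shape operator acts as k2. *)
Lemma Codazzi_principal u v : pv su u v - pu sv u v =
  log_factor' (defect x u v) * (pu (defect x) u v * sv u v - pv (defect x) u v * su u v).
Proof.
  assert (Se := e1_smooth). assert (SN := smooth_of_vec _ (unitN_vec x x_immersion)).
  assert (SNu := smooth_of_vec _ (torus_vec_dU _ (unitN_vec x x_immersion))).
  assert (SNv := smooth_of_vec _ (torus_vec_dV _ (unitN_vec x x_immersion))).
  assert (Sxu := smooth_of_vec _ (xu_vec x x_immersion)). assert (Sxv := smooth_of_vec _ (xv_vec x x_immersion)).
  assert (Sx := smooth_of_vec _ (x_vec x x_immersion)).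
  assert (Hperp : forall y z, dot y (e1 u v) = 0 -> dot z (unitN x u v) = 0 ->
     dot y z = dot y (e2 u v) * dot z (e2 u v)).
  { intros y z H1 H2. rewrite (frame_dot u v y z), H1, H2. ring. }
  assert (Hu0 : dot (dU e1 u v) (e1 u v) = 0).
  { pose proof (pu_dot e1 e1 u v Se Se) as H. rewrite (pu_ext _ (fun _ _ => 1)) in H by apply e1_e1.
    rewrite pu_const, (dot_comm (e1 u v)) in H. lra. }
  assert (Hv0 : dot (dV e1 u v) (e1 u v) = 0).
  { pose proof (pv_dot e1 e1 u v Se Se) as H. rewrite (pv_ext _ (fun _ _ => 1)) in H by apply e1_e1.
    rewrite pv_const, (dot_comm (e1 u v)) in H. lra. }
  assert (A1 : dot (dV e1 u v) (dU (unitN x) u v) = - k2 u v * dot (dV e1 u v) (dU x u v)).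
  { rewrite (Hperp _ _ Hv0 (dU_unitN_N x x_immersion u v)).
    rewrite (Hperp _ (dU x u v) Hv0) by (rewrite dot_comm; apply unitN_xu).
    rewrite !(dot_comm _ (e2 u v)), (proj2 (e_shape_u u v)). ring. }
  assert (A2 : dot (dU e1 u v) (dV (unitN x) u v) = - k2 u v * dot (dU e1 u v) (dV x u v)).
  { rewrite (Hperp _ _ Hu0 (dV_unitN_N x x_immersion u v)).
    rewrite (Hperp _ (dV x u v) Hu0) by (rewrite dot_comm; apply unitN_xv).
    rewrite !(dot_comm _ (e2 u v)), (proj2 (e_shape_v u v)). ring. }
  (* The relations e1.N_u = - k1 e1.x_u and e1.N_v = - k1 e1.x_v are differentiated crosswise. The
     common term e1.N_uv drops out, leaving (k1 - k2) tau = (k1)_u sv - (k1)_v su. *)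
  pose proof (pv_dot e1 (dU (unitN x)) u v Se SNu) as B1.
  pose proof (pu_dot e1 (dV (unitN x)) u v Se SNv) as B2.
  rewrite (pv_ext _ (fun u v => (-1) * (k1 u v * su u v))) in B1 by (intros a b; rewrite (proj1 (e_shape_u a b)); unfold su; ring).
  rewrite (pu_ext _ (fun u v => (-1) * (k1 u v * sv u v))) in B2 by (intros a b; rewrite (proj1 (e_shape_v a b)); unfold sv; ring).
  rewrite pv_mult, pv_mult, pv_const in B1 by auto using smooth2_const, smooth2_mult, k1_smooth, su_smooth.
  rewrite pu_mult, pu_mult, pu_const in B2 by auto using smooth2_const, smooth2_mult, k1_smooth, sv_smooth.
  rewrite (dV_dU_comm (unitN x) u v SN), A1 in B1. rewrite A2 in B2.
  pose proof (pv_dot e1 (dU x) u v Se Sxu) as D1. pose proof (pu_dot e1 (dV x) u v Se Sxv) as D2.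
  rewrite (dV_dU_comm x u v Sx) in D1. fold su in D1. fold sv in D2.
  change (pv su u v = dot (dV e1 u v) (dU x u v) + dot (e1 u v) (dU (dV x) u v)) in D1.
  change (pu sv u v = dot (dU e1 u v) (dV x u v) + dot (e1 u v) (dU (dV x) u v)) in D2.
  rewrite pv_k1 in B1. rewrite pu_k1 in B2.
  pose proof (sqrt_defect_pos u v) as Hs.
  assert (Hk : k1 u v - k2 u v = 2 * sqrt (defect x u v)) by (unfold k1, k2; ring).
  set (tau := dot (dV e1 u v) (dU x u v) - dot (dU e1 u v) (dV x u v)).
  assert (Htau : pv su u v - pu sv u v = tau) by (unfold tau; lra).
  apply (Rmult_eq_reg_l (2 * sqrt (defect x u v))); [|lra].
  rewrite <- Hk at 1. rewrite Htau in *. unfold tau in *. nra.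
Qed.

Let wgt u v := exp (log_factor (defect x u v)).
Let Pf u v := wgt u v * su u v.
Let Qf u v := wgt u v * sv u v.
Let Sf u v := pv (defect x) u v * (log_factor' (defect x u v) * wgt u v) * su u v + wgt u v * pv su u v.

Lemma is_derive_weight t : 0 < t ->
  is_derive (fun t => exp (log_factor t)) t (log_factor' t * exp (log_factor t)).
Proof. intros Ht. apply (is_derive_Rcomp exp log_factor); [apply is_derive_exp | now apply is_derive_log_factor]. Qed.

(** The logarithmic differential of [wgt] is dk1 / (k1 - k2), exactly what cancels the exterior
    derivative of the form e1.dx found in [Codazzi_principal]. *)
Lemma principal_form_closed : cont2 Pf /\ cont2 Qf /\ cont2 Sf /\ partial_v Pf Sf /\ partial_u Qf Sf.
Proof.
  assert (Td := defect_fun x x_immersion). assert (Sd := smooth_of_fun _ Td).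
  assert (Cd := smooth2_cont2 _ Sd).
  assert (Cw : cont2 wgt).
  { apply (cont2_comp (fun t => exp (log_factor t))); auto. intros u v.
    apply (ex_derive_continuous (fun t => exp (log_factor t))). eexists; apply is_derive_weight; auto. }
  assert (Cl : cont2 (fun u v => log_factor' (defect x u v))).
  { apply (cont2_comp log_factor'); auto. intros u v. apply continuous_log_factor'; auto. }
  assert (Cu := smooth2_cont2 _ su_smooth). assert (Cv := smooth2_cont2 _ sv_smooth).
  assert (Cdv := smooth2_cont2 _ (smooth2_pv _ Sd)). assert (Cuv := smooth2_cont2 _ (smooth2_pv _ su_smooth)).
  assert (Hwu : partial_u wgt (fun u v => pu (defect x) u v * (log_factor' (defect x u v) * wgt u v))).
  { apply (partial_u_comp (defect x) (pu (defect x)) (fun t => exp (log_factor t)) (fun t => log_factor' t * exp (log_factor t))).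
    - intros u v; apply is_derive_weight; auto.
    - apply smooth2_partial_u, Sd. }
  assert (Hwv : partial_v wgt (fun u v => pv (defect x) u v * (log_factor' (defect x u v) * wgt u v))).
  { apply (partial_v_comp (defect x) (pv (defect x)) (fun t => exp (log_factor t)) (fun t => log_factor' t * exp (log_factor t))).
    - intros u v; apply is_derive_weight; auto.
    - apply smooth2_partial_v, Sd. }
  split; [apply cont2_mult; auto|]. split; [apply cont2_mult; auto|].
  split; [|split].
  - apply cont2_plus; apply cont2_mult; auto. apply cont2_mult; auto. apply cont2_mult; auto.
  - apply partial_v_mult; auto. apply smooth2_partial_v, su_smooth.
  - intros u v.
    replace (Sf u v) with (pu (defect x) u v * (log_factor' (defect x u v) * wgt u v) * sv u v + wgt u v * pu sv u v).
    + exact (partial_u_mult wgt sv _ (pu sv) Hwu (smooth2_partial_u _ sv_smooth) u v).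
    + unfold Sf. replace (pv su u v) with (pu sv u v + (pv su u v - pu sv u v)) by ring.
      rewrite Codazzi_principal. ring.
Qed.

(** A tangent vector orthogonal to x_u and x_v would be zero, while e1 is a unit vector. *)
Lemma principal_form_nonzero u v : Pf u v <> 0 \/ Qf u v <> 0.
Proof.
  assert (Hw : wgt u v <> 0) by (unfold wgt; pose proof (exp_pos (log_factor (defect x u v))); lra).
  destruct (Req_dec (Pf u v) 0) as [H1|]; auto. destruct (Req_dec (Qf u v) 0) as [H2|]; auto. exfalso.
  unfold Pf, Qf in *. apply Rmult_integral in H1 as [|H1]; [contradiction|].
  apply Rmult_integral in H2 as [|H2]; [contradiction|]. unfold su, sv in *.
  pose proof (dot_decomposition x x_immersion u v (e1 u v) (e1 u v)) as H.
  rewrite e1_e1, H1, H2, e1_N in H. lra.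
Qed.

Hypothesis th_u : periodic2 (pu th).
Hypothesis th_v : periodic2 (pv th).

(** The periods d1, d2 of th have cosine 1 because (fp, fr) is periodic. Hence cos(d_i / 2) = 1 or
    -1 is the sign acquired by e1, e2 and the closed form, and [closed_form_untwisted] forces it to
    be 1. *)
Lemma principal_frame_periodic : periodic2 e1 /\ periodic2 e2.
Proof.
  destruct (quasiperiodic_constants th (pu th) (pv th) 1 1) as (d1 & d2 & Hd).
  { apply smooth2_partial_u, th_smooth. } { apply smooth2_partial_v, th_smooth. }
  { intros u v. rewrite (proj1 (th_u u v)), (proj1 (th_v u v)). split; ring. }
  { intros u v. rewrite (proj2 (th_u u v)), (proj2 (th_v u v)). split; ring. }
  assert (Hcs : forall u v u' v', fp u v = fp u' v' -> fr u v = fr u' v' -> defect x u v = defect x u' v' ->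
     cos (th u v - th u' v') = 1).
  { intros u v u' v' H1 H2 H3. rewrite th_cos, (th_cos u' v'), H3 in H1. rewrite th_sin, (th_sin u' v'), H3 in H2.
    pose proof (sqrt_defect_pos u' v') as Hs. apply Rmult_eq_reg_l in H1; [|lra]. apply Rmult_eq_reg_l in H2; [|lra].
    rewrite cos_minus, H1, H2. pose proof (sin2_cos2 (th u' v')) as H. unfold Rsqr in H. lra. }
  assert (Td := defect_fun x x_immersion).
  assert (Hhalf : forall d, cos d = 1 -> sin (d / 2) = 0 /\ cos (d / 2) ^ 2 = 1).
  { intros d H. replace d with (2 * (d / 2)) in H by field. rewrite cos_2a_sin in H.
    pose proof (sin2_cos2 (d / 2)) as H'. unfold Rsqr in H'.
    assert (Hs : sin (d / 2) * sin (d / 2) = 0) by lra.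
    split; [apply Rsqr_0_uniq; exact Hs | lra]. }
  assert (Hc1 : cos d1 = 1).
  { replace d1 with (th (0 + 1) 0 - th 0 0) by (rewrite (proj1 (Hd 0 0)); ring).
    exact (Hcs _ _ _ _ (proj1 (proj2 fp_fun 0 0)) (proj1 (proj2 fr_fun 0 0)) (proj1 (proj2 Td 0 0))). }
  assert (Hc2 : cos d2 = 1).
  { replace d2 with (th 0 (0 + 1) - th 0 0) by (rewrite (proj2 (Hd 0 0)); ring).
    exact (Hcs _ _ _ _ (proj2 (proj2 fp_fun 0 0)) (proj2 (proj2 fr_fun 0 0)) (proj2 (proj2 Td 0 0))). }
  destruct (Hhalf d1 Hc1) as [Z1 S1]. destruct (Hhalf d2 Hc2) as [Z2 S2].
  set (s1 := cos (d1 / 2)) in *. set (s2 := cos (d2 / 2)) in *.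
  assert (C1 : forall u v, c (u + 1) v = s1 * c u v /\ s (u + 1) v = s1 * s u v).
  { intros u v. unfold c, s. rewrite (proj1 (Hd u v)).
    replace ((1 * th u v + d1) / 2) with (th u v / 2 + d1 / 2) by field.
    rewrite cos_plus, sin_plus, Z1. fold s1. split; ring. }
  assert (C2 : forall u v, c u (v + 1) = s2 * c u v /\ s u (v + 1) = s2 * s u v).
  { intros u v. unfold c, s. rewrite (proj2 (Hd u v)).
    replace ((1 * th u v + d2) / 2) with (th u v / 2 + d2 / 2) by field.
    rewrite cos_plus, sin_plus, Z2. fold s2. split; ring. }
  destruct (torus_vec_elim _ b1_vec) as [_ Pb1]. destruct (torus_vec_elim _ b2_vec) as [_ Pb2].
  destruct (torus_vec_elim _ (xu_vec x x_immersion)) as [_ Pxu].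
  destruct (torus_vec_elim _ (xv_vec x x_immersion)) as [_ Pxv].
  destruct principal_form_closed as (K1 & K2 & K3 & K4 & K5).
  destruct (closed_form_untwisted Pf Qf Sf s1 s2 K1 K2 K3 K4 K5 principal_form_nonzero S1 S2) as [E1 E2].
  - intros u v. unfold Pf, Qf, wgt, su, sv, e1. rewrite !dot_rot.
    rewrite (proj1 (Pb1 u v)), (proj1 (Pb2 u v)), (proj1 (Pxu u v)), (proj1 (Pxv u v)), (proj1 (proj2 Td u v)).
    rewrite (proj1 (C1 u v)), (proj2 (C1 u v)). split; ring.
  - intros u v. unfold Pf, Qf, wgt, su, sv, e1. rewrite !dot_rot.
    rewrite (proj2 (Pb1 u v)), (proj2 (Pb2 u v)), (proj2 (Pxu u v)), (proj2 (Pxv u v)), (proj2 (proj2 Td u v)).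
    rewrite (proj1 (C2 u v)), (proj2 (C2 u v)). split; ring.
  - split; intros u v; unfold e1, e2.
    + rewrite (proj1 (Pb1 u v)), (proj1 (Pb2 u v)), (proj1 (C1 u v)), (proj2 (C1 u v)).
      rewrite (proj2 (Pb1 u v)), (proj2 (Pb2 u v)), (proj1 (C2 u v)), (proj2 (C2 u v)), E1, E2, !Rmult_1_l. auto.
    + rewrite (proj1 (Pb1 u v)), (proj1 (Pb2 u v)), (proj1 (C1 u v)), (proj2 (C1 u v)).
      rewrite (proj2 (Pb1 u v)), (proj2 (Pb2 u v)), (proj1 (C2 u v)), (proj2 (C2 u v)), E1, E2, !Rmult_1_l. auto.
Qed.

End Lift.

Theorem principal_frame_exists : exists e1 e2, positive_principal_frame x e1 e2.
Proof.
  assert (Tr : torus_fun (fun u v => sqrt (defect x u v))).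
  { apply torus_fun_sqrt; auto. apply defect_fun; auto. }
  assert (Hr : forall u v, sqrt (defect x u v) <> 0) by (intros u v; pose proof (sqrt_defect_pos u v); lra).
  destruct (angle_lift (fun u v => fp u v / sqrt (defect x u v)) (fun u v => fr u v / sqrt (defect x u v)))
    as (th & Sth & (_ & Pu) & (_ & Pv) & Hth).
  - apply torus_fun_div; auto. apply fp_fun.
  - apply torus_fun_div; auto. apply fr_fun.
  - intros u v. pose proof (fp_fr_norm u v) as H. pose proof (sqrt_sqrt (defect x u v) (Rlt_le _ _ (defect_pos u v))) as Hs.
    specialize (Hr u v).
    replace ((fp u v / sqrt (defect x u v)) ^ 2 + (fr u v / sqrt (defect x u v)) ^ 2)
      with ((fp u v ^ 2 + fr u v ^ 2) / (sqrt (defect x u v) * sqrt (defect x u v))) by (field; auto).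
    rewrite H, Hs. field. pose proof (defect_pos u v); lra.
  - assert (Hc : forall u v, fp u v = sqrt (defect x u v) * cos (th u v)).
    { intros u v. rewrite (proj1 (Hth u v)). field. auto. }
    assert (Hs : forall u v, fr u v = sqrt (defect x u v) * sin (th u v)).
    { intros u v. rewrite (proj2 (Hth u v)). field. auto. }
    destruct (principal_frame_periodic th Sth Hc Hs Pu Pv) as [P1 P2].
    exists (e1 th), (e2 th).
    split; [apply e1_smooth; auto|]. split; [apply e2_smooth; auto|]. split; auto. split; auto.
    intros u v. split; [apply e1_e1|]. split; [apply e2_e2|]. split; [apply e1_e2|].
    split; [apply cross_e1_e2|]. apply e_principal; auto.
Qed.

End Frame.

Theorem theorem7 (x : R -> R -> V3) (f : R -> R) (eps : R) :
  torus_immersion x -> 0 < eps -> smooth_on_ray eps f ->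
  (forall u v : R, meanH x u v = f (meanH x u v ^ 2 - gaussK x u v)) ->
  (forall u v : R, ~ umbilic x u v) /\
  exists e1 e2 : R -> R -> V3, positive_principal_frame x e1 e2.
Proof.
  intros Hx He Hf HW.
  assert (Hno : forall u v, ~ umbilic x u v).
  { intros u v Hu. apply (torus_not_totally_umbilic x Hx).
    apply (umbilic_everywhere x f eps Hx He Hf HW). eauto. }
  split; auto.
  apply (principal_frame_exists x f eps Hx He Hf HW).
  intros u v. pose proof (defect_nonneg x Hx u v).
  destruct (Req_dec (defect x u v) 0) as [H0|]; [|lra].
  exfalso. apply (Hno u v). now apply umbilic_iff.
Qed.
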